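(* Let $\mathcal{A}$ be a unital C$^*$-algebra with the local lifting property (LLP). Then either $\mathcal{A}$ has an amenable trace or there is no unital $*$-homomorphism $\pi:\mathcal{A}\to\mathcal{R}^{\omega}$.
   Context: A tracial state $\tau$ on a C$^*$-algebra $\mathcal{A}\subseteq B(H)$ is called amenable (an amenable trace) if there is a state $\rho$ on $B(H)$ with $\rho|_{\mathcal{A}}=\tau$ and $\rho(aT)=\rho(Ta)$ for all $T\in B(H)$, $a\in\mathcal{A}$; this does not depend on the faithful representation of $\mathcal{A}$. $\mathcal{R}$ is the hyperfinite $\mathrm{II}_1$ factor, $\omega$ is a free ultrafilter on the positive integers, and $\mathcal{R}^\omega$ is the corresponding tracial ultrapower, i.e. $\ell^\infty(\mathcal{R})/I$ with $I=\{(x_k):\lim_{k\to\omega}\|x_k\|_2=0\}$. A unital C$^*$-algebra (more generally an operator system) $\mathcal{S}$ has the LLP if, for every unital C$^*$-algebra $\mathcal{C}$ with closed two-sided ideal $J$, every unital completely positive (UCP) map $\phi:\mathcal{S}\to\mathcal{C}/J$ and every finite-dimensional operator subsystem $\mathcal{T}\subseteq\mathcal{S}$, there is a UCP map $\psi:\mathcal{T}\to\mathcal{C}$ with $q\circ\psi=\phi|_{\mathcal{T}}$, where $q:\mathcal{C}\to\mathcal{C}/J$ is the quotient map. *)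

(* Defs.v *)
From HB Require Import structures.
From mathcomp Require Import all_boot all_order all_algebra.
From mathcomp Require Import generic_quotient ring_quotient sesquilinear.
From mathcomp Require Import complex ring lra.
From mathcomp Require Import boolp classical_sets functions reals topology.
From mathcomp Require Import normedtype sequences.

Set Implicit Arguments.
Unset Strict Implicit.
Unset Printing Implicit Defensive.
Import Order.TTheory GRing.Theory Num.Theory.
Import numFieldNormedType.Exports.
Local Open Scope classical_set_scope.
Local Open Scope complex_scope.
Local Open Scope ring_scope.

HB.mixin Record Algebra_hasStar (R : realType) A of GRing.Algebra R[i] A := {
  star : A -> A;
  starK : involutive star;
  starD : {morph star : x y / x + y};
  starZ : forall (c : R[i]) x, star (c *: x) = c^* *: star x;
  starM : forall x y, star (x * y) = star y * star x
}.
#[short(type="starAlgType")]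
HB.structure Definition StarAlgebra (R : realType) :=
  {A of Algebra_hasStar R A & GRing.Algebra R[i] A}.

(* The norm is a real-valued operation of its own, with sequential completeness:
   a structure inheriting from both GRing.Algebra and NormedModule would be a
   second join of rings and normed modules besides Num.NumDomain, which HB
   rejects. *)
HB.mixin Record StarAlgebra_isCStar (R : realType) A of StarAlgebra R A := {
  cnorm : A -> R;
  cnorm_triangle : forall x y, cnorm (x + y) <= cnorm x + cnorm y;
  cnormZ : forall (c : R[i]) x, (cnorm (c *: x))%:C = `|c| * (cnorm x)%:C;
  cnorm_eq0 : forall x, cnorm x = 0 -> x = 0;
  cnormM : forall x y, cnorm (x * y) <= cnorm x * cnorm y;
  cnorm_star_mul : forall x, cnorm (star x * x) = cnorm x ^+ 2;
  cnorm_complete : forall u : nat -> A,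
    (forall e : R, 0 < e -> exists N, forall m n, (N <= m)%N -> (N <= n)%N ->
       cnorm (u m - u n) < e) ->
    exists l, cnorm (u n - l) @[n --> \oo] --> 0
}.
#[short(type="cstarAlgType")]
HB.structure Definition CStarAlgebra (R : realType) :=
  {A of StarAlgebra R A & StarAlgebra_isCStar R A}.

HB.mixin Record CompleteNormedModule_isHilbert (R : realType) H
    of CompleteNormedModule R[i] H := {
  inner : {dot H for (@Num.conj R[i])};
  normE_inner : forall x : H, `|x| ^+ 2 = inner x x
}.
#[short(type="hilbertType")]
HB.structure Definition Hilbert (R : realType) :=
  {H of CompleteNormedModule R[i] H & CompleteNormedModule_isHilbert R H}.


Section CStarTheory.
Variables (R : realType) (A : cstarAlgType R).
Implicit Types x y : A.

Lemma star0 (D : starAlgType R) : star 0 = 0 :> D.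
Proof. by apply: (addrI (star 0)); rewrite -starD !addr0. Qed.

Lemma starN (D : starAlgType R) (x : D) : star (- x) = - star x.
Proof. by apply: (addrI (star x)); rewrite -starD !subrr star0. Qed.

Lemma starB (D : starAlgType R) (x y : D) : star (x - y) = star x - star y.
Proof. by rewrite starD starN. Qed.

Lemma star1 (D : starAlgType R) : star 1 = 1 :> D.
Proof. by rewrite -[LHS]mulr1 -{2}[1](@starK R D) -starM mulr1 starK. Qed.

Lemma cnorm0 : cnorm (0 : A) = 0.
Proof.
by apply: complexI; rewrite -[X in cnorm X](scale0r 0) cnormZ normr0 mul0r.
Qed.

Lemma cnormN x : cnorm (- x) = cnorm x.
Proof. by apply: complexI; rewrite -scaleN1r cnormZ normrN1 mul1r. Qed.

Lemma cnorm_ge0 x : 0 <= cnorm x.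
Proof.
have := cnorm_triangle x (- x); rewrite subrr cnorm0 cnormN -mulr2n.
by rewrite pmulrn_lge0.
Qed.

Lemma le_cnorm_star x : cnorm x <= cnorm (star x).
Proof.
have [->|x0] := eqVneq (cnorm x) 0; first exact: cnorm_ge0.
have xp : 0 < cnorm x by rewrite lt_def x0 cnorm_ge0.
by rewrite -(ler_pM2r xp) -expr2 -cnorm_star_mul cnormM.
Qed.

Lemma cnorm_star x : cnorm (star x) = cnorm x.
Proof.
by apply/eqP; rewrite eq_le le_cnorm_star andbT -{2}[x]starK le_cnorm_star.
Qed.

End CStarTheory.

(* Rings of type algType are nonzero, hence the restriction to proper ideals.
   Closed two-sided ideals of C*-algebras are automatically star-invariant. *)
Record star_ideal (R : realType) (D : starAlgType R) := StarIdeal {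
  ideal_set :> D -> Prop;
  ideal0 : ideal_set 0;
  idealB : forall x y, ideal_set x -> ideal_set y -> ideal_set (x - y);
  idealMl : forall a x, ideal_set x -> ideal_set (a * x);
  idealMr : forall a x, ideal_set x -> ideal_set (x * a);
  ideal_star : forall x, ideal_set x -> ideal_set (star x);
  ideal_proper : ~ ideal_set 1
}.

Section StarQuotient.
Variables (R : realType) (D : starAlgType R) (J : star_ideal D).

Definition ideal_pred : {pred D} := fun x => `[< J x >].

Lemma ideal_zmod_closed : zmod_closed ideal_pred.
Proof.
split; first exact/asboolP/ideal0.
by move=> x y /asboolP Jx /asboolP Jy; exact/asboolP/idealB.
Qed.
HB.instance Definition _ := GRing.isZmodClosed.Build D ideal_pred
  ideal_zmod_closed.

Definition star_quot := Quotient.quot ideal_pred.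
HB.instance Definition _ := GRing.Zmodule.on star_quot.
HB.instance Definition _ := EqQuotient.on star_quot.

Definition qpi (x : D) : star_quot := \pi_(Quotient.quot ideal_pred)%qT x.

Lemma qpiP x y : qpi x = qpi y <-> J (x - y).
Proof.
rewrite /qpi; split=> [/eqP|Jxy].
  by rewrite -Quotient.idealrBE => /asboolP.
by apply/eqP; rewrite -Quotient.idealrBE; exact/asboolP.
Qed.

Lemma qpi_surj (X : star_quot) : exists x, X = qpi x.
Proof. by exists (repr X); rewrite /qpi reprK. Qed.

Lemma qpiD x y : qpi (x + y) = qpi x + qpi y.
Proof. by rewrite /qpi Quotient.pi_add. Qed.

Lemma qpi_repr x : J (repr (qpi x) - x).
Proof. by apply/qpiP; rewrite /qpi reprK. Qed.

Definition qone : star_quot := qpi 1.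
Definition qmul (X Y : star_quot) : star_quot := qpi (repr X * repr Y).
Definition qscale (c : R[i]) (X : star_quot) : star_quot := qpi (c *: repr X).
Definition qstar (X : star_quot) : star_quot := qpi (star (repr X)).

Lemma idealD x y : J x -> J y -> J (x + y).
Proof.
move=> Jx Jy; rewrite -[y]opprK; apply: idealB => //.
by rewrite -sub0r; apply: idealB => //; exact: ideal0.
Qed.

Lemma qpiM x y : qpi (x * y) = qmul (qpi x) (qpi y).
Proof.
apply/esym/qpiP; set x' := repr _; set y' := repr _.
rewrite (_ : _ - _ = x' * (y' - y) + (x' - x) * y); last first.
  by rewrite mulrBr mulrBl addrA addrNK.
by apply: idealD; [apply: idealMl|apply: idealMr]; exact: qpi_repr.
Qed.

Lemma qpiZ c x : qpi (c *: x) = qscale c (qpi x).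
Proof.
apply/esym/qpiP; rewrite -scalerBr -mulr_algl.
by apply: idealMl; exact: qpi_repr.
Qed.

Lemma qpi_star x : qpi (star x) = qstar (qpi x).
Proof.
by apply/esym/qpiP; rewrite -starB; apply: ideal_star; exact: qpi_repr.
Qed.

Lemma qmulA : associative qmul.
Proof.
move=> X Y Z; have [x ->] := qpi_surj X; have [y ->] := qpi_surj Y.
by have [z ->] := qpi_surj Z; rewrite -!qpiM mulrA.
Qed.

Lemma qmul1 : left_id qone qmul.
Proof. by move=> X; have [x ->] := qpi_surj X; rewrite -!qpiM mul1r. Qed.

Lemma qmulr1 : right_id qone qmul.
Proof. by move=> X; have [x ->] := qpi_surj X; rewrite -!qpiM mulr1. Qed.

Lemma qmulDl : left_distributive qmul +%R.
Proof.
move=> X Y Z; have [x ->] := qpi_surj X; have [y ->] := qpi_surj Y.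
by have [z ->] := qpi_surj Z; rewrite -qpiD -!qpiM -qpiD mulrDl.
Qed.

Lemma qmulDr : right_distributive qmul +%R.
Proof.
move=> X Y Z; have [x ->] := qpi_surj X; have [y ->] := qpi_surj Y.
by have [z ->] := qpi_surj Z; rewrite -qpiD -!qpiM -qpiD mulrDr.
Qed.

Lemma qpi0 : qpi 0 = 0.
Proof. by apply: (addrI (qpi 0)); rewrite -qpiD !addr0. Qed.

Lemma qone_neq0 : qone != 0.
Proof.
by apply/eqP; rewrite /qone -qpi0 => /qpiP; rewrite subr0; exact: ideal_proper.
Qed.

HB.instance Definition _ := GRing.Zmodule_isNzRing.Build star_quot
  qmulA qmul1 qmulr1 qmulDl qmulDr qone_neq0.

Lemma qscaleA a b X : qscale a (qscale b X) = qscale (a * b) X.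
Proof. by have [x ->] := qpi_surj X; rewrite -!qpiZ scalerA. Qed.

Lemma qscale1 : left_id 1 qscale.
Proof. by move=> X; have [x ->] := qpi_surj X; rewrite -qpiZ scale1r. Qed.

Lemma qscaleDr : right_distributive qscale +%R.
Proof.
move=> c X Y; have [x ->] := qpi_surj X; have [y ->] := qpi_surj Y.
by rewrite -qpiD -!qpiZ -qpiD scalerDr.
Qed.

Lemma qscaleDl X : {morph qscale^~ X : a b / a + b}.
Proof.
by move=> a b; have [x ->] := qpi_surj X; rewrite -!qpiZ -qpiD scalerDl.
Qed.

HB.instance Definition _ := GRing.Zmodule_isLmodule.Build R[i] star_quot
  qscaleA qscale1 qscaleDr qscaleDl.

Lemma qscaleAl (a : R[i]) (X Y : star_quot) : a *: (X * Y) = (a *: X) * Y.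
Proof.
have [x ->] := qpi_surj X; have [y ->] := qpi_surj Y.
rewrite -[qpi x * _]qpiM -[a *: qpi x]qpiZ.
by rewrite -[LHS]qpiZ -[RHS]qpiM scalerAl.
Qed.

HB.instance Definition _ := GRing.Lmodule_isLalgebra.Build R[i] star_quot
  qscaleAl.

Lemma qscaleAr (a : R[i]) (X Y : star_quot) : a *: (X * Y) = X * (a *: Y).
Proof.
have [x ->] := qpi_surj X; have [y ->] := qpi_surj Y.
rewrite -[qpi x * qpi y]qpiM -[a *: qpi y]qpiZ.
by rewrite -[LHS]qpiZ -[RHS]qpiM scalerAr.
Qed.

HB.instance Definition _ := GRing.Lalgebra_isAlgebra.Build R[i] star_quot
  qscaleAr.

Lemma qstarK : involutive qstar.
Proof. by move=> X; have [x ->] := qpi_surj X; rewrite -!qpi_star starK. Qed.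

Lemma qstarD : {morph qstar : X Y / X + Y}.
Proof.
move=> X Y; have [x ->] := qpi_surj X; have [y ->] := qpi_surj Y.
by rewrite -qpiD -!qpi_star -qpiD starD.
Qed.

Lemma qstarZ (c : R[i]) (X : star_quot) : qstar (c *: X) = c^* *: qstar X.
Proof.
have [x ->] := qpi_surj X.
by rewrite -[c *: _]qpiZ -!qpi_star -[RHS]qpiZ starZ.
Qed.

Lemma qstarM (X Y : star_quot) : qstar (X * Y) = qstar Y * qstar X.
Proof.
have [x ->] := qpi_surj X; have [y ->] := qpi_surj Y.
by rewrite -[_ * _]qpiM -!qpi_star -[RHS]qpiM starM.
Qed.

HB.instance Definition _ := Algebra_hasStar.Build R star_quot
  qstarK qstarD qstarZ qstarM.

End StarQuotient.

Section CompletePositivity.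
Variable R : realType.

(* The positive cone of M_n(D) is {Y^* Y}; for D a C*-algebra or a quotient of
   one, these are exactly the positive elements of the C*-algebra M_n(D). *)
Definition mx_positive (D : starAlgType R) n (X : 'M[D]_n) : Prop :=
  exists Y : 'M[D]_n, X = (map_mx star Y)^T *m Y.

(* UCP maps on an operator subsystem S of A are given by functions on A of which
   only the restriction to S is considered. *)
Record ucp_on (A D : starAlgType R) (S : set A) (phi : A -> D) : Prop := {
  ucp_linear : forall (c : R[i]) x y, S x -> S y ->
    phi (c *: x + y) = c *: phi x + phi y;
  ucp_unital : phi 1 = 1;
  ucp_cp : forall n (X : 'M[A]_n), (forall i j, S (X i j)) ->
    mx_positive X -> mx_positive (map_mx phi X)
}.

Definition finite_dim (V : lmodType R[i]) (S : set V) : Prop :=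
  exists n (e : 'I_n -> V), forall x, S x ->
    exists c : 'I_n -> R[i], x = \sum_i c i *: e i.

Record operator_subsystem (A : starAlgType R) (S : set A) : Prop := {
  opsys1 : S 1;
  opsys_linear : forall (c : R[i]) x y, S x -> S y -> S (c *: x + y);
  opsys_star : forall x, S x -> S (star x)
}.

Definition closed_ideal (C : cstarAlgType R) (J : star_ideal C) : Prop :=
  forall (u : nat -> C) l, (forall n, J (u n)) ->
    cnorm (u n - l) @[n --> \oo] --> 0 -> J l.

Definition LLP (A : cstarAlgType R) : Prop :=
  forall (C : cstarAlgType R) (J : star_ideal C), closed_ideal J ->
  forall phi : A -> star_quot J, ucp_on setT phi ->
  forall T : set A, operator_subsystem T -> finite_dim T ->
  exists psi : A -> C,
    ucp_on T psi /\ forall x, T x -> qpi J (psi x) = phi x.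

End CompletePositivity.

Section Operators.
Variables (R : realType) (H : hilbertType R).

Definition bounded_op (T : H -> H) : Prop := linear T /\ continuous T.

Definition commutant (S : set (H -> H)) : set (H -> H) :=
  [set T | bounded_op T /\ forall X, S X -> T \o X = X \o T].

Record BH_state (rho : (H -> H) -> R[i]) : Prop := {
  BH_state_linear : forall (c : R[i]) S T, bounded_op S -> bounded_op T ->
    rho (fun v => c *: S v + T v) = c * rho S + rho T;
  BH_state_positive : forall T, bounded_op T ->
    (forall v, 0 <= inner (T v) v) -> 0 <= rho T;
  BH_state_unital : rho id = 1
}.

(* Realisation of A as a unital C*-subalgebra of B(H). Since *-homomorphisms of
   C*-algebras are isometric as soon as they are injective, these are exactly
   the faithful unital *-representations of A on H. *)
Record faithful_rep (A : cstarAlgType R) (sigma : A -> H -> H) : Prop := {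
  rep_bounded : forall a, bounded_op (sigma a);
  rep_linear : forall (c : R[i]) a b v,
    sigma (c *: a + b) v = c *: sigma a v + sigma b v;
  rep_unital : sigma 1 = id;
  rep_mul : forall a b, sigma (a * b) = sigma a \o sigma b;
  rep_star : forall a u v, inner (sigma a u) v = inner u (sigma (star a) v);
  rep_isometric : forall a (K : R), 0 <= K ->
    cnorm a <= K <-> forall v, `|sigma a v| <= K%:C * `|v|
}.

End Operators.

Section Traces.
Variables (R : realType) (A : cstarAlgType R).

Record tracial_state (tau : {scalar A}) : Prop := {
  trace_positive : forall x, 0 <= tau (star x * x);
  trace_unital : tau 1 = 1;
  trace_comm : forall x y, tau (x * y) = tau (y * x)
}.

(* Amenability does not depend on the faithful representation A <= B(H) in which
   it is tested; the definition asks for the state in each of them. *)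
Definition amenable_trace (tau : {scalar A}) : Prop :=
  tracial_state tau /\
  forall (H : hilbertType R) (sigma : A -> H -> H), faithful_rep sigma ->
  exists rho : (H -> H) -> R[i],
    [/\ BH_state rho,
        forall a, rho (sigma a) = tau a &
        forall a T, bounded_op T -> rho (sigma a \o T) = rho (T \o sigma a)].

End Traces.

Section VonNeumann.
Variables (R : realType) (M : cstarAlgType R) (H : hilbertType R).
Variable iota : M -> H -> H.

Definition von_neumann_rep : Prop :=
  faithful_rep iota /\ commutant (commutant (range iota)) = range iota.

Definition trivial_center : Prop :=
  forall z : M, (forall x, z * x = x * z) -> exists c : R[i], z = c%:A.

(* sigma-weak continuity on iota(M): tau is a functional x |-> sum_i <x xi_i, eta_i> with
   square summable xi and eta *)
Definition normal_functional (tau : M -> R[i]) : Prop :=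
  exists (xi eta : nat -> H) (K : R),
    [/\ forall n, \sum_(i < n) `|xi i| ^+ 2 <= K%:C,
        forall n, \sum_(i < n) `|eta i| ^+ 2 <= K%:C &
        forall x,
          \sum_(i < n) inner (iota x (xi i)) (eta i) @[n --> \oo]
            --> (tau x : (R[i] : numFieldType))].

Record star_subalgebra (N : set M) : Prop := {
  subalg_opsys : operator_subsystem N;
  subalg_mul : forall x y, N x -> N y -> N (x * y)
}.

(* M is generated, as a von Neumann algebra, by an increasing sequence of
   finite-dimensional unital *-subalgebras. *)
Definition hyperfinite : Prop :=
  exists N : nat -> set M,
    [/\ forall n, star_subalgebra (N n) /\ finite_dim (N n),
        forall n, N n `<=` N n.+1 &
        commutant (commutant (iota @` (\bigcup_n N n))) = range iota].

End VonNeumann.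

(* The hyperfinite II_1 factor is unique up to isomorphism, and so is its tracial
   state; this is the type of its concrete realisations M'' = M in some B(H). *)
Record hyperfinite_II1_factor (R : realType) := HyperfiniteII1 {
  factor_alg :> cstarAlgType R;
  factor_space : hilbertType R;
  factor_rep : factor_alg -> factor_space -> factor_space;
  factor_von_neumann : von_neumann_rep factor_rep;
  factor_center : trivial_center factor_alg;
  factor_infinite : ~ finite_dim [set: factor_alg];
  factor_trace : {scalar factor_alg};
  factor_tracial : tracial_state factor_trace;
  factor_faithful : forall x, factor_trace (star x * x) = 0 -> x = 0;
  factor_normal : normal_functional factor_rep factor_trace;
  factor_hyperfinite : hyperfinite factor_rep
}.

Section BoundedSequences.
Variables (R : realType) (M : cstarAlgType R).

Definition bounded_seq : {pred nat -> M} :=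
  fun x => `[< exists K : R, forall k, cnorm (x k) <= K >].

Lemma bounded_seqP (x : nat -> M) :
  reflect (exists K : R, forall k, cnorm (x k) <= K) (x \in bounded_seq).
Proof. exact: asboolP. Qed.

Lemma bounded_seq_zmod : zmod_closed bounded_seq.
Proof.
split=> [|x y /bounded_seqP[K xK] /bounded_seqP[L yL]]; apply/bounded_seqP.
  by exists 0 => k; rewrite cnorm0.
exists (K + L) => k; rewrite (le_trans (cnorm_triangle _ _))//.
by rewrite cnormN lerD.
Qed.

Lemma bounded_seq_mul : mulr_closed bounded_seq.
Proof.
split=> [|x y /bounded_seqP[K xK] /bounded_seqP[L yL]]; apply/bounded_seqP.
  by exists (cnorm (1 : M)).
exists (K * L) => k; rewrite (le_trans (cnormM _ _))//.
by rewrite ler_pM ?cnorm_ge0.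
Qed.

Lemma bounded_seq_scale : GRing.scaler_closed (bounded_seq : {pred nat -> M}).
Proof.
move=> c x /bounded_seqP[K xK]; apply/bounded_seqP.
exists (complex.Re `|c| * K) => k.
have cE : `|c| = (complex.Re `|c|)%:C by rewrite RRe_real// normr_real.
have -> : cnorm ((c *: x) k) = complex.Re `|c| * cnorm (x k).
  by apply: complexI; rewrite cnormZ [in LHS]cE -rmorphM.
apply: ler_wpM2l; last exact: xK.
by rewrite -ler0c -cE.
Qed.

HB.instance Definition _ := GRing.isZmodClosed.Build _ bounded_seq
  bounded_seq_zmod.
HB.instance Definition _ := GRing.isMulClosed.Build _ bounded_seq
  bounded_seq_mul.
HB.instance Definition _ := GRing.isScaleClosed.Build R[i] _ bounded_seq
  bounded_seq_scale.

Record linf := Linf { linf_seq :> nat -> M; _ : linf_seq \in bounded_seq }.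
HB.instance Definition _ := [isSub for linf_seq].
HB.instance Definition _ := [Choice of linf by <:].
HB.instance Definition _ := [SubChoice_isSubZmodule of linf by <:].
HB.instance Definition _ := [SubZmodule_isSubNzRing of linf by <:].
HB.instance Definition _ := [SubZmodule_isSubLmodule of linf by <:].

Lemma linf_scaleAl (a : R[i]) (x y : linf) : a *: (x * y) = (a *: x) * y.
Proof. by apply: val_inj; apply/funext => k /=; exact: scalerAl. Qed.
HB.instance Definition _ := GRing.Lmodule_isLalgebra.Build R[i] linf
  linf_scaleAl.

Lemma linf_scaleAr (a : R[i]) (x y : linf) : a *: (x * y) = x * (a *: y).
Proof. by apply: val_inj; apply/funext => k /=; exact: scalerAr. Qed.
HB.instance Definition _ := GRing.Lalgebra_isAlgebra.Build R[i] linf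
  linf_scaleAr.

Lemma bounded_seq_star (x : linf) : (fun k => star (x k)) \in bounded_seq.
Proof.
case: x => x /= /bounded_seqP[K xK]; apply/bounded_seqP.
by exists K => k; rewrite cnorm_star.
Qed.
Definition linf_star (x : linf) : linf := Linf (bounded_seq_star x).

Lemma linf_starK : involutive linf_star.
Proof. by move=> x; apply: val_inj; apply/funext => k /=; rewrite starK. Qed.

Lemma linf_starD : {morph linf_star : x y / x + y}.
Proof. by move=> x y; apply: val_inj; apply/funext => k /=; exact: starD. Qed.

Lemma linf_starZ (c : R[i]) x : linf_star (c *: x) = c^* *: linf_star x.
Proof. by apply: val_inj; apply/funext => k /=; exact: starZ. Qed.

Lemma linf_starM x y : linf_star (x * y) = linf_star y * linf_star x.
Proof. by apply: val_inj; apply/funext => k /=; exact: starM. Qed.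

HB.instance Definition _ := Algebra_hasStar.Build R linf
  linf_starK linf_starD linf_starZ linf_starM.

End BoundedSequences.

Section TracialUltrapower.
Variables (R : realType) (M : hyperfinite_II1_factor R).
Variables (omega : set_system nat) (omega_ultra : UltraFilter omega).
Local Notation tau := (factor_trace M).

Definition norm2 (x : M) : R := Num.sqrt (complex.Re (tau (star x * x))).

Definition null_seq (x : linf M) : Prop :=
  norm2 (x k) @[k --> omega] --> (0 : R).

Let sq (x : M) : R := complex.Re (tau (star x * x)).

Let sqE x : tau (star x * x) = (sq x)%:C.
Proof.
by rewrite /sq RRe_real// ger0_real// trace_positive//; exact: factor_tracial.
Qed.

Let sq_ge0 x : 0 <= sq x.
Proof. by rewrite -ler0c -sqE trace_positive//; exact: factor_tracial. Qed.

Let sq0 : sq 0 = 0.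
Proof. by rewrite /sq mulr0 linear0. Qed.

Let sqB_expand x y : tau (star (x - y) * (x - y)) =
  tau (star x * x) + tau (star y * y) - (tau (star x * y) + tau (star y * x)).
Proof. rewrite starB mulrBl !mulrBr !linearB /=; ring. Qed.

Let sqN x : sq (- x) = sq x.
Proof. by rewrite /sq starN mulrNN. Qed.

Let sqB x y : sq (x - y) <= 2 * sq x + 2 * sq y.
Proof.
suff -> : 2 * sq x + 2 * sq y = sq (x - y) + sq (x + y) by rewrite lerDl.
apply: complexI; rewrite !rmorphD !rmorphM /= -!sqE -[in x + y](opprK y).
rewrite !sqB_expand !starN !mulNr !mulrN !linearN /= opprK.
by rewrite (rmorphMn _ 2 1); ring.
Qed.

Let sq_star x : sq (star x) = sq x.
Proof. by rewrite /sq starK (trace_comm (factor_tracial M)). Qed.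

Let inner_bound (u v : factor_space M) :
  `|inner u v| <= `|u| ^+ 2 + `|v| ^+ 2.
Proof.
have [->|c0] := eqVneq (inner u v) 0.
  by rewrite normr0 addr_ge0// exprn_ge0.
pose a := inner u v / `|inner u v|.
have a1 : a * a^* = 1.
  by rewrite -normCK normrM normfV normr_id divff ?expr1n// normr_eq0.
have dE : inner u (a *: v) = `|inner u v|.
  rewrite linearZr_LR /= /a rmorphM fmorphV/= (CrealP (normr_real _)).
  by rewrite mulrAC [_^* * _]mulrC -normCK expr2 mulfK// normr_eq0.
have : 0 <= inner (u - a *: v) (u - a *: v) by exact: dnorm_ge0.
rewrite dnormB dnormZ normCK a1 mul1r -!normE_inner dE.
rewrite (CrealP (normr_real _)) subr_ge0; apply: le_trans.
by rewrite lerDl.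
Qed.

Let tau_bound : exists K : R, 0 <= K /\ forall x, `|tau x| <= (K * cnorm x)%:C.
Proof.
have [xi [eta [K [xiK etaK tauE]]]] := factor_normal M.
have K0 : 0 <= K.
  by rewrite -ler0c (le_trans _ (xiK 0%N))// big_ord0.
have [repH _] := factor_von_neumann M.
have tau1 x : cnorm x <= 1 -> `|tau x| <= (K + K)%:C.
  move=> x1; apply/ler_addgt0Pr => e e0.
  have := tauE x; move/cvgrPdist_lt => /(_ e e0) [N _ /(_ N (leqnn N))] /=.
  move=> tN; rewrite -[tau x](subrK (\sum_(i < N) inner (factor_rep x (xi i)) (eta i))).
  rewrite (le_trans (ler_normD _ _))// addrC lerD//; last exact/ltW/tN.
  rewrite (le_trans (ler_norm_sum _ _ _))// rmorphD/=.
  rewrite (le_trans _ (lerD (xiK N) (etaK N)))// -big_split/=.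
  apply: ler_sum => i _; rewrite (le_trans (inner_bound _ _))// lerD2r.
  rewrite ler_pXn2r ?nnegrE//.
  by have /(_ x1 (xi i)) := proj1 (rep_isometric repH x ler01); rewrite mul1r.
exists (K + K); split; first exact: addr_ge0.
move=> x; have [x0|x0] := eqVneq (cnorm x) 0.
  by rewrite (cnorm_eq0 _ x0) linear0 normr0 cnorm0 mulr0.
have xp : 0 < cnorm x by rewrite lt_def x0 cnorm_ge0.
have xpC : 0 < (cnorm x)%:C :> R[i] by rewrite ltcR.
have := tau1 ((cnorm x)%:C^-1 *: x).
rewrite linearZ /= normrM normfV (gtr0_norm xpC) ler_pdivrMl// => tx.
rewrite rmorphM/= mulrC; apply: tx.
rewrite -lecR cnormZ normfV (gtr0_norm xpC) mulVf//.
by rewrite gt_eqF.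
Qed.

Let sqM_bound : exists K : R, 0 <= K /\ forall (x y : M) (e : R), 0 < e ->
  2 * e * sq (x * y) <= e ^+ 2 * (K * (cnorm x ^+ 2 * cnorm y) ^+ 2) + sq y.
Proof.
have [K [K0 tauK]] := tau_bound.
exists K; split=> // x y e e0; pose a := star x * (x * y).
have sqa : sq a <= K * (cnorm x ^+ 2 * cnorm y) ^+ 2.
  have := tauK (star a * a).
  rewrite ger0_norm ?sqE ?ler0c// lecR => /le_trans; apply.
  rewrite ler_wpM2l// cnorm_star_mul; apply: lerXn2r.
  - by rewrite nnegrE cnorm_ge0.
  - by rewrite nnegrE mulr_ge0 ?sqr_ge0 ?cnorm_ge0.
  - by rewrite /a mulrA (le_trans (cnormM _ _))// cnorm_star_mul.
rewrite -subr_ge0.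
suff : 0 <= e ^+ 2 * sq a + sq y - 2 * e * sq (x * y).
  move=> h; rewrite (le_trans h)// lerB// lerD2r ler_wpM2l// exprn_ge0// ltW//.
suff -> : e ^+ 2 * sq a + sq y - 2 * e * sq (x * y) = sq (e%:C *: a - y) by [].
apply: complexI; rewrite rmorphB rmorphD !rmorphM /= -!sqE sqB_expand.
rewrite starZ (CrealP _) ?complex_real//=.
rewrite -!(scalerAl, scalerAr) !(scalarZ tau).
have -> : tau (star a * y) = tau (star (x * y) * (x * y)).
  by rewrite /a !starM starK -!mulrA.
have -> : tau (star y * a) = tau (star (x * y) * (x * y)).
  by rewrite /a !starM -!mulrA.
by rewrite (rmorphMn _ 2 1); ring.
Qed.

Let null_seqP (x : linf M) :
  null_seq x <-> forall e : R, 0 < e -> \forall k \near omega, sq (x k) < e.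
Proof.
split=> [/cvgr0Pnorm_lt x0 e e0|x0].
  have se0 : 0 < Num.sqrt e by rewrite sqrtr_gt0.
  have := x0 _ se0; apply: filterS => k.
  by rewrite /norm2 ger0_norm ?sqrtr_ge0// ltr_sqrt.
apply/cvgr0Pnorm_lt => e e0; have e20 : 0 < e ^+ 2 by rewrite exprn_gt0.
have := x0 _ e20; apply: filterS => k ske.
by rewrite ger0_norm ?sqrtr_ge0// -(ger0_norm (ltW e0)) -sqrtr_sqr ltr_sqrt.
Qed.

Lemma null_seq0 : null_seq 0.
Proof.
by apply/null_seqP => e e0; apply: nearW => k; rewrite [_ 0 _]/(0 : M) sq0.
Qed.

Lemma null_seqB x y : null_seq x -> null_seq y -> null_seq (x - y).
Proof.
move=> /null_seqP x0 /null_seqP y0; apply/null_seqP => e e0.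
have e4 : 0 < e / 4 by rewrite divr_gt0.
apply: filterS2 (x0 _ e4) (y0 _ e4) => k xk yk.
rewrite (le_lt_trans (sqB (x k) (y k)))//; lra.
Qed.

Lemma null_seq_star x : null_seq x -> null_seq (star x).
Proof.
move=> /null_seqP x0; apply/null_seqP => e e0.
by apply: filterS (x0 _ e0) => k; rewrite sq_star.
Qed.

Lemma null_seqMl x y : null_seq y -> null_seq (x * y).
Proof.
move=> /null_seqP y0; apply/null_seqP => e e0.
have [K [K0 sqM]] := sqM_bound.
have /bounded_seqP[L xL] := valP x; have /bounded_seqP[N yN] := valP y.
pose B := K * (L ^+ 2 * N) ^+ 2.
have B0 : 0 <= B by rewrite mulr_ge0// sqr_ge0.
pose d := e / (B + 1).
have d0 : 0 < d by rewrite divr_gt0// ltr_wpDl.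
have dB : d * B < e by rewrite /d mulrAC ltr_pdivrMr ?ltr_wpDl// ltr_pM2l// ltrDl.
have de : 0 < d * e by rewrite mulr_gt0.
apply: filterS (y0 _ de) => k yk.
have L0 : 0 <= L := le_trans (cnorm_ge0 _) (xL k).
have N0 : 0 <= N := le_trans (cnorm_ge0 _) (yN k).
have := sqM (x k) (y k) d d0.
have : K * (cnorm (x k) ^+ 2 * cnorm (y k)) ^+ 2 <= B.
  rewrite ler_wpM2l//; apply: lerXn2r.
  - by rewrite nnegrE mulr_ge0 ?sqr_ge0 ?cnorm_ge0.
  - by rewrite nnegrE mulr_ge0 ?sqr_ge0.
  - apply: ler_pM; rewrite ?sqr_ge0 ?cnorm_ge0 ?yN//.
    by apply: lerXn2r; rewrite ?nnegrE ?cnorm_ge0 ?xL.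
set t := K * _; set s := sq _ => tB h.
have : d * (2 * s) < d * (e + e).
  rewrite (_ : d * (2 * s) = 2 * d * s); last by ring.
  rewrite (le_lt_trans h)// mulrDr ltrD// expr2 -mulrA ltr_pM2l//.
  by rewrite (le_lt_trans _ dB)// ler_wpM2l// ltW.
rewrite ltr_pM2l// => h2; lra.
Qed.

Lemma null_seqMr x y : null_seq y -> null_seq (y * x).
Proof.
move=> /null_seq_star /(null_seqMl (star x)); rewrite -starM.
by move=> /null_seq_star; rewrite starK.
Qed.

Lemma null_seq_proper : ~ null_seq 1.
Proof.
move=> /null_seqP /(_ 1 ltr01); case/filter_ex => k.
rewrite [_ 1 k]/(1 : M) /sq mulr1 star1 (trace_unital (factor_tracial M)) /=.
by rewrite ltxx.
Qed.

Definition null_ideal : star_ideal (linf M) :=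
  StarIdeal null_seq0 null_seqB null_seqMl null_seqMr null_seq_star
    null_seq_proper.

Definition tracial_ultrapower : starAlgType R := star_quot null_ideal.

End TracialUltrapower.

(* Main.v *)
(* Composing pi with the trace of the ultrapower gives a tracial state tau_A on A.
   To extend it to a hypertrace on B(H), fix finitely many elements a of A and let
   S be the span of 1 and of the a, a^*, a^* a, a a^*. By the LLP, pi lifts on S
   to a UCP map into l^oo(R), one coordinate phi : S -> R of which is almost
   multiplicative in 2-norm on these elements; and phi(a) is 2-norm close to an
   element m_a of a finite-dimensional subalgebra N of R. The functional
   x (x) n |-> tau(n phi(x)) on S (x) N^op is a vector functional of the CP map
   phi (x) id, so it is positive on S (x) N^op in B(H) (x) B(L^2 N) and extends to
   a state there by M. Riesz's theorem. Restricting this state to B(H) (x) 1 gives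
   an approximate hypertrace: a (x) 1 - 1 (x) m_a is almost 0 on both sides in the
   GNS seminorm, while 1 (x) m_a commutes with B(H) (x) 1. An ultralimit over the
   finite subsets of A finishes the proof. *)

Require Import Defs.
From HB Require Import structures.
From mathcomp Require Import all_boot all_order all_algebra.
From mathcomp Require Import sesquilinear.
From mathcomp Require Import complex ring lra.
From mathcomp Require Import boolp classical_sets functions reals topology.
From mathcomp Require Import normedtype sequences.

Set Implicit Arguments.
Unset Strict Implicit.
Unset Printing Implicit Defensive.
Import Order.TTheory GRing.Theory Num.Theory.
Import numFieldNormedType.Exports.
Local Open Scope classical_set_scope.
Local Open Scope complex_scope.
Local Open Scope ring_scope.
Import ComplexField.Normc.
Local Notation Re := complex.Re.
Local Notation Im := complex.Im.

(** Tensor products become matrices: for [N] of dimension [d], [B(H) (x) B(L^2 N)] acts on [H^d],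
    and [N^op] acts there by the scalar matrices of right multiplication in a basis [e_j] of [N]
    that is orthonormal for the trace. The vector behind the functional has the entries [z e_j^*],
    where [z] is the inverse square root of [c = sum_j e_j^* e_j]; without this weight the
    functional would be [tau(m phi(x) c)] instead of [tau(m phi(x))]. Complete positivity speaks of
    matrices [Y^* Y], the extension of positive operators; the bridge is a square root in [M_d(A)],
    taken after a small shift and obtained from the fixed point of [y |-> x + y^2]. The extended
    functional is real, and becomes complex-linear only at the end. That [phi(a)] is 2-norm close to
    some [N] is not the definition of hyperfiniteness, which speaks of bicommutants: it takes von
    Neumann's density argument for the vectors that represent the normal trace. There, sequences
    with an explicit rate of convergence stand for the elements of the closure of [N zeta]. *)

Section Complex.
Variable R : realType.
Implicit Types (a b c : R[i]) (x y : R).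

Lemma normC_real c : `|c| = (normc c)%:C.
Proof. by []. Qed.

Lemma conjE c : Num.conj c = (c^*)%C.
Proof. by []. Qed.

Lemma conj_real x : Num.conj (x%:C : R[i]) = x%:C.
Proof. by rewrite conjE conjc_real. Qed.

Lemma normc_ge0 c : 0 <= normc c.
Proof. by case: c => a b; rewrite /= sqrtr_ge0. Qed.

Lemma ReD a b : Re (a + b) = Re a + Re b.
Proof. by case: a b => [? ?] [? ?]. Qed.

Lemma ReN a : Re (- a) = - Re a.
Proof. by case: a => [? ?]. Qed.

Lemma ReB a b : Re (a - b) = Re a - Re b.
Proof. by rewrite ReD ReN. Qed.

Lemma ReZ x c : Re (x%:C * c) = x * Re c.
Proof. by case: c => a b /=; rewrite mul0r subr0. Qed.

Lemma Re_conj c : Re (Num.conj c) = Re c.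
Proof. by case: c. Qed.

Lemma Re_le_normc c : `|Re c| <= normc c.
Proof. by rewrite -lecR; exact: normc_ge_Re. Qed.

Lemma Re_ge0 c : 0 <= c -> 0 <= Re c.
Proof. by rewrite lecE => /andP[]. Qed.

Lemma ge0_ReE c : 0 <= c -> c = (Re c)%:C.
Proof. by move=> c0; rewrite RRe_real// ger0_real. Qed.

Lemma Re_sum I (r : seq I) (P : pred I) (F : I -> R[i]) :
  Re (\sum_(i <- r | P i) F i) = \sum_(i <- r | P i) Re (F i).
Proof. by elim/big_rec2: _ => //= i ? ? _ <-; rewrite ReD. Qed.

Lemma mul_conj_normc c : c * Num.conj c = (normc c ^+ 2)%:C.
Proof. by rewrite -normCK normC_real rmorphXn. Qed.

Lemma normc_real x : normc x%:C = `|x|.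
Proof. by rewrite /= expr0n/= addr0 sqrtr_sqr. Qed.

Lemma normc_conj c : normc (Num.conj c) = normc c.
Proof. by case: c => a b /=; rewrite sqrrN. Qed.

(** Take [s = 1/g], or a large [s] when [g = 0]. Inserting the scalar [s w] with [b = |w|^2] into a
    sesquilinear form produces [b] in both coefficients, so complex discriminant arguments need only
    real [s]. *)
Lemma quad_disc (a b g : R) : 0 <= a -> 0 <= b -> 0 <= g ->
  (forall s, 0 <= a - 2 * s * b + s ^+ 2 * b * g) -> b <= a * g.
Proof.
move=> a0 b0 g0 h; have [->|bn0] := eqVneq b 0; first exact: mulr_ge0.
have bp : 0 < b by rewrite lt_def bn0.
have [g00|gn0] := eqVneq g 0.
  have := h ((a + 1) / (2 * b)); rewrite g00 mulr0 addr0.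
  have -> : 2 * ((a + 1) / (2 * b)) * b = a + 1 by field.
  by move=> k; exfalso; lra.
have gp : 0 < g by rewrite lt_def gn0.
have := h g^-1.
have -> : a - 2 / g * b + g^-1 ^+ 2 * b * g = (a * g - b) / g by field.
by rewrite pmulr_lge0 ?invr_gt0// subr_ge0.
Qed.

End Complex.

(** * Positive semidefinite forms *)

Section PsdForm.
Variables (R : realType) (V : lmodType R[i]).
Implicit Types (x y z : V) (B : V -> V -> R[i]).

(** Hermitian symmetry is not a field: [psd_conj] derives it from positivity. The form may be
    degenerate, so that forms of GNS type are used without quotient or completion. *)
Record psd_form B : Prop := PsdForm {
  psdl : forall c x y z, B (c *: x + y) z = c * B x z + B y z;
  psdr : forall c x y z, B z (c *: x + y) = Num.conj c * B z x + B z y;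
  psd_ge0 : forall x, 0 <= B x x
}.

Definition seminorm B x : R := Num.sqrt (Re (B x x)).

Variable B : V -> V -> R[i].
Hypothesis hB : psd_form B.
Local Notation sn := (seminorm B).

Lemma psdDl x y z : B (x + y) z = B x z + B y z.
Proof. by have := psdl hB 1 x y z; rewrite scale1r mul1r. Qed.

Lemma psdDr x y z : B z (x + y) = B z x + B z y.
Proof. by have := psdr hB 1 x y z; rewrite scale1r rmorph1 mul1r. Qed.

Lemma psd0l z : B 0 z = 0.
Proof. by apply: (addrI (B 0 z)); rewrite -psdDl !addr0. Qed.

Lemma psd0r z : B z 0 = 0.
Proof. by apply: (addrI (B z 0)); rewrite -psdDr !addr0. Qed.

Lemma psdZl c x z : B (c *: x) z = c * B x z.
Proof. by have := psdl hB c x 0 z; rewrite addr0 psd0l addr0. Qed.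

Lemma psdZr c x z : B z (c *: x) = Num.conj c * B z x.
Proof. by have := psdr hB c x 0 z; rewrite addr0 psd0r addr0. Qed.

Lemma psdNl x z : B (- x) z = - B x z.
Proof. by rewrite -scaleN1r psdZl mulN1r. Qed.

Lemma psdNr x z : B z (- x) = - B z x.
Proof. by rewrite -scaleN1r psdZr rmorphN1 mulN1r. Qed.

Lemma psdBl x y z : B (x - y) z = B x z - B y z.
Proof. by rewrite psdDl psdNl. Qed.

Lemma psdBr x y z : B z (x - y) = B z x - B z y.
Proof. by rewrite psdDr psdNr. Qed.

(** Polarization: the values at [x], [y], [x + y] and [i x + y] are real, which kills the imaginary
    part of [B x y + B y x] and the real part of [B x y - B y x]. *)
Lemma psd_conj x y : B y x = Num.conj (B x y).
Proof.
have h1 := psd_ge0 hB (x + y); have h2 := psd_ge0 hB ('i%C *: x + y).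
have hx := psd_ge0 hB x; have hy := psd_ge0 hB y.
have i1 : Num.conj ('i%C : R[i]) = - 'i%C by rewrite conjE; simpc.
move: h1 h2; rewrite !(psdDl, psdDr, psdZl, psdZr) i1.
move: hx hy; case: (B x y) => a b; case: (B y x) => c d.
case: (B x x) => e f; case: (B y y) => g h; rewrite conjE !lecE /=.
simpc => /andP[/eqP f0 _] /andP[/eqP h0 _] /andP[/eqP h1 _] /andP[/eqP h2 _].
by apply/eqP; rewrite eq_complex /=; apply/andP; split; apply/eqP; lra.
Qed.

Lemma seminorm_ge0 x : 0 <= sn x.
Proof. exact: sqrtr_ge0. Qed.

Lemma seminormE x : B x x = (sn x ^+ 2)%:C.
Proof.
by rewrite sqr_sqrtr -?ge0_ReE//; [exact: psd_ge0 hB _|exact/Re_ge0/(psd_ge0 hB)].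
Qed.

Lemma seminorm0 : sn 0 = 0.
Proof. by rewrite /seminorm psd0l sqrtr0. Qed.

Lemma seminormZ c x : sn (c *: x) = normc c * sn x.
Proof.
apply/eqP; rewrite -(eqrXn2 (n := 2))// ?mulr_ge0 ?seminorm_ge0 ?normc_ge0//.
apply/eqP/complexI; rewrite -seminormE psdZl psdZr seminormE mulrA.
by rewrite mul_conj_normc -rmorphM exprMn.
Qed.

Lemma seminormN x : sn (- x) = sn x.
Proof. by rewrite /seminorm psdNl psdNr opprK. Qed.

Lemma seminormBC x y : sn (x - y) = sn (y - x).
Proof. by rewrite -opprB seminormN. Qed.

Lemma psd_CS x y : normc (B x y) <= sn x * sn y.
Proof.
rewrite -(ler_pXn2r (n := 2)) ?nnegrE ?mulr_ge0 ?seminorm_ge0 ?normc_ge0//.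
rewrite exprMn; apply: quad_disc; rewrite ?exprn_ge0 ?seminorm_ge0 ?normc_ge0//.
move=> s; rewrite -ler0c.
have := psd_ge0 hB (x - (s%:C * B x y) *: y).
rewrite psdBl !psdBr !psdZl !psdZr !seminormE (psd_conj x y).
rewrite [Num.conj (s%:C * _)]rmorphM /= conj_real; congr (0 <= _).
have := mul_conj_normc (B x y); move: (normc _ ^+ 2) (sn x ^+ 2) (sn y ^+ 2).
move=> q f g qE; rewrite !(rmorphD, rmorphN, rmorphM, rmorph_nat) /= -qE.
ring.
Qed.

Lemma seminormD x y : sn (x + y) <= sn x + sn y.
Proof.
rewrite -(ler_pXn2r (n := 2)) ?nnegrE ?addr_ge0 ?seminorm_ge0//.
have -> : sn (x + y) ^+ 2 = sn x ^+ 2 + sn y ^+ 2 + 2 * Re (B x y).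
  apply: complexI; rewrite -seminormE psdDl !psdDr !seminormE (psd_conj x y).
  rewrite !rmorphD /= -[RHS]addrA -[LHS]addrA; congr (_ + _).
  rewrite [RHS]addrC addrA; congr (_ + _).
  by rewrite conjE addcJ rmorphM rmorph_nat.
rewrite sqrrD addrAC lerD2r lerD2l mulr_natl ler_pMn2r//.
exact: le_trans (le_trans (ler_norm _) (Re_le_normc _)) (psd_CS x y).
Qed.

Lemma seminormB x y : sn (x - y) <= sn x + sn y.
Proof. by rewrite -(seminormN y); exact: seminormD. Qed.

Lemma seminorm_sum I (r : seq I) (P : pred I) (F : I -> V) :
  sn (\sum_(i <- r | P i) F i) <= \sum_(i <- r | P i) sn (F i).
Proof.
elim/big_rec2: _ => [|i a b _ ab]; first by rewrite seminorm0.
by rewrite (le_trans (seminormD _ _))// lerD2l.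
Qed.

Lemma psd_suml I (r : seq I) (P : pred I) (F : I -> V) z :
  B (\sum_(i <- r | P i) F i) z = \sum_(i <- r | P i) B (F i) z.
Proof. exact: (big_morph (B^~ z) (fun x y => psdDl x y z) (psd0l z)). Qed.

Lemma psd_sumr I (r : seq I) (P : pred I) (F : I -> V) z :
  B z (\sum_(i <- r | P i) F i) = \sum_(i <- r | P i) B z (F i).
Proof. exact: (big_morph (B z) (fun x y => psdDr x y z) (psd0r z)). Qed.

(* Riesz representation up to epsilon: a near minimizer p of
   |n|^2 - 2 Re lambda(n) nearly represents lambda, and completeness of the
   form is not needed. *)
Lemma approx_riesz (N : set V) (lam : V -> R[i]) (K : R) :
  N 0 -> (forall c x y, N x -> N y -> N (c *: x + y)) ->
  (forall c x y, N x -> N y -> lam (c *: x + y) = c * lam x + lam y) ->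
  0 <= K -> (forall x, N x -> normc (lam x) <= K * sn x) ->
  forall e, 0 < e -> exists2 p, N p &
    forall n, N n -> normc (lam n - B n p) <= e * sn n.
Proof.
move=> N0 Nlin lamlin K0 lamK e e0.
pose J x := sn x ^+ 2 - 2 * Re (lam x).
pose S := [set J x | x in N].
have hinf : has_inf S.
  split; first by exists (J 0), 0.
  exists (- K ^+ 2) => _ [x Nx <-].
  have h1 : Re (lam x) <= K * sn x.
    exact: le_trans (le_trans (ler_norm _) (Re_le_normc _)) (lamK _ Nx).
  rewrite /J; have := sqr_ge0 (sn x - K); nra.
have [_ [p Np <-] Jp] := inf_adherent (exprn_gt0 2 e0) hinf.
exists p => // n Nn.
have Jn x : N x -> J p - e ^+ 2 <= J x.
  move=> Nx; rewrite lerBlDr (le_trans (ltW Jp))// lerD2r.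
  by apply: ge_inf; [case: hinf|exists x].
set r := lam n - B n p.
rewrite -(ler_pXn2r (n := 2)) ?nnegrE ?mulr_ge0 ?seminorm_ge0 ?normc_ge0 ?(ltW e0)//.
rewrite exprMn; apply: quad_disc; rewrite ?exprn_ge0 ?seminorm_ge0 ?normc_ge0 ?(ltW e0)//.
(* Moving [p] by [c *: n] changes [J] by a quadratic in the real [s], at least [- e ^+ 2] by near
   minimality; [quad_disc] turns this into the bound on [r]. *)
move=> s; set c := s%:C * Num.conj r.
have := Jn _ (Nlin c n p Nn Np).
suff -> : J (c *: n + p) = J p - 2 * s * normc r ^+ 2 + s ^+ 2 * normc r ^+ 2 * sn n ^+ 2.
  by move=> h; lra.
have l1 : Re (c * r) = s * normc r ^+ 2.
  by rewrite /c -mulrA [_ * r]mulrC mul_conj_normc -rmorphM.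
have n1 : normc c ^+ 2 = s ^+ 2 * normc r ^+ 2.
  by rewrite /c normcM normc_real normc_conj exprMn real_normK ?num_real.
clearbody c; rewrite /J.
have -> : sn (c *: n + p) ^+ 2 = normc c ^+ 2 * sn n ^+ 2 + sn p ^+ 2 + 2 * Re (c * B n p).
  apply: complexI; rewrite -seminormE psdDl !psdDr !psdZl !psdZr !seminormE (psd_conj n p).
  rewrite !rmorphD/= [X in _ = _ + X]rmorphM/= rmorph_nat.
  rewrite -addcJ -conjE [Num.conj (c * _)]rmorphM/= [X in _ = X + _ + _]rmorphM/= -mul_conj_normc.
  ring.
rewrite lamlin// n1 ReD.
have -> : Re (c * lam n) = s * normc r ^+ 2 + Re (c * B n p).
  by rewrite -l1 -ReD -mulrDr subrK.
by ring.
Qed.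

End PsdForm.

(** * Square roots and inverses in complete normed rings *)

(** If [y = z + y * y], the right-hand side is [1 - 4 z]: the fixed point yields the square root
    [1 - 2 y] of [1 - 4 z]. All algebraic square roots below arise in this way. *)
Lemma sqr_1_subDD (B : pzRingType) (y : B) :
  (1 - y - y) * (1 - y - y) = 1 - (y - y * y) *+ 4.
Proof.
have -> : 1 - y - y = 1 - y *+ 2 by rewrite -addrA -opprD.
rewrite mulrBl mul1r mulrBr mulr1 mulrnAl mulrnAr -mulrnA mulrnBl !opprB.
by rewrite (mulrnDr y 2 2 : y *+ 4 = _) [LHS]addrACA -opprD [RHS]addrA.
Qed.

Section NormedRing.
Variables (R : realType) (B : pzRingType).
Implicit Types (x y z w : B).

(* [bd x k] reads "the norm of x is at most k" *)
Record complete_bound (bd : B -> R -> Prop) : Prop := CompleteBound {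
  bdW : forall x k l, bd x k -> k <= l -> bd x l;
  bd0 : bd 0 0;
  bdN : forall x k, bd x k -> bd (- x) k;
  bdD : forall x y k l, bd x k -> bd y l -> bd (x + y) (k + l);
  bdM : forall x y k l, bd x k -> bd y l -> bd (x * y) (k * l);
  bd_sep : forall x, (forall e, 0 < e -> bd x e) -> x = 0;
  bd_complete : forall u : nat -> B,
    (forall e, 0 < e -> exists N, forall m n, (N <= m)%N -> (N <= n)%N ->
       bd (u m - u n) e) ->
    exists l, forall e, 0 < e -> exists N, forall n, (N <= n)%N -> bd (u n - l) e
}.

Variable bd : B -> R -> Prop.
Hypothesis hbd : complete_bound bd.

Lemma bdB x y k l : bd x k -> bd y l -> bd (x - y) (k + l).
Proof. by move=> xk yl; apply: bdD => //; exact: bdN. Qed.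

Lemma geometric_cvg (u : nat -> B) (C r : R) : 0 <= C -> 0 <= r < 1 ->
  (forall n, bd (u n.+1 - u n) (C * r ^+ n)) ->
  exists l, forall e, 0 < e -> exists N, forall n, (N <= n)%N -> bd (u n - l) e.
Proof.
move=> C0 /andP[r0 r1] uC; apply: (bd_complete hbd) => e e0.
have r1' : 0 < 1 - r by rewrite subr_gt0.
have step n k : bd (u (n + k)%N - u n) (C * (r ^+ n - r ^+ (n + k)) / (1 - r)).
  elim: k => [|k ih]; first by rewrite addn0 !subrr mulr0 mul0r; exact: bd0.
  have := bdD hbd (uC (n + k)%N) ih; rewrite addrA subrK addnS => h.
  apply: (bdW hbd h); rewrite le_eqVlt; apply/orP; left; apply/eqP.
  by rewrite exprS; field; rewrite gt_eqF.
have cr : (fun n => r ^+ n) @ \oo --> (0 : R).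
  by apply: cvg_expr; rewrite ger0_norm.
pose d := e * (1 - r) / (C + 1) / 2.
have d0 : 0 < d by rewrite !divr_gt0 ?mulr_gt0// ltr_wpDl.
have [N _ hN] := (cvgr0Pnorm_lt _).1 cr _ d0.
have bnd k : bd (u (N + k)%N - u N) (e / 2).
  apply: (bdW hbd (step N k)).
  have := hN N (leqnn N); rewrite /= ger0_norm ?exprn_ge0// => rN.
  have : 0 <= r ^+ (N + k) by exact: exprn_ge0.
  move: rN; rewrite /d ler_pdivrMr// => h1 h2.
  have h3 : r ^+ N * (C + 1) <= e * (1 - r) / 2.
    by move/ltW: h1; rewrite mulrAC ler_pdivlMr// ltr_wpDl.
  rewrite mulrAC; apply: le_trans h3.
  have := exprn_ge0 N r0; nra.
exists N => m n Nm Nn; rewrite (_ : e = e / 2 + e / 2); last by field.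
have := bdB (bnd (m - N)%N) (bnd (n - N)%N); rewrite !subnKC//.
by rewrite opprB addrA subrK.
Qed.

(** The map [y |-> z + y * y] preserves the ball of radius [r / 2], since
    [r / 4 + r ^+ 2 / 4 <= r / 2], and contracts it by the factor [r]. The iterates are returned
    with the limit because self-adjointness and commutation are inherited from them. The bound on
    [y] is stated for [l > r / 2] as [bd] is not assumed closed in its second argument. *)
Lemma sqrt_fixpoint z r : 0 <= r < 1 -> bd z (r / 4) ->
  exists (u : nat -> B) y, [/\ u 0%N = 0 /\ forall n, u n.+1 = z + u n * u n,
    forall e, 0 < e -> exists n, bd (u n - y) e,
    y = z + y * y & forall l, r / 2 < l -> bd y l].
Proof.
move=> /andP[r0 r1] zr; pose u n := iter n (fun y => z + y * y) 0.
have u2 n : bd (u n) (r / 2).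
  elim: n => [|n ih]; first by apply: (bdW hbd (bd0 hbd)); rewrite divr_ge0.
  by apply: (bdW hbd (bdD hbd zr (bdM hbd ih ih))); nra.
have uS n : bd (u n.+1 - u n) (r / 4 * r ^+ n).
  elim: n => [|n ih]; first by rewrite /u/= mulr0 addr0 subr0 expr0 mulr1.
  have -> : u n.+2 - u n.+1 = u n.+1 * (u n.+1 - u n) + (u n.+1 - u n) * u n.
    rewrite mulrBr mulrBl addrA subrK [u n.+2]/(z + u n.+1 * u n.+1).
    by rewrite [in X in _ - X]/u/= opprD addrACA subrr add0r.
  apply: (bdW hbd (bdD hbd (bdM hbd (u2 n.+1) ih) (bdM hbd ih (u2 n)))).
  by rewrite exprS le_eqVlt; apply/orP; left; apply/eqP; field.
have [y uy] : exists l, forall e, 0 < e ->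
    exists N, forall n, (N <= n)%N -> bd (u n - l) e.
  by apply: geometric_cvg uS; rewrite ?divr_ge0 ?r0.
have yl l : r / 2 < l -> bd y l.
  move=> rl; have l0 : 0 < l - r / 2 by rewrite subr_gt0.
  have [N hN] := uy _ l0; have := bdB (u2 N) (hN N (leqnn N)).
  by rewrite opprB addrC subrK addrC subrK.
exists u, y; split=> //.
- by move=> e e0; have [N hN] := uy e e0; exists N; exact: hN.
- apply/eqP; rewrite -subr_eq0; apply/eqP/(bd_sep hbd) => e e0.
  pose d := Num.min 1 (e / 3).
  have d0 : 0 < d by rewrite lt_min ltr01 divr_gt0.
  have [N hN] := uy d d0.
  have y1 : bd y 1 by apply: yl; lra.
  have hn := hN N (leqnn N).
  have := bdB (bdD hbd (bdM hbd (u2 N) hn) (bdM hbd hn y1)) (hN N.+1 (leqnSn N)).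
  have -> : u N * (u N - y) + (u N - y) * y - (u N.+1 - y) = y - (z + y * y).
    rewrite mulrBr mulrBl addrA subrK (_ : u N.+1 = z + u N * u N)// opprB [LHS]addrC.
    by rewrite !opprD !addrA subrK.
  move=> h; apply: (bdW hbd h).
  have : d <= e / 3 by rewrite ge_min lexx orbT.
  by nra.
Qed.

(** The iterates are the partial sums of the geometric series of [x]. The right inverse becomes
    two-sided through [limit_comm]. *)
Lemma neumann x r : 0 <= r < 1 -> bd x r ->
  exists (u : nat -> B) y, [/\ u 0%N = 1 /\ forall n, u n.+1 = 1 + x * u n,
    forall e, 0 < e -> exists n, bd (u n - y) e & (1 - x) * y = 1].
Proof.
move=> /andP[r0 r1] xr; pose u n := iter n (fun y => 1 + x * y) 1.
have uS n : bd (u n.+1 - u n) (r * r ^+ n).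
  elim: n => [|n ih].
    by rewrite /u/= !mulr1 addrC addKr.
  have -> : u n.+2 - u n.+1 = x * (u n.+1 - u n).
    rewrite mulrBr [u n.+2]/(1 + x * u n.+1).
    by rewrite [in X in _ - X]/u/= opprD addrACA subrr add0r.
  by rewrite exprS; apply: bdM.
have [y uy] : exists l, forall e, 0 < e ->
    exists N, forall n, (N <= n)%N -> bd (u n - l) e.
  by apply: geometric_cvg uS; rewrite ?r0.
exists u, y; split=> //.
  by move=> e e0; have [N hN] := uy e e0; exists N; exact: hN.
apply/eqP; rewrite -subr_eq0; apply/eqP/(bd_sep hbd) => e e0.
have e2 : 0 < e / 2 by rewrite divr_gt0.
have [N hN] := uy _ e2.
have hn := hN N (leqnn N).
have := bdB (bdM hbd xr hn) (hN N.+1 (leqnSn N)).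
have -> : x * (u N - y) - (u N.+1 - y) = (1 - x) * y - 1.
  rewrite mulrBr mulrBl mul1r (_ : u N.+1 = 1 + x * u N)// opprB [LHS]addrC.
  by rewrite opprD !addrA subrK addrAC.
by move=> h; apply: (bdW hbd h); nra.
Qed.

Lemma limit_comm (u : nat -> B) y w k :
  (forall e, 0 < e -> exists n, bd (u n - y) e) -> 0 <= k -> bd w k ->
  (forall n, u n * w = w * u n) -> y * w = w * y.
Proof.
move=> uy k0 wk uw; apply/eqP; rewrite -subr_eq0; apply/eqP/(bd_sep hbd) => e e0.
pose d := e / (2 * k + 1).
have k1 : 0 < 2 * k + 1 by nra.
have d0 : 0 < d by rewrite divr_gt0.
have [n hn] := uy d d0.
have := bdB (bdM hbd wk hn) (bdM hbd hn wk).
have -> : w * (u n - y) - (u n - y) * w = y * w - w * y.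
  by rewrite mulrBr mulrBl uw opprB addrC addrA subrK.
move=> h; apply: (bdW hbd h).
have dE : d * (2 * k + 1) = e by rewrite /d divfK// gt_eqF.
by nra.
Qed.

Lemma limit_fixed (f : B -> B) (u : nat -> B) y :
  (forall x y, f (x - y) = f x - f y) -> (forall x k, bd x k -> bd (f x) k) ->
  (forall e, 0 < e -> exists n, bd (u n - y) e) ->
  (forall n, f (u n) = u n) -> f y = y.
Proof.
move=> fB fbd uy fu; apply/eqP; rewrite -subr_eq0; apply/eqP/(bd_sep hbd) => e e0.
have [n hn] := uy (e / 2) (divr_gt0 e0 (ltr0Sn _ 1)).
have := bdB hn (fbd _ _ hn); rewrite fB fu opprB addrC addrA subrK.
by rewrite -splitr.
Qed.

End NormedRing.

(** * Matrices over a represented C*-algebra *)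

Section Hilbert.
Variables (R : realType) (H : hilbertType R).

Lemma inner_psd : psd_form (fun u v : H => inner u v).
Proof.
split=> [c x y z|c x y z|x]; first by rewrite linearDl linearZl_LR.
  by rewrite linearDr linearZr_LR.
by rewrite -normE_inner exprn_ge0.
Qed.

Definition hnorm (u : H) : R := seminorm (fun u v : H => inner u v) u.

Lemma hnorm_ge0 u : 0 <= hnorm u.
Proof. exact: seminorm_ge0. Qed.

Lemma hnormE u : `|u| = (hnorm u)%:C.
Proof.
apply/eqP; rewrite -(eqrXn2 (n := 2))// ?ler0c ?hnorm_ge0//.
by rewrite normE_inner (seminormE inner_psd) rmorphXn.
Qed.

Definition hsum n (u v : 'I_n -> H) : R[i] := \sum_i inner (u i) (v i).

Lemma hsum_psd n : psd_form (@hsum n).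
Proof.
split=> [c x y z|c x y z|x]; rewrite /hsum.
- by rewrite mulr_sumr -big_split; apply: eq_bigr => i _; exact: (psdl inner_psd).
- by rewrite mulr_sumr -big_split; apply: eq_bigr => i _; exact: (psdr inner_psd).
- by apply: sumr_ge0 => i _; exact: (psd_ge0 inner_psd).
Qed.

Definition hnsum n (u : 'I_n -> H) : R := seminorm (@hsum n) u.

Lemma hnsum_ge0 n (u : 'I_n -> H) : 0 <= hnsum u.
Proof. exact: seminorm_ge0. Qed.

Lemma hnsumE n (u : 'I_n -> H) : hnsum u ^+ 2 = \sum_i hnorm (u i) ^+ 2.
Proof.
apply: complexI; rewrite -(seminormE (hsum_psd n)) rmorph_sum /hsum/=.
by apply: eq_bigr => i _; rewrite (seminormE inner_psd).
Qed.

Lemma hnorm_le_hnsum n (u : 'I_n -> H) i : hnorm (u i) <= hnsum u.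
Proof.
rewrite -(ler_pXn2r (n := 2)) ?nnegrE ?hnorm_ge0 ?hnsum_ge0// hnsumE.
by rewrite (bigD1 i)//= lerDl sumr_ge0// => j _; rewrite exprn_ge0 ?hnorm_ge0.
Qed.

Lemma hnsum_single n (j : 'I_n) (v : H) :
  hnsum (fun i => if i == j then v else 0) = hnorm v.
Proof.
apply/eqP; rewrite -(eqrXn2 (n := 2)) ?hnorm_ge0 ?hnsum_ge0// hnsumE.
rewrite (bigD1 j)//= eqxx big1 ?addr0// => i /negPf ->.
by rewrite /hnorm (seminorm0 inner_psd) expr0n.
Qed.

Lemma hnsum_le n (u : 'I_n -> H) : hnsum u <= \sum_i hnorm (u i).
Proof.
have -> : u = \sum_j (fun i => if i == j then u j else 0).
  apply/funext => i; rewrite fct_sumE (bigD1 i)//= eqxx big1 ?addr0// => j.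
  by rewrite eq_sym => /negPf ->.
rewrite (le_trans (seminorm_sum (hsum_psd n) _ _ _))// ler_sum// => j _.
rewrite [leLHS]hnsum_single fct_sumE (bigD1 j)//= eqxx big1 ?addr0// => i.
by rewrite eq_sym => /negPf ->.
Qed.

End Hilbert.

Section MatrixStar.
Variables (R : realType) (A : starAlgType R) (n : nat).
Implicit Types X Y : 'M[A]_n.

Definition mxstar X : 'M[A]_n := (map_mx star X)^T.

Lemma mxstarE X i j : mxstar X i j = star (X j i).
Proof. by rewrite !mxE. Qed.

Lemma mxstarK : involutive mxstar.
Proof. by move=> X; apply/matrixP => i j; rewrite !mxstarE starK. Qed.

Lemma mxstarB X Y : mxstar (X - Y) = mxstar X - mxstar Y.
Proof. by apply/matrixP => i j; rewrite !mxE starB. Qed.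

Lemma mxstarD X Y : mxstar (X + Y) = mxstar X + mxstar Y.
Proof. by apply/matrixP => i j; rewrite !mxE starD. Qed.

Lemma mxstarM X Y : mxstar (X *m Y) = mxstar Y *m mxstar X.
Proof.
apply/matrixP => i j; rewrite !mxE.
rewrite (big_morph star (@starD R A) (star0 A)).
by apply: eq_bigr => k _; rewrite starM !mxstarE.
Qed.

(** Complex scalars act entrywise; the built-in scaling of ['M[A]_n] takes its scalars from [A]. *)
Definition mxscal (c : R[i]) X : 'M[A]_n := \matrix_(i, j) (c *: X i j).

Lemma mxstarZ c X : mxstar (mxscal c X) = mxscal (Num.conj c) (mxstar X).
Proof. by apply/matrixP => i j; rewrite !mxE starZ. Qed.

Lemma mxscalA c d X : mxscal c (mxscal d X) = mxscal (c * d) X.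
Proof. by apply/matrixP => i j; rewrite !mxE scalerA. Qed.

Lemma mxscal1 X : mxscal 1 X = X.
Proof. by apply/matrixP => i j; rewrite !mxE scale1r. Qed.

Lemma mxscalMl c X Y : mxscal c X *m Y = mxscal c (X *m Y).
Proof.
apply/matrixP => i j; rewrite !mxE scaler_sumr; apply: eq_bigr => k _.
by rewrite mxE scalerAl.
Qed.

Lemma mxscalMr c X Y : X *m mxscal c Y = mxscal c (X *m Y).
Proof.
apply/matrixP => i j; rewrite !mxE scaler_sumr; apply: eq_bigr => k _.
by rewrite mxE scalerAr.
Qed.

Lemma mxstar1 : mxstar 1%:M = 1%:M.
Proof.
apply/matrixP => i j; rewrite !mxE eq_sym.
by case: eqP => _; rewrite ?star1 ?star0.
Qed.

End MatrixStar.

Section CStarBound.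
Variables (R : realType) (A : cstarAlgType R).

Lemma cnorm_sub (x y : A) : cnorm (x - y) = cnorm (y - x).
Proof. by rewrite -opprB cnormN. Qed.

Lemma cnormZ_real (c : R[i]) (x : A) : cnorm (c *: x) = normc c * cnorm x.
Proof. by apply: complexI; rewrite cnormZ normC_real rmorphM. Qed.

Lemma cstar_complete_bound :
  complete_bound (fun (x : A) (k : R) => cnorm x <= k).
Proof.
split=> [x k l|||x y k l xk yl|x y k l xk yl|x xe|u uC].
- exact: le_trans.
- by rewrite cnorm0.
- by move=> x k; rewrite cnormN.
- by rewrite (le_trans (cnorm_triangle _ _))// lerD.
- by rewrite (le_trans (cnormM _ _))// ler_pM ?cnorm_ge0.
- apply: cnorm_eq0; apply/eqP; rewrite eq_le cnorm_ge0 andbT.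
  by apply/ler_addgt0Pr => e e0; rewrite add0r xe.
- have [|l ul] := cnorm_complete u.
    move=> e e0; have [N hN] := uC _ (divr_gt0 e0 (ltr0Sn _ 1)).
    exists N => m n Nm Nn; rewrite (le_lt_trans (hN _ _ Nm Nn))//.
    by rewrite ltr_pdivrMr// mulr2n mulrDr mulr1 ltrDl.
  exists l => e e0; have [N _ hN] := (cvgr0Pnorm_lt _).1 ul _ e0.
  by exists N => n /hN /ltW; rewrite /= ger0_norm ?cnorm_ge0.
Qed.

End CStarBound.

Section Representation.
Variables (R : realType) (A : cstarAlgType R) (H : hilbertType R).
Variables (sg : A -> H -> H) (hs : faithful_rep sg).

Lemma rep_linv a (c : R[i]) u v : sg a (c *: u + v) = c *: sg a u + sg a v.
Proof. by have [h _] := rep_bounded hs a; exact: h. Qed.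

Lemma repD a b v : sg (a + b) v = sg a v + sg b v.
Proof. by have := rep_linear hs 1 a b v; rewrite !scale1r. Qed.

Lemma rep0 v : sg 0 v = 0.
Proof. by apply: (addrI (sg 0 v)); rewrite -repD !addr0. Qed.

Lemma repZ (c : R[i]) a v : sg (c *: a) v = c *: sg a v.
Proof. by have := rep_linear hs c a 0 v; rewrite addr0 rep0 addr0. Qed.

Lemma repN a v : sg (- a) v = - sg a v.
Proof. by rewrite -scaleN1r repZ scaleN1r. Qed.

Lemma repB a b v : sg (a - b) v = sg a v - sg b v.
Proof. by rewrite repD repN. Qed.

Lemma repDv a u v : sg a (u + v) = sg a u + sg a v.
Proof. by have := rep_linv a 1 u v; rewrite !scale1r. Qed.

Lemma rep0v a : sg a 0 = 0.
Proof. by apply: (addrI (sg a 0)); rewrite -repDv !addr0. Qed.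

Lemma repZv a (c : R[i]) v : sg a (c *: v) = c *: sg a v.
Proof. by have := rep_linv a c v 0; rewrite addr0 rep0v addr0. Qed.

Lemma repNv a v : sg a (- v) = - sg a v.
Proof. by rewrite -scaleN1r repZv scaleN1r. Qed.

Lemma repBv a u v : sg a (u - v) = sg a u - sg a v.
Proof. by rewrite repDv repNv. Qed.

Lemma rep_sumv a I (r : seq I) (P : pred I) (F : I -> H) :
  sg a (\sum_(i <- r | P i) F i) = \sum_(i <- r | P i) sg a (F i).
Proof. exact: (big_morph (sg a) (repDv a) (rep0v a)). Qed.

Lemma rep_sum I (r : seq I) (P : pred I) (F : I -> A) v :
  sg (\sum_(i <- r | P i) F i) v = \sum_(i <- r | P i) sg (F i) v.
Proof. exact: (big_morph (sg^~ v) (fun a b => repD a b v) (rep0 v)). Qed.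

Lemma rep1 v : sg 1 v = v.
Proof. by rewrite (rep_unital hs). Qed.

Lemma repM a b v : sg (a * b) v = sg a (sg b v).
Proof. by rewrite (rep_mul hs). Qed.

Lemma rep_cnorm_le a (K : R) : 0 <= K ->
  (cnorm a <= K <-> forall v, hnorm (sg a v) <= K * hnorm v).
Proof.
move=> K0; rewrite (rep_isometric hs a K0).
by split=> h v; move: (h v); rewrite !hnormE -rmorphM lecR.
Qed.

Lemma rep_le a v : hnorm (sg a v) <= cnorm a * hnorm v.
Proof. by apply: (rep_cnorm_le a (cnorm_ge0 a)).1. Qed.

Definition mxact n (X : 'M[A]_n) (u : 'I_n -> H) : 'I_n -> H :=
  fun i => \sum_j sg (X i j) (u j).

Section Fixed.
Variable n : nat.
Implicit Types (X Y : 'M[A]_n) (u v : 'I_n -> H).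

Lemma mxactD X Y u : mxact (X + Y) u = mxact X u + mxact Y u.
Proof.
apply/funext => i; rewrite /mxact [in RHS]fctE -big_split/=.
by apply: eq_bigr => j _; rewrite mxE repD.
Qed.

Lemma mxact0 u : mxact 0 u = 0.
Proof. by apply: (addrI (mxact 0 u)); rewrite -mxactD !addr0. Qed.

Lemma mxactN X u : mxact (- X) u = - mxact X u.
Proof. by apply: (addrI (mxact X u)); rewrite -mxactD !subrr mxact0. Qed.

Lemma mxactB X Y u : mxact (X - Y) u = mxact X u - mxact Y u.
Proof. by rewrite mxactD mxactN. Qed.

Lemma mxactZ c X u : mxact (mxscal c X) u = c *: mxact X u.
Proof.
apply/funext => i; rewrite /mxact fctE scaler_sumr.
by apply: eq_bigr => j _; rewrite mxE repZ.
Qed.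

Lemma mxact_lin X c u v : mxact X (c *: u + v) = c *: mxact X u + mxact X v.
Proof.
apply/funext => i; rewrite /mxact !fctE scaler_sumr -big_split/=.
by apply: eq_bigr => j _; rewrite rep_linv.
Qed.

Lemma mxactM X Y u : mxact (X *m Y) u = mxact X (mxact Y u).
Proof.
apply/funext => i; rewrite /mxact.
under eq_bigr do rewrite mxE rep_sum.
under [RHS]eq_bigr do rewrite rep_sumv.
rewrite exchange_big; apply: eq_bigr => k _; apply: eq_bigr => j _.
by rewrite repM.
Qed.

Lemma mxact1 u : mxact 1%:M u = u.
Proof.
apply/funext => i; rewrite /mxact (bigD1 i)//= mxE eqxx rep1 big1 ?addr0//.
by move=> j; rewrite mxE eq_sym => /negPf ->; rewrite rep0.
Qed.

Lemma mxact_star X u v : hsum (mxact X u) v = hsum u (mxact (mxstar X) v).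
Proof.
rewrite /hsum /mxact.
under eq_bigr do rewrite (psd_suml (inner_psd H))/=.
under [RHS]eq_bigr do rewrite (psd_sumr (inner_psd H))/=.
rewrite exchange_big; apply: eq_bigr => j _; apply: eq_bigr => i _.
by rewrite (rep_star hs) mxE mxE.
Qed.

(** Operator bounds on [H^n] take the place of the C*-norm of [M_n(A)]. *)
Definition mxbd X (k : R) : Prop :=
  0 <= k /\ forall u, hnsum (mxact X u) <= k * hnsum u.

Lemma mxbd_entry X k i j : mxbd X k -> cnorm (X i j) <= k.
Proof.
move=> [k0 Xk]; apply/(rep_cnorm_le _ k0) => v.
have := Xk (fun i => if i == j then v else 0); rewrite hnsum_single.
apply: le_trans; apply: le_trans (hnorm_le_hnsum _ i).
rewrite /mxact (bigD1 j)//= eqxx big1 ?addr0// => l /negPf ->.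
by rewrite rep0v.
Qed.

Lemma mxbd_sum X : mxbd X (\sum_i \sum_j cnorm (X i j)).
Proof.
split; first by apply: sumr_ge0 => i _; apply: sumr_ge0 => j _; exact: cnorm_ge0.
move=> u; rewrite (le_trans (hnsum_le _))// mulr_suml ler_sum// => i _.
rewrite (le_trans (seminorm_sum (inner_psd H) _ _ _))// mulr_suml ler_sum// => j _.
by rewrite (le_trans (rep_le _ _))// ler_wpM2l ?cnorm_ge0 ?hnorm_le_hnsum.
Qed.

(** An operator bound controls every entry, and bounds on the entries add up to an operator bound,
    so completeness is inherited entrywise from [A]. *)
Lemma mxbd_complete_bound : complete_bound mxbd.
Proof.
have sum_const (e : R) : 0 < e -> exists2 d, 0 < d &
    forall X, (forall i j, cnorm (X i j) <= d) -> mxbd X e.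
  (* The error is shared among [n * n] entries; the successor covers [n = 0]. *)
  move=> e0; exists (e / (n * n).+1%:R); first by rewrite divr_gt0.
  move=> X Xd; have [h0 h] := mxbd_sum X; split; first exact: ltW.
  move=> u; rewrite (le_trans (h u))// ler_wpM2r ?hnsum_ge0//.
  apply: (@le_trans _ _ (\sum_(i < n) \sum_(j < n) (e / (n * n).+1%:R))).
    by apply: ler_sum => i _; apply: ler_sum => j _; exact: Xd.
  rewrite !sumr_const !card_ord -mulrnA -[_ *+ _]mulr_natr mulrAC.
  by rewrite ler_pdivrMr ?ltr0Sn// ler_pM2l// ler_nat.
split=> [X k l [k0 Xk] kl||X k [k0 Xk]|X Y k l [k0 Xk] [l0 Yl]|X Y k l [k0 Xk] [l0 Yl]|X Xe|u uC].
- split; first exact: le_trans kl.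
  by move=> u; rewrite (le_trans (Xk u))// ler_wpM2r ?hnsum_ge0.
- by split=> // u; rewrite mxact0 /hnsum (seminorm0 (hsum_psd H n)) mul0r.
- by split=> // u; rewrite mxactN /hnsum (seminormN (hsum_psd H n)); exact: Xk.
- split=> [|u]; first exact: addr_ge0.
  by rewrite mxactD (le_trans (seminormD (hsum_psd H n) _ _))// mulrDl lerD ?Xk ?Yl.
- split=> [|u]; first exact: mulr_ge0.
  by rewrite mxactM (le_trans (Xk _))// -mulrA ler_wpM2l.
- apply/matrixP => i j; rewrite mxE; apply: (bd_sep (cstar_complete_bound A)) => e e0.
  exact/mxbd_entry/Xe.
- have lim i j : exists l, forall e, 0 < e -> exists N, forall m, (N <= m)%N ->
      cnorm (u m i j - l) <= e.
    apply: (bd_complete (cstar_complete_bound A)) => e e0.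
    have [N hN] := uC e e0; exists N => p q Np Nq.
    by have := mxbd_entry i j (hN p q Np Nq); rewrite !mxE.
  have [L hL] := choice (fun ij : 'I_n * 'I_n => lim ij.1 ij.2).
  exists (\matrix_(i, j) L (i, j)) => e e0; have [d d0 hd] := sum_const e e0.
  have [N hN] := choice (fun ij : 'I_n * 'I_n => hL ij d d0).
  exists (\max_(ij : 'I_n * 'I_n) N ij)%N => m Nm; apply: hd => i j; rewrite !mxE.
  by apply: (hN (i, j)); apply: leq_trans Nm; exact: leq_bigmax.
Qed.

Lemma mxbd_star X k : mxbd X k -> mxbd (mxstar X) k.
Proof.
move=> [k0 Xk]; split=> // u; set w := mxact (mxstar X) u.
have [->|w0] := eqVneq (hnsum w) 0; first by rewrite mulr_ge0 ?hnsum_ge0.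
have wp : 0 < hnsum w by rewrite lt_def w0 hnsum_ge0.
rewrite -(ler_pM2r wp) -expr2.
have -> : hnsum w ^+ 2 = Re (hsum (mxact X w) u).
  by rewrite mxact_star -/w (seminormE (hsum_psd H n)).
rewrite (le_trans (le_trans (ler_norm _) (Re_le_normc _)))//.
rewrite (le_trans (psd_CS (hsum_psd H n) _ _))// mulrAC.
by rewrite ler_wpM2r ?hnsum_ge0 ?Xk.
Qed.

Lemma mx_form_conj X u v : mxstar X = X ->
  hsum (mxact X u) v = Num.conj (hsum (mxact X v) u).
Proof. by move=> Xs; rewrite mxact_star Xs (psd_conj (hsum_psd H n)). Qed.

(** Cauchy-Schwarz for the positive form [<X u, v>], applied to [u] and [X u], turns a bound on the
    quadratic form into an operator bound without spectral theory. *)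
Lemma mx_pos_bd X (k : R) : mxstar X = X -> 0 <= k ->
  (forall u, 0 <= Re (hsum (mxact X u) u) <= k * hnsum u ^+ 2) -> mxbd X k.
Proof.
move=> Xs k0 Xk.
have reX u : hsum (mxact X u) u = (Re (hsum (mxact X u) u))%:C.
  have /CrealP/RRe_real -> // := esym (mx_form_conj u u Xs).
have hB : psd_form (fun u v => hsum (mxact X u) v).
  split=> [c x y z|c x y z|x].
  - by rewrite mxact_lin (psdl (hsum_psd H n)).
  - by rewrite (psdr (hsum_psd H n)).
  - by rewrite reX ler0c; have /andP[] := Xk x.
have snX u : seminorm (fun u v => hsum (mxact X u) v) u ^+ 2 <= k * hnsum u ^+ 2.
  by rewrite sqr_sqrtr; have /andP[] := Xk u.
split=> // u; set w := mxact X u.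
have [->|w0] := eqVneq (hnsum w) 0; first by rewrite mulr_ge0 ?hnsum_ge0.
have wp : 0 < hnsum w by rewrite lt_def w0 hnsum_ge0.
have := psd_CS hB u w; rewrite -/w (seminormE (hsum_psd H n)) -/(hnsum w).
rewrite normc_real (ger0_norm (exprn_ge0 _ (hnsum_ge0 _))) => h.
rewrite -(ler_pM2r wp) -expr2; rewrite (le_trans h)//.
rewrite -(ler_pXn2r (n := 2)) ?nnegrE ?mulr_ge0 ?seminorm_ge0//.
rewrite exprMn (le_trans (ler_pM _ _ (snX u) (snX w))) ?exprn_ge0 ?seminorm_ge0//.
by rewrite le_eqVlt; apply/orP; left; apply/eqP; rewrite /hnsum; ring.
Qed.

(** With [k = K + e], the matrix [T = 1 - (X + e) / k] lies between [0] and [r = 1 - e / k]; the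
    shift makes [r < 1]. The fixed point [y] for [T / 4] satisfies
    [(1 - 2 y)^2 = 1 - T = (X + e) / k] and is self-adjoint with its iterates, so
    [Y = sqrt k (1 - 2 y)] lies in [M_n(A)]. *)
Lemma mx_positive_shift X (e : R) : mxstar X = X -> 0 < e ->
  (forall u, 0 <= Re (hsum (mxact X u) u)) ->
  mx_positive (X + mxscal e%:C 1%:M).
Proof.
move=> Xs e0 Xpos; pose K := \sum_i \sum_j cnorm (X i j).
have [K0 XK] := mxbd_sum X; rewrite -/K in K0 XK.
pose k := K + e; have k0 : 0 < k by rewrite ltr_wpDl.
have kC : k%:C != 0 :> R[i] by rewrite fmorph_eq0 gt_eqF.
pose Q := X + mxscal e%:C 1%:M; pose T := 1%:M - mxscal (k%:C)^-1 Q.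
have QS : mxstar Q = Q by rewrite mxstarD Xs mxstarZ conj_real mxstar1.
have rE : Num.conj ((k%:C)^-1 : R[i]) = (k%:C)^-1 by rewrite fmorphV/= conj_real.
have TS : mxstar T = T by rewrite mxstarB mxstar1 mxstarZ QS rE.
pose r := 1 - e / k.
have ek : 0 < e / k by rewrite divr_gt0.
have r0 : 0 <= r by rewrite subr_ge0 ler_pdivrMr// mul1r lerDr.
have r1 : r < 1 by rewrite gtrBl.
have Tr : mxbd T r.
  apply: mx_pos_bd => // u.
  have sq1 : hsum u u = (hnsum u ^+ 2)%:C := seminormE (hsum_psd H n) u.
  have -> : Re (hsum (mxact T u) u) =
      hnsum u ^+ 2 - k^-1 * (Re (hsum (mxact X u) u) + e * hnsum u ^+ 2).
    rewrite mxactB mxactZ mxactD mxactZ mxact1 (psdBl (hsum_psd H n)) ReB sq1.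
    rewrite (psdZl (hsum_psd H n)) -fmorphV ReZ (psdDl (hsum_psd H n)) ReD.
    by rewrite (psdZl (hsum_psd H n)) ReZ sq1.
  have h1 := Xpos u; have : Re (hsum (mxact X u) u) <= K * hnsum u ^+ 2.
    rewrite (le_trans (le_trans (ler_norm _) (Re_le_normc _)))//.
    rewrite (le_trans (psd_CS (hsum_psd H n) _ _))// expr2 mulrA.
    by rewrite ler_wpM2r ?hnsum_ge0 ?XK.
  move: h1; set a := Re _; set s := hnsum u ^+ 2 => a0 aK.
  have kK : k^-1 * (a + e * s) <= s.
    by rewrite ler_pdivrMl// /k mulrDl lerD2r.
  rewrite subr_ge0 kK/= /r mulrBl mul1r lerB// mulrAC mulrC ler_wpM2l ?invr_ge0 ?(ltW k0)//.
  by rewrite lerDr.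
have Zr : mxbd (mxscal (4^-1)%:C T) (r / 4).
  split; first by rewrite divr_ge0.
  move=> u; rewrite mxactZ /hnsum (seminormZ (hsum_psd H n)) normc_real.
  rewrite ger0_norm ?invr_ge0// [r / 4]mulrC -mulrA ler_wpM2l ?invr_ge0//.
  exact: Tr.2.
have rr : 0 <= r < 1 by rewrite r0.
have [u [y [[u0 uS] uy yE _]]] := sqrt_fixpoint mxbd_complete_bound rr Zr.
have uSA m : mxstar (u m) = u m.
  elim: m => [|m ih]; last by rewrite uS mxstarD mxstarZ TS conj_real mxstarM ih.
  by rewrite u0; apply/matrixP => i j; rewrite !mxE star0.
have yS : mxstar y = y.
  exact: (limit_fixed mxbd_complete_bound (@mxstarB R A n) mxbd_star uy uSA).
pose Y := mxscal (Num.sqrt k)%:C (1%:M - y - y); exists Y.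
rewrite -/(mxstar Y) /Y mxstarZ conj_real !mxstarB mxstar1 yS mxscalMl mxscalMr mxscalA.
rewrite -rmorphM -expr2 sqr_sqrtr ?(ltW k0)//.
have -> : (1%:M - y - y) *m (1%:M - y - y) = mxscal (k%:C)^-1 Q.
  transitivity (1%:M - T); last by rewrite /T opprB addrC subrK.
  have -> : T = (y - y *m y) *+ 4.
    have : y - y *m y = mxscal (4^-1)%:C T by rewrite [X in X - _]yE addrK.
    move=> ->; apply/matrixP => i j; rewrite mulmxnE [mxscal _ _ i j]mxE -scaler_nat scalerA.
    have -> : 4%:R * (4^-1)%:C = 1 :> R[i]; last by rewrite scale1r.
    by rewrite fmorphV/= (rmorph_nat (real_complex R)) divff// pnatr_eq0.
  exact: sqr_1_subDD.
by rewrite mxscalA divff// mxscal1.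
Qed.

End Fixed.
End Representation.

(** * Extension of positive functionals *)

Section RieszExtension.
Variables (R : realType) (V : lmodType R[i]).
Variables (D C : set V) (e : V) (G : set (V * R)).

(** Partial real-linear functionals, positive on [C], as graphs. Single-valuedness is not a field:
    as [0] lies in [C], positivity at the zero vector forces it. *)
Record real_graph (Y : set (V * R)) : Prop := RealGraph {
  graph_dom : forall p, Y p -> D p.1;
  graphD : forall p q, Y p -> Y q -> Y (p.1 + q.1, p.2 + q.2);
  graphZ : forall (r : R) p, Y p -> Y (r%:C *: p.1, r * p.2);
  graph_pos : forall p, Y p -> C p.1 -> 0 <= p.2
}.

Hypothesis DD : forall x y, D x -> D y -> D (x + y).
Hypothesis DZ : forall (r : R) x, D x -> D (r%:C *: x).
Hypothesis CD : forall x y, C x -> C y -> C (x + y).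
Hypothesis CZ : forall (r : R) x, 0 <= r -> C x -> C (r%:C *: x).
Hypothesis C0 : C 0.
Hypothesis unit_C : forall x, D x -> exists k : R, C (k%:C *: e - x).
Hypothesis Ge : G (e, 1).
Hypothesis graphG : real_graph G.

(** The value at [v] is the supremum of the values at the [w] with [v - w] in [C]; the order unit
    [e] makes this set nonempty and bounded above. The sign of [r] decides whether the supremum is
    used as an upper bound or as a least one. [v] may already lie in the domain, since positivity
    forces consistency. *)
Lemma graph_extend (Y : set (V * R)) v : real_graph Y -> Y (e, 1) -> D v ->
  exists s, real_graph
    [set p | exists w t (r : R), Y (w, t) /\ p = (w + r%:C *: v, t + r * s)].
Proof.
move=> hY Ye Dv.
pose L := [set t | exists w, Y (w, t) /\ C (v - w)].
have LU t w' t' : L t -> Y (w', t') -> C (w' - v) -> t <= t'.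
  move=> [w [Yw Cw]] Yw' Cw'.
  have := graphD hY Yw' (graphZ hY (-1) Yw).
  move/(graph_pos hY) => /=; rewrite mulN1r subr_ge0; apply.
  by rewrite rmorphN1 scaleN1r; have := CD Cw' Cw; rewrite addrA subrK.
have hsup : has_sup L.
  split.
    have [k hk] := unit_C (DZ (-1) Dv).
    exists (- k), ((- k)%:C *: e); split.
      by have := graphZ hY (- k) Ye; rewrite /= mulr1.
    move: hk; rewrite !rmorphN1 scaleN1r opprK rmorphN scaleNr opprK.
    by rewrite addrC.
  have [k hk] := unit_C Dv; exists k => t Lt; apply: (LU _ _ _ Lt _ hk).
  by have := graphZ hY k Ye; rewrite /= mulr1.
exists (sup L); split.
- move=> _ [w [t [r [Yw ->]]]] /=; apply: DD; first exact: (graph_dom hY Yw).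
  exact: DZ.
- move=> _ _ [w [t [r [Yw ->]]]] [w' [t' [r' [Yw' ->]]]] /=.
  exists (w + w'), (t + t'), (r + r'); split; first exact: (graphD hY Yw Yw').
  by rewrite rmorphD scalerDl mulrDl (addrACA w) (addrACA t).
- move=> a _ [w [t [r [Yw ->]]]] /=; exists (a%:C *: w), (a * t), (a * r).
  split; first exact: (graphZ hY a Yw).
  by rewrite scalerDr scalerA mulrDr mulrA rmorphM.
- move=> _ [w [t [r [Yw ->]]]] /= Cw.
  have [r0|r0|r0] := ltgtP r 0.
  + have nr : 0 < - r by rewrite oppr_gt0.
    have nrC : (- r)%:C != 0 :> R[i] by rewrite fmorph_eq0 gt_eqF.
    have Yw2 := graphZ hY (- r)^-1 Yw.
    suff h : sup L <= (- r)^-1 * t.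
      by move: h; rewrite ler_pdivlMl// mulNr -subr_ge0 opprK.
    apply: sup_le_ub; first by case: hsup.
    move=> l Ll; apply: (LU _ _ _ Ll Yw2) => /=.
    have := CZ (ltW (etrans (invr_gt0 _) nr)) Cw.
    rewrite scalerDr scalerA -rmorphM invrN mulNr mulVf ?lt_eqF//.
    by rewrite rmorphN1 scaleN1r.
  + have Yw2 := graphZ hY (- r^-1) Yw.
    have Cw2 : C (v - (- r^-1)%:C *: w).
      have := CZ (ltW (etrans (invr_gt0 _) r0)) Cw.
      rewrite scalerDr scalerA -rmorphM mulVf ?gt_eqF// scale1r.
      by rewrite rmorphN scaleNr opprK addrC.
    have : - r^-1 * t <= sup L by apply: sup_upper_bound => //; exists ((- r^-1)%:C *: w).
    move=> h; have := ler_wpM2l (ltW r0) h; rewrite mulrA mulrN divff ?gt_eqF// mulN1r.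
    by rewrite -subr_ge0 opprK addrC.
  + have := graph_pos hY Yw; rewrite r0 mul0r addr0; apply.
    by move: Cw; rewrite r0 scale0r addr0.
Qed.

Theorem riesz_extension : exists F : V -> R,
  [/\ forall x y, D x -> D y -> F (x + y) = F x + F y,
      forall (r : R) x, D x -> F (r%:C *: x) = r * F x,
      forall x, D x -> C x -> 0 <= F x &
      forall p, G p -> F p.1 = p.2].
Proof.
(* Zorn's lemma runs over the sets to be added to [G], so that the empty chain is covered too. *)
have [|A [gA maxA]] := @Zorn_bigcup (V * R) [set X | real_graph (G `|` X)].
  move=> F FP Ftot.
  have common p q : (G `|` \bigcup_(X in F) X) p -> (G `|` \bigcup_(X in F) X) q ->
      exists Y, [/\ real_graph Y, Y `<=` G `|` \bigcup_(X in F) X, Y p & Y q].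
    have sub X : F X -> G `|` X `<=` G `|` \bigcup_(X in F) X.
      by move=> FX; apply: setUS; exact: bigcup_sup.
    move=> [Gp|[X FX Xp]] [Gq|[Z FZ Zq]].
    - by exists G; split=> //; exact: subsetUl.
    - by exists (G `|` Z); split; [exact: FP|exact: sub|left|right].
    - by exists (G `|` X); split; [exact: FP|exact: sub|right|left].
    - have [XZ|ZX] := Ftot _ _ FX FZ.
        by exists (G `|` Z); split; [exact: FP|exact: sub|right; exact: XZ|right].
      by exists (G `|` X); split; [exact: FP|exact: sub|right|right; exact: ZX].
  split.
  - by move=> p Yp; have [Y [hY _ Yp' _]] := common p p Yp Yp; exact: (graph_dom hY).
  - move=> p q Yp Yq; have [Y [hY sY Yp' Yq']] := common p q Yp Yq.
    exact/sY/(graphD hY).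
  - move=> r p Yp; have [Y [hY sY Yp' _]] := common p p Yp Yp.
    exact/sY/(graphZ hY).
  - by move=> p Yp; have [Y [hY _ Yp' _]] := common p p Yp Yp; exact: (graph_pos hY).
pose Y := G `|` A; have hY : real_graph Y := gA.
have Ye : Y (e, 1) by left.
have tot v : exists t, D v -> Y (v, t).
  have [Dv|nDv] := pselect (D v); last by exists 0.
  have [s hs] := graph_extend hY Ye Dv; exists s => _.
  apply: contrapT => nY; set A' := [set p | _] in hs.
  have YA' : Y `<=` A'.
    by move=> [w t] Yw; exists w, t, 0; rewrite rmorph0 scale0r mul0r !addr0.
  have Y0 : Y (0, 0) by have := graphZ hY 0 Ye; rewrite /= rmorph0 scale0r mul0r.
  apply: (maxA A').
    split; first by move=> p Ap; apply: YA'; right.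
    move=> /(_ (v, s)) h; apply: nY; right; apply: h.
    by exists 0, 0, 1; rewrite rmorph1 scale1r mul1r !add0r.
  by rewrite /= (_ : G `|` A' = A')//; apply/setUidPr => p Gp; apply: YA'; left.
have [F hF] := choice tot.
have uniqY v t s : Y (v, t) -> Y (v, s) -> t = s.
  move=> Yt Ys; have le a b : Y (v, a) -> Y (v, b) -> a <= b.
    move=> Ya Yb; have := graph_pos hY (graphD hY Yb (graphZ hY (-1) Ya)).
    by rewrite /= rmorphN1 scaleN1r subrr mulN1r subr_ge0; apply.
  by apply/eqP; rewrite eq_le !le.
exists F; split.
- move=> x y Dx Dy; apply: uniqY; first exact/hF/DD.
  exact: (graphD hY (hF _ Dx) (hF _ Dy)).
- move=> r x Dx; apply: uniqY; first exact/hF/DZ.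
  exact: (graphZ hY r (hF _ Dx)).
- by move=> x Dx; exact: (graph_pos hY (hF _ Dx)).
- move=> [v t] Gp /=; apply: (@uniqY v); last by left.
  exact/hF/(graph_dom graphG Gp).
Qed.

End RieszExtension.

(** * Ultralimits *)

Section UltraLimit.
Variables (R : realType) (I : Type) (U : set_system I).

Lemma fmap_ultra (T : Type) (f : I -> T) : UltraFilter U -> UltraFilter (f @ U).
Proof.
move=> UU; split => [|G PG fG]; first exact: fmap_proper_filter.
rewrite predeqE => A; split; last exact: fG.
move=> GA; have [//|nA] := in_ultra_setVsetC (f @^-1` A) UU.
have GnA : G (~` A) by apply: fG.
by have [x []] := filter_ex (filterI GA GnA).
Qed.

Lemma bounded_ultralimit (f : I -> R) (K : R) : UltraFilter U ->
  (forall i, `|f i| <= K) -> exists l : R, f @ U --> l.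
Proof.
move=> UU fK; have := @segment_compact R (- K) K.
rewrite compact_ultra => /(_ (f @ U)).
have fU : U (f @^-1` `[- K, K]%classic).
  by apply: (@filterE _ U) => i; rewrite /= in_itv/= -ler_norml; exact: fK.
by move=> /(_ (fmap_ultra _ _) fU) [l [_ fl]]; exists l.
Qed.

End UltraLimit.

(** * From real-linear to complex-linear functionals *)

Section Complexify.
Variables (R : realType) (V : lmodType R[i]) (D : set V) (f : V -> R).
Hypothesis fD : forall x y, D x -> D y -> f (x + y) = f x + f y.
Hypothesis fZ : forall (r : R) x, D x -> f (r%:C *: x) = r * f x.
Hypothesis DZ : forall (c : R[i]) x, D x -> D (c *: x).

(** The complex-linear functional with real part [f]: the imaginary part at [x] has to be minus the
    real part at [i x]. *)
Definition complexify (x : V) : R[i] := Complex (f x) (- f ('i%C *: x)).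

Lemma complexify_linear c x y : D x -> D y ->
  complexify (c *: x + y) = c * complexify x + complexify y.
Proof.
move=> Dx Dy; case: c => a b.
have cE : (a +i* b)%C = a%:C + b%:C * 'i%C by simpc.
have D1 z : D z -> f ((a +i* b)%C *: z) = a * f z + b * f ('i%C *: z).
  by move=> Dz; rewrite cE scalerDl -scalerA fD ?fZ//; do !apply: DZ.
have i2 z : D z -> f ('i%C *: ('i%C *: z)) = - f z.
  move=> Dz; rewrite scalerA (_ : _ * _ = (-1)%:C) ?fZ ?mulN1r//.
  by simpc.
rewrite /complexify scalerDr !fD ?D1//; do ?by do !apply: DZ.
rewrite scalerA ['i%C * _]mulrC -scalerA D1; last exact: DZ.
by rewrite i2//; simpc; congr Complex; ring.
Qed.

End Complexify.

(** * Bounded sequences as a C*-algebra, the target of the lifting *)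

Section LinfCStar.
Variables (R : realType) (M : cstarAlgType R).
Implicit Types x y : linf M.

Definition linf_norm x : R := sup (range (fun k => cnorm (x k))).

Lemma linf_norm_le x (K : R) : linf_norm x <= K <-> forall k, cnorm (x k) <= K.
Proof.
have hs : has_sup (range (fun k => cnorm (x k))).
  split; first by exists (cnorm (x 0%N)), 0%N.
  by have /bounded_seqP[L xL] := valP x; exists L => _ [k _ <-]; exact: xL.
split=> [xK k|xK].
  by apply: le_trans xK; apply: sup_upper_bound => //; exists k.
by apply: sup_le_ub; [case: hs|move=> _ [k _ <-]].
Qed.

Lemma linf_norm_ge x k : cnorm (x k) <= linf_norm x.
Proof. by move: k; apply/linf_norm_le. Qed.

Lemma linf_norm_triangle x y : linf_norm (x + y) <= linf_norm x + linf_norm y.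
Proof.
apply/linf_norm_le => k; rewrite (le_trans (cnorm_triangle _ _))//.
by rewrite lerD ?linf_norm_ge.
Qed.

Lemma linf_normM x y : linf_norm (x * y) <= linf_norm x * linf_norm y.
Proof.
apply/linf_norm_le => k; rewrite (le_trans (cnormM _ _))//.
by rewrite ler_pM ?cnorm_ge0 ?linf_norm_ge.
Qed.

Lemma linf_norm_ge0 x : 0 <= linf_norm x.
Proof. by rewrite (le_trans (cnorm_ge0 (x 0%N)))// linf_norm_ge. Qed.

Lemma linf_normZ_le (c : R[i]) x : linf_norm (c *: x) <= normc c * linf_norm x.
Proof.
apply/linf_norm_le => k; rewrite [cnorm _]cnormZ_real.
by rewrite ler_wpM2l ?normc_ge0 ?linf_norm_ge.
Qed.

Lemma linf_normZ (c : R[i]) x : (linf_norm (c *: x))%:C = `|c| * (linf_norm x)%:C.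
Proof.
rewrite normC_real -rmorphM; congr (_%:C); apply/eqP; rewrite eq_le linf_normZ_le.
have [->|c0] := eqVneq c 0; first by rewrite normc0 mul0r linf_norm_ge0.
have nc : 0 < normc c.
  by rewrite lt_def normc_ge0 andbT; apply: contra c0 => /eqP/eq0_normc ->.
rewrite -ler_pdivlMl// -normcV.
by have := linf_normZ_le c^-1 (c *: x); rewrite scalerA mulVf// scale1r.
Qed.

Lemma linf_norm_eq0 x : linf_norm x = 0 -> x = 0.
Proof.
move=> x0; apply: val_inj; apply/funext => k; apply: cnorm_eq0; apply/eqP.
by rewrite eq_le cnorm_ge0 -x0 linf_norm_ge.
Qed.

Lemma linf_norm_star_mul x : linf_norm (star x * x) = linf_norm x ^+ 2.
Proof.
apply/eqP; rewrite eq_le; apply/andP; split.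
  apply/linf_norm_le => k; rewrite [cnorm _]cnorm_star_mul.
  by rewrite ler_pXn2r ?nnegrE ?cnorm_ge0 ?linf_norm_ge0 ?linf_norm_ge.
rewrite -(sqr_sqrtr (linf_norm_ge0 (star x * x))).
rewrite ler_pXn2r ?nnegrE ?linf_norm_ge0 ?sqrtr_ge0//.
apply/linf_norm_le => k; rewrite -(ger0_norm (cnorm_ge0 (x k))) -sqrtr_sqr.
by apply: ler_wsqrtr; rewrite -cnorm_star_mul; exact: (linf_norm_ge (star x * x) k).
Qed.

Lemma linf_norm_complete (u : nat -> linf M) :
  (forall e : R, 0 < e -> exists N, forall m n, (N <= m)%N -> (N <= n)%N ->
     linf_norm (u m - u n) < e) ->
  exists l, linf_norm (u n - l) @[n --> \oo] --> (0 : R).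
Proof.
move=> uC; have hM := cstar_complete_bound M.
have lim k : exists l : M, forall e, 0 < e -> exists N, forall n, (N <= n)%N ->
    cnorm (u n k - l) <= e.
  apply: (bd_complete hM) => e e0; have [N hN] := uC e e0; exists N => m n Nm Nn.
  by rewrite (le_trans _ (ltW (hN m n Nm Nn)))//; exact: (linf_norm_ge (u m - u n) k).
have [l hl] := choice lim.
have unif e : 0 < e -> exists N, forall n, (N <= n)%N -> forall k,
    cnorm (u n k - l k) <= e.
  move=> e0; have [N hN] := uC e e0; exists N => n Nn k.
  apply/ler_addgt0Pr => d d0; have [N' hN'] := hl k d d0.
  pose m := maxn N N'.
  rewrite -(subrK (u m k) (u n k)) -addrA (le_trans (cnorm_triangle _ _))//.
  rewrite lerD ?hN' ?leq_maxr//.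
  rewrite (le_trans _ (ltW (hN n m Nn (leq_maxl _ _))))//.
  exact: (linf_norm_ge (u n - u m) k).
have lb : l \in @bounded_seq R M.
  apply/bounded_seqP; have [N hN] := unif 1 ltr01.
  exists (1 + linf_norm (u N)) => k.
  rewrite -[l k](subrK (u N k)) (le_trans (cnorm_triangle _ _))//.
  by rewrite lerD ?linf_norm_ge// cnorm_sub hN.
exists (Linf lb); apply/cvgr0Pnorm_lt => e e0.
have [N hN] := unif _ (divr_gt0 e0 (ltr0Sn R 1)).
exists N => //= n Nn; rewrite ger0_norm ?linf_norm_ge0//.
apply: (@le_lt_trans _ _ (e / 2)); last by rewrite ltr_pdivrMr// mulr2n mulrDr mulr1 ltrDl.
by apply/linf_norm_le => k; exact: hN.
Qed.

HB.instance Definition _ := StarAlgebra_isCStar.Build R (linf M)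
  linf_norm_triangle linf_normZ linf_norm_eq0 linf_normM linf_norm_star_mul
  linf_norm_complete.

End LinfCStar.

(** * Ultralimits of bounded complex families *)

Section ComplexUltraLimit.
Variables (R : realType) (I : Type) (U : set_system I).
Hypothesis UU : UltraFilter U.
Implicit Types (g h : I -> R[i]).

Definition cbounded g := exists K : R, forall i, normc (g i) <= K.

Definition ulim g : R[i] :=
  Complex (lim ((fun i => Re (g i)) @ U)) (lim ((fun i => Im (g i)) @ U)).

Lemma Im_le_normc (c : R[i]) : `|Im c| <= normc c.
Proof.
case: c => a b /=; rewrite -sqrtr_sqr ler_wsqrtr// lerDr sqr_ge0//.
Qed.

Lemma ulim_Re g : cbounded g -> (fun i => Re (g i)) @ U --> Re (ulim g).
Proof.
move=> [K gK]; have [i|l gl] := @bounded_ultralimit R I U (fun i => Re (g i)) K UU.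
  exact: le_trans (Re_le_normc _) (gK i).
by rewrite /ulim /= (cvg_lim _ gl).
Qed.

Lemma ulim_Im g : cbounded g -> (fun i => Im (g i)) @ U --> Im (ulim g).
Proof.
move=> [K gK]; have [i|l gl] := @bounded_ultralimit R I U (fun i => Im (g i)) K UU.
  exact: le_trans (Im_le_normc _) (gK i).
by rewrite /ulim /= (cvg_lim _ gl).
Qed.

Lemma ulim_eq g (l : R[i]) : (fun i => Re (g i)) @ U --> Re l ->
  (fun i => Im (g i)) @ U --> Im l -> ulim g = l.
Proof.
case: l => a b /= ga gb.
by rewrite /ulim (cvg_lim _ ga)// (cvg_lim _ gb).
Qed.

Lemma ulim_linear (c : R[i]) g h : cbounded g -> cbounded h ->
  ulim (fun i => c * g i + h i) = c * ulim g + ulim h.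
Proof.
move=> bg bh; apply: ulim_eq.
  have -> : Re (c * ulim g + ulim h) =
      Re c * Re (ulim g) - Im c * Im (ulim g) + Re (ulim h).
    by case: c => a b; case: (ulim g) => ? ?; case: (ulim h).
  rewrite (_ : (fun i => _) = (fun i => Re c * Re (g i) - Im c * Im (g i) + Re (h i))).
    apply: cvgD; last exact: ulim_Re.
    by apply: cvgB; apply: cvgM; do ?exact: cvg_cst; [exact: ulim_Re|exact: ulim_Im].
  by apply/funext => i; case: c => a b; case: (g i) => ? ?; case: (h i).
have -> : Im (c * ulim g + ulim h) =
    Re c * Im (ulim g) + Im c * Re (ulim g) + Im (ulim h).
  by case: c => a b; case: (ulim g) => ? ?; case: (ulim h).
rewrite (_ : (fun i => _) = (fun i => Re c * Im (g i) + Im c * Re (g i) + Im (h i))).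
  apply: cvgD; last exact: ulim_Im.
  by apply: cvgD; apply: cvgM; do ?exact: cvg_cst; [exact: ulim_Im|exact: ulim_Re].
by apply/funext => i; case: c => a b; case: (g i) => ? ?; case: (h i).
Qed.

Lemma ulim_conj g : cbounded g ->
  ulim (fun i => Num.conj (g i)) = Num.conj (ulim g).
Proof.
move=> bg; apply: ulim_eq.
  rewrite Re_conj (_ : (fun i => _) = (fun i => Re (g i))); first exact: ulim_Re.
  by apply/funext => i; rewrite Re_conj.
have -> : Im (Num.conj (ulim g)) = - Im (ulim g) by case: (ulim g).
rewrite (_ : (fun i => _) = (fun i => - Im (g i))); first by apply: cvgN; exact: ulim_Im.
by apply/funext => i; case: (g i).
Qed.

Lemma ulim_cst (c : R[i]) : ulim (fun=> c) = c.
Proof. by apply: ulim_eq; exact: cvg_cst. Qed.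

Lemma ulim_ge0 g : cbounded g -> (forall i, 0 <= g i) -> 0 <= ulim g.
Proof.
move=> bg g0; rewrite lecE; apply/andP; split.
  have := ulim_Im bg; rewrite (_ : (fun i => _) = fun=> 0).
    by move=> /cvg_lim <-//; rewrite lim_cst.
  by apply/funext => i; exact: ger0_Im.
by apply: (cvgr_to_ge (ulim_Re bg)); apply: nearW => i; exact/Re_ge0/g0.
Qed.

Lemma ulim_normc_le g (K : R) : cbounded g ->
  (\forall i \near U, normc (g i) <= K) -> normc (ulim g) <= K.
Proof.
move=> bg gK.
have K0 : 0 <= K by have [i /(le_trans (normc_ge0 _))] := filter_ex gK.
have sqE (c : R[i]) : normc c ^+ 2 = Re c * Re c + Im c * Im c.
  by case: c => a b /=; rewrite sqr_sqrtr ?addr_ge0 ?sqr_ge0// !expr2.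
rewrite -(ler_pXn2r (n := 2)) ?nnegrE ?normc_ge0// sqE.
apply: (cvgr_to_le (cvgD (cvgM (ulim_Re bg) (ulim_Re bg))
  (cvgM (ulim_Im bg) (ulim_Im bg)))).
apply: filterS gK => i gi.
by rewrite !fctE -sqE ler_pXn2r ?nnegrE ?normc_ge0.
Qed.

Lemma ulimB g h : cbounded g -> cbounded h ->
  ulim (fun i => g i - h i) = ulim g - ulim h.
Proof.
move=> bg bh; rewrite [RHS]addrC -mulN1r -ulim_linear//; congr ulim.
by apply/funext => i; rewrite mulN1r addrC.
Qed.

Lemma cboundedB g h : cbounded g -> cbounded h -> cbounded (fun i => g i - h i).
Proof.
move=> [K gK] [L hL]; exists (K + L) => i; rewrite (le_trans (le_normcD _ _))//.
by rewrite normcN lerD.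
Qed.

Lemma ulim_dist_le g h (K : R) : cbounded g -> cbounded h ->
  (forall i, normc (g i - h i) <= K) -> normc (ulim g - ulim h) <= K.
Proof.
move=> bg bh ghK; rewrite -ulimB//; apply: ulim_normc_le.
  exact: cboundedB.
exact: nearW.
Qed.

End ComplexUltraLimit.

(** * Density of a *-algebra in its bicommutant *)

Section Eps.
Variable R : realType.

(** One rate for all approximating sequences: errors [c * eps l] combine by adding their constants,
    and [le_eps] lets the index tend to infinity. *)
Definition eps (l : nat) : R := l.+1%:R^-1.

Lemma eps_gt0 l : 0 < eps l.
Proof. by rewrite invr_gt0. Qed.

Lemma eps_le1 l : eps l <= 1.
Proof. by rewrite invf_le1// ler1n. Qed.

Lemma eps_small (e : R) : 0 < e -> exists N, forall l, (N <= l)%N -> eps l < e.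
Proof.
move=> e0; have [N _ hN] := (cvgr0Pnorm_lt _).1 (@cvg_harmonic R) _ e0.
by exists N => l /hN /=; rewrite ger0_norm ?(ltW (eps_gt0 l)).
Qed.

Lemma le_eps (a b c : R) : (forall j, a <= b + c * eps j) -> a <= b.
Proof.
move=> h; apply/ler_addgt0Pr => e e0.
have c1 : 0 < `|c| + 1 by rewrite ltr_wpDl.
have [N hN] := eps_small (divr_gt0 e0 c1).
apply: le_trans (h N) _; rewrite lerD2l.
apply: (@le_trans _ _ ((`|c| + 1) * eps N)).
  by rewrite ler_wpM2r ?(ltW (eps_gt0 N))// (le_trans (ler_norm c))// lerDl.
by rewrite mulrC -ler_pdivlMr// ltW// hN.
Qed.

End Eps.

Section HilbertComplete.
Variables (R : realType) (H : hilbertType R).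

Lemma hnormD (u v : H) : hnorm (u + v) <= hnorm u + hnorm v.
Proof. exact: seminormD (inner_psd H) _ _. Qed.

Lemma hnormB (u v : H) : hnorm (u - v) <= hnorm u + hnorm v.
Proof. exact: seminormB (inner_psd H) _ _. Qed.

Lemma hnormZ (c : R[i]) (u : H) : hnorm (c *: u) = normc c * hnorm u.
Proof. exact: seminormZ (inner_psd H) _ _. Qed.

Lemma hnormBC (u v : H) : hnorm (u - v) = hnorm (v - u).
Proof. exact: seminormBC (inner_psd H) _ _. Qed.

Lemma hnorm_dist (u v w : H) : hnorm (u - w) <= hnorm (u - v) + hnorm (v - w).
Proof. by have := hnormD (u - v) (v - w); rewrite addrA subrK. Qed.

Lemma hnorm_le0 (u : H) : hnorm u <= 0 -> u = 0.
Proof.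
move=> u0; apply/eqP; rewrite -normr_eq0 hnormE.
by rewrite (_ : hnorm u = 0)//; apply/eqP; rewrite eq_le u0 hnorm_ge0.
Qed.

Lemma hilbert_cauchy (u : nat -> H) (c : R) : 0 <= c ->
  (forall l j, hnorm (u l - u j) <= c * (eps R l + eps R j)) ->
  exists w, forall l, hnorm (u l - w) <= c * eps R l.
Proof.
move=> c0 uC.
have c1 : 0 < 2 * c + 1 by rewrite ltr_wpDl// mulr_ge0.
have small e : 0 < e -> exists N, forall l j, (N <= l)%N -> (N <= j)%N ->
    hnorm (u l - u j) < e.
  move=> e0; have [N hN] := eps_small (divr_gt0 e0 c1); exists N => l j Nl Nj.
  rewrite (le_lt_trans (uC l j))//.
  have := hN l Nl; have := hN j Nj; rewrite !ltr_pdivlMr//.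
  have := eps_gt0 R l; have := eps_gt0 R j; nra.
have /cauchy_cvg : cauchy (u @ \oo).
  apply/cauchy_ballP => e e0.
  have eE := ge0_ReE (ltW e0).
  have [|N hN] := small (Re e); first by rewrite -ltcR -eE.
  exists ([set u l | l in [set l | (N <= l)%N]], [set u l | l in [set l | (N <= l)%N]]).
    by split; exists N => //= l Nl; exists l.
  move=> [a b] [[l /= Nl <-] [j /= Nj <-]].
  by rewrite -ball_normE /= hnormE eE ltcR hN.
move=> /cvg_ex[w uw]; exists w => l; apply/ler_addgt0Pr => d d0.
have c1' : 0 < c + 1 by rewrite ltr_wpDl.
have e0 : 0 < d / 2 by rewrite divr_gt0.
have e0C : 0 < (d / 2)%:C :> R[i] by rewrite ltcR.
have [N1 hN1] := eps_small (divr_gt0 e0 c1').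
have [N _ hN] := (cvgrPdist_lt _ _).1 uw _ e0C.
pose j := maxn N1 N.
have jw : hnorm (u j - w) < d / 2.
  by have := hN j (leq_maxr N1 N); rewrite /= hnormE ltcR hnormBC.
rewrite (le_trans (hnorm_dist _ (u j) _))//.
have := uC l j; have := hN1 j (leq_maxl N1 N); rewrite ltr_pdivlMr//.
have := eps_gt0 R j; lra.
Qed.

End HilbertComplete.

Section Density.
Variables (R : realType) (M : cstarAlgType R) (K : hilbertType R).
Variables (io : M -> K -> K) (hio : faithful_rep io).
Variables (N : set M) (hN : star_subalgebra N).
Hypothesis bicomm : forall x, commutant (commutant (io @` N)) (io x).
Variables (zeta : nat -> K) (Kb : R).
Hypothesis zetaK : forall n, \sum_(i < n) hnorm (zeta i) ^+ 2 <= Kb.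
Variables (U : set_system nat) (UU : UltraFilter U).
Hypothesis Uoo : forall m, U [set n | (m <= n)%N].
Local Notation eps := (eps R).

Let N1 : N 1 := opsys1 (subalg_opsys hN).
Let Nlin (c : R[i]) x y : N x -> N y -> N (c *: x + y).
Proof. exact: (opsys_linear (subalg_opsys hN)). Qed.
Let Nstar x : N x -> N (star x).
Proof. exact: (opsys_star (subalg_opsys hN)). Qed.
Let Nmul x y : N x -> N y -> N (x * y).
Proof. exact: (subalg_mul hN). Qed.
Let N0 : N 0.
Proof. by have := Nlin (-1) N1 N1; rewrite scaleN1r addNr. Qed.
Let NB x y : N x -> N y -> N (x - y).
Proof. by move=> Nx Ny; have := Nlin (-1) Ny Nx; rewrite scaleN1r addrC. Qed.

Definition evec n (y : M) : 'I_n -> K := fun i => io y (zeta i).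
Arguments evec : clear implicits.

Lemma evec_lin n (c : R[i]) y z : evec n (c *: y + z) = c *: evec n y + evec n z.
Proof. by apply/funext => i; rewrite /evec (rep_linear hio). Qed.

Lemma evecB n y z : evec n (y - z) = evec n y - evec n z.
Proof. by rewrite addrC -scaleN1r evec_lin scaleN1r addrC. Qed.

Lemma evec_mul_le n m y : hnsum (evec n (m * y)) <= cnorm m * hnsum (evec n y).
Proof.
rewrite -(ler_pXn2r (n := 2)) ?nnegrE ?mulr_ge0 ?hnsum_ge0 ?cnorm_ge0//.
rewrite exprMn !hnsumE mulr_sumr ler_sum// => i _; rewrite -exprMn.
rewrite ler_pXn2r ?nnegrE ?mulr_ge0 ?hnorm_ge0 ?cnorm_ge0//.
by rewrite /evec (repM hio) (rep_le hio).
Qed.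

Lemma evec_mono n k y : (n <= k)%N -> hnsum (evec n y) <= hnsum (evec k y).
Proof.
move=> nk; rewrite -(ler_pXn2r (n := 2)) ?nnegrE ?hnsum_ge0// !hnsumE.
rewrite -!(big_mkord xpredT (fun i => hnorm (io y (zeta i)) ^+ 2)).
rewrite [leRHS](big_cat_nat (n := n))//= lerDl.
by apply: sumr_ge0 => i _; rewrite exprn_ge0 ?hnorm_ge0.
Qed.

Lemma hnorm_evec k y n : (k < n)%N -> hnorm (io y (zeta k)) <= hnsum (evec n y).
Proof. by move=> kn; exact: (hnorm_le_hnsum (evec n y) (Ordinal kn)). Qed.

Let L := Num.sqrt Kb.

Lemma evec_bound n y : hnsum (evec n y) <= cnorm y * L.
Proof.
rewrite -[y in evec _ y]mulr1 (le_trans (evec_mul_le _ _ _))//.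
rewrite ler_wpM2l ?cnorm_ge0// -(ger0_norm (hnsum_ge0 _)) -sqrtr_sqr ler_wsqrtr//.
rewrite hnsumE (le_trans _ (zetaK n))// ler_sum// => i _.
by rewrite /evec (rep1 hio).
Qed.

Lemma evec_CS n y (w : 'I_n -> K) : normc (hsum (evec n y) w) <= hnsum (evec n y) * hnsum w.
Proof. exact: psd_CS (hsum_psd K n) _ _. Qed.

Lemma evec_cbounded y z : cbounded (fun n => hsum (evec n y) (evec n z)).
Proof.
exists (cnorm y * L * (cnorm z * L)) => n; rewrite (le_trans (evec_CS _ _))//.
by rewrite ler_pM ?hnsum_ge0 ?evec_bound.
Qed.

(** The inner product of [y zeta] and [z zeta] in [l^2(K)], where [y zeta] is the sequence of the
    [io y (zeta i)]. Taking the limit along an ultrafilter makes sesquilinearity immediate. *)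
Definition tform (y z : M) : R[i] := ulim U (fun n => hsum (evec n y) (evec n z)).

Lemma tform_psd : psd_form tform.
Proof.
split=> [c x y z|c x y z|x].
- rewrite -ulim_linear; do ?exact: evec_cbounded.
  by congr ulim; apply/funext => n; rewrite evec_lin (psdl (hsum_psd K n)).
- have conjB y' z' : tform y' z' = Num.conj (tform z' y').
    rewrite /tform -ulim_conj; do ?exact: evec_cbounded.
    by congr ulim; apply/funext => n; exact: (psd_conj (hsum_psd K n)).
  rewrite conjB [tform z x]conjB [tform z y]conjB -rmorphM -rmorphD; congr Num.conj.
  rewrite -ulim_linear; do ?exact: evec_cbounded.
  by congr ulim; apply/funext => n; rewrite evec_lin (psdl (hsum_psd K n)).
- apply: ulim_ge0; first exact: evec_cbounded.
  by move=> n; exact: (psd_ge0 (hsum_psd K n)).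
Qed.

Local Notation tn := (seminorm tform).

Lemma tn_ge0 y : 0 <= tn y. Proof. exact: seminorm_ge0. Qed.

Let Re_tform y : (fun n => hnsum (evec n y) ^+ 2) @ U --> tn y ^+ 2.
Proof.
have := ulim_Re UU (evec_cbounded y y); rewrite -/(tform y y).
rewrite (seminormE tform_psd)/= (_ : (fun n => _) = fun n => hnsum (evec n y) ^+ 2)//.
by apply/funext => n; rewrite (seminormE (hsum_psd K n)).
Qed.

(** The truncated norms increase and [U] contains the tails, so [tn] is their supremum; [tn_le] is
    the other half. *)
Lemma evec_le n y : hnsum (evec n y) <= tn y.
Proof.
rewrite -(ler_pXn2r (n := 2)) ?nnegrE ?hnsum_ge0 ?tn_ge0//.
apply: (cvgr_to_ge (@Re_tform y)); apply: filterS (Uoo n) => k nk.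
by rewrite ler_pXn2r ?nnegrE ?hnsum_ge0// evec_mono.
Qed.

Lemma tn_le y k : (forall n, hnsum (evec n y) <= k) -> tn y <= k.
Proof.
move=> yk; have k0 : 0 <= k := le_trans (hnsum_ge0 _) (yk 0%N).
rewrite -(ler_pXn2r (n := 2)) ?nnegrE ?tn_ge0//.
apply: (cvgr_to_le (@Re_tform y)); apply: nearW => n.
by rewrite ler_pXn2r ?nnegrE ?hnsum_ge0.
Qed.

Lemma tn_mul m y : tn (m * y) <= cnorm m * tn y.
Proof.
apply: tn_le => n; rewrite (le_trans (evec_mul_le _ _ _))//.
by rewrite ler_wpM2l ?cnorm_ge0 ?evec_le.
Qed.

Lemma tform_star m y z : tform (m * y) z = tform y (star m * z).
Proof.
congr ulim; apply/funext => n; apply: eq_bigr => i _.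
by rewrite /evec !(repM hio) (rep_star hio).
Qed.

Lemma hnorm_tn k y : hnorm (io y (zeta k)) <= tn y.
Proof. exact: le_trans (hnorm_evec _ (ltnSn k)) (evec_le _ _). Qed.

(* [p] represents [lam] on N up to c / (l + 1) *)
Definition reps (lam : M -> R[i]) (p : nat -> M) (c : R) : Prop :=
  [/\ 0 <= c, forall l, N (p l) &
  forall l n, N n -> normc (lam n - tform n (p l)) <= c * eps l * tn n].

Lemma reps_exists (lam : M -> R[i]) (C : R) : 0 <= C ->
  (forall (c : R[i]) x y, lam (c *: x + y) = c * lam x + lam y) ->
  (forall x, normc (lam x) <= C * tn x) -> exists p, reps lam p 1.
Proof.
move=> C0 lamlin lamC.
have /choice[p hp] : forall l, exists p, N p /\
    forall n, N n -> normc (lam n - tform n p) <= 1 * eps l * tn n.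
  move=> l.
  have [p Np hp] := @approx_riesz R M tform tform_psd N lam C N0 (fun c x y => @Nlin c x y)
    (fun c x y _ _ => lamlin c x y) C0 (fun x _ => lamC x) _ (eps_gt0 R l).
  by exists p; split=> // n Nn; rewrite mul1r hp.
by exists p; split=> // l; have [] := hp l.
Qed.

(** Both representations are tested on the difference [p l - q j] itself, which lies in [N]. With
    [p = q] this shows that a representing sequence is Cauchy for [tn]. *)
Lemma reps_dist lam p q c d l j : reps lam p c -> reps lam q d ->
  tn (p l - q j) <= c * eps l + d * eps j.
Proof.
move=> [c0 Np hp] [d0 Nq hq]; set z := p l - q j.
have Nz : N z by exact: NB.
have [->|z0] := eqVneq (tn z) 0.
  by rewrite addr_ge0// mulr_ge0// ltW// eps_gt0.
have zp : 0 < tn z by rewrite lt_def z0 tn_ge0.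
rewrite -(ler_pM2r zp) -expr2 mulrDl.
have -> : tn z ^+ 2 = Re (tform z (p l) - tform z (q j)).
  by rewrite -(psdBr tform_psd) (seminormE tform_psd).
rewrite (le_trans (le_trans (ler_norm _) (Re_le_normc _)))//.
rewrite (_ : _ - _ = (lam z - tform z (q j)) - (lam z - tform z (p l))); last by ring.
by rewrite (le_trans (le_normcD _ _))// normcN addrC lerD// ?hp ?hq.
Qed.

(** The pairing of [y zeta] with the vector of [l^2(K)] that has [v] at place [k] and [0] elsewhere.
    If [p] represents it on [N], then [p l zeta] tends to the projection of that vector onto the
    closure of [N zeta]. *)
Definition lam (k : nat) (v : K) (y : M) : R[i] := inner (io y (zeta k)) v.

Lemma lam_le k v y : normc (lam k v y) <= tn y * hnorm v.
Proof.
rewrite (le_trans (psd_CS (inner_psd K) _ _))// ler_wpM2r ?hnorm_ge0//.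
exact: hnorm_tn.
Qed.

Lemma reps_tn k v p c l : reps (lam k v) p c -> tn (p l) <= hnorm v + c * eps l.
Proof.
move=> [c0 Np hp]; have e0 := ltW (eps_gt0 R l); set z := p l.
have [->|z0] := eqVneq (tn z) 0; first by rewrite addr_ge0 ?hnorm_ge0// mulr_ge0.
have zp : 0 < tn z by rewrite lt_def z0 tn_ge0.
rewrite -(ler_pM2r zp) -expr2 mulrDl.
have -> : tn z ^+ 2 = Re (tform z (p l)) by rewrite (seminormE tform_psd).
rewrite (le_trans (le_trans (ler_norm _) (Re_le_normc _)))//.
rewrite (_ : tform _ _ = lam k v z - (lam k v z - tform z (p l))); last by ring.
rewrite (le_trans (le_normcD _ _))// normcN lerD//; last exact: hp (Np l).
by rewrite mulrC lam_le.
Qed.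

Lemma reps_lin k (a : R[i]) u v p q c d : reps (lam k u) p c -> reps (lam k v) q d ->
  reps (lam k (a *: u + v)) (fun l => a *: p l + q l) (normc a * c + d).
Proof.
move=> [c0 Np hp] [d0 Nq hq]; split.
- by rewrite addr_ge0// mulr_ge0// normc_ge0.
- by move=> l; apply: Nlin.
- move=> l n Nn; rewrite (psdr tform_psd) /lam (psdr (inner_psd K)).
  rewrite (_ : _ - _ = Num.conj a * (lam k u n - tform n (p l)) +
    (lam k v n - tform n (q l))); last by rewrite /lam; ring.
  rewrite (le_trans (le_normcD _ _))// normcM normc_conj !mulrDl lerD ?hq//.
  by rewrite -!mulrA ler_wpM2l ?normc_ge0// mulrA hp.
Qed.

Lemma reps_mul k m v p c : N m -> reps (lam k v) p c ->
  reps (lam k (io m v)) (fun l => m * p l) (c * cnorm m).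
Proof.
move=> Nm [c0 Np hp]; split.
- by rewrite mulr_ge0 ?cnorm_ge0.
- by move=> l; exact: Nmul.
- move=> l n Nn.
  have -> : lam k (io m v) n = lam k v (star m * n).
    by rewrite /lam (repM hio) [RHS](rep_star hio) starK.
  rewrite -[m in m * p l]starK -tform_star (le_trans (hp l _ _))//.
    by apply: Nmul => //; exact: Nstar.
  rewrite -!mulrA ler_wpM2l// mulrCA ler_wpM2l ?(ltW (eps_gt0 R l))//.
  by rewrite (le_trans (tn_mul _ _))// cnorm_star.
Qed.

Lemma proj_data_exists k v : exists pw : (nat -> M) * (nat -> K), reps (lam k v) pw.1 1 /\
  forall i l, hnorm (io (pw.1 l) (zeta i) - pw.2 i) <= eps l.
Proof.
have [||p hp] := @reps_exists (lam k v) (hnorm v) (hnorm_ge0 v).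
- by move=> c x y; rewrite /lam (rep_linear hio) (psdl (inner_psd K)).
- by move=> x; rewrite mulrC lam_le.
have /choice[w hw] : forall i, exists w, forall l,
    hnorm (io (p l) (zeta i) - w) <= 1 * eps l.
  move=> i; apply: hilbert_cauchy => // l j.
  rewrite -(repB hio) (le_trans (hnorm_tn _ _))//.
  by rewrite mul1r (le_trans (reps_dist _ _ hp hp))// !mul1r.
by exists (p, w); split=> // i l; rewrite -[eps l]mul1r hw.
Qed.

Definition proj_data k v : (nat -> M) * (nat -> K) := projT1 (cid (proj_data_exists k v)).

(* matrix entries of the projection of l^2(K) onto the closure of N zeta:
   [proj k i] maps v at place k to the i-th entry *)
Definition proj k i v : K := (proj_data k v).2 i.

Lemma proj_dataP k v : reps (lam k v) (proj_data k v).1 1.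
Proof. by have [] := projT2 (cid (proj_data_exists k v)). Qed.

Lemma projP k v i l : hnorm (io ((proj_data k v).1 l) (zeta i) - proj k i v) <= eps l.
Proof. by have [_] := projT2 (cid (proj_data_exists k v)); exact. Qed.

Lemma reps_proj k v q c i l : reps (lam k v) q c ->
  hnorm (io (q l) (zeta i) - proj k i v) <= c * eps l.
Proof.
move=> hq; apply: (@le_eps R _ _ 2) => j.
rewrite (le_trans (hnorm_dist _ (io ((proj_data k v).1 j) (zeta i)) _))//.
rewrite -(repB hio) (_ : c * eps l + 2 * eps j = (c * eps l + 1 * eps j) + eps j); last by ring.
rewrite lerD ?projP// (le_trans (hnorm_tn _ _))//.
exact: reps_dist hq (proj_dataP k v).
Qed.

(** Uniqueness of the projection: any representing sequence computes it. Linearity and commutation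
    with [N] follow by exhibiting representing sequences for [a *: u + v] and for [io m v]. *)
Lemma reps_lim k v q c i (w : K) (d : R) : reps (lam k v) q c ->
  (forall l, hnorm (io (q l) (zeta i) - w) <= d * eps l) -> proj k i v = w.
Proof.
move=> hq hw; apply/eqP; rewrite -subr_eq0; apply/eqP/hnorm_le0.
apply: (@le_eps R _ _ (c + d)) => l; rewrite add0r.
rewrite (le_trans (hnorm_dist _ (io (q l) (zeta i)) _))// mulrDl lerD//.
by rewrite hnormBC (reps_proj _ _ hq).
Qed.

Lemma proj_linear k i (a : R[i]) u v : proj k i (a *: u + v) = a *: proj k i u + proj k i v.
Proof.
apply: (@reps_lim _ _ _ _ _ _ (normc a + 1) (reps_lin a (proj_dataP k u) (proj_dataP k v))).
move=> l; rewrite (rep_linear hio) opprD addrACA -scalerBr.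
rewrite (le_trans (hnormD _ _))// mulrDl lerD ?mul1r ?projP//.
by rewrite [hnorm _](seminormZ (inner_psd K)) ler_wpM2l ?normc_ge0 ?projP.
Qed.

Lemma proj_comm k i m v : N m -> proj k i (io m v) = io m (proj k i v).
Proof.
move=> Nm; apply: (@reps_lim _ _ _ _ _ _ (cnorm m) (reps_mul Nm (proj_dataP k v))).
move=> l; rewrite (repM hio) -(repBv hio) (le_trans (rep_le hio _ _))//.
by rewrite ler_wpM2l ?cnorm_ge0 ?projP.
Qed.

Lemma proj_le k i v : hnorm (proj k i v) <= hnorm v.
Proof.
apply: (@le_eps R _ _ 2) => l.
rewrite -[proj k i v](subKr (io ((proj_data k v).1 l) (zeta i))).
rewrite (le_trans (hnormB _ _))//.
rewrite (_ : hnorm v + 2 * eps l = (hnorm v + 1 * eps l) + eps l); last by ring.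
rewrite lerD ?projP// (le_trans (hnorm_tn _ _))//.
exact: reps_tn (proj_dataP k v).
Qed.

Lemma bounded_opP (T : K -> K) (c : R) : 0 <= c -> linear T ->
  (forall v, hnorm (T v) <= c * hnorm v) -> bounded_op T.
Proof.
move=> c0 Tlin Tc; split=> // x; apply/cvgrPdist_lt => e e0.
have eE := ge0_ReE (ltW e0).
have Re0 : 0 < Re e by rewrite -ltcR -eE.
have d0 : 0 < Re e / (c + 1) by rewrite divr_gt0// ltr_wpDl.
near=> y.
have TB : T x - T y = T (x - y).
  by have := Tlin (-1) y x; rewrite !scaleN1r ![- _ + _]addrC.
rewrite TB hnormE eE ltcR (le_lt_trans (Tc _))//.
have : hnorm (x - y) < Re e / (c + 1).
  rewrite -ltcR -hnormE; near: y.
  by apply: cvgr_dist_lt; rewrite ?ltcR//; exact: cvg_id.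
rewrite ltr_pdivlMr ?ltr_wpDl// mulrDr mulr1 mulrC; apply: le_lt_trans.
by rewrite lerDl hnorm_ge0.
Unshelve. all: end_near. Qed.

(* hence the projection commutes with x (+) x (+) ..., as in von Neumann's double
   commutant theorem *)
Lemma proj_commutant k i x v : io x (proj k i v) = proj k i (io x v).
Proof.
have [_ /(_ (proj k i))] := bicomm x.
have hP : commutant (io @` N) (proj k i).
  split.
    apply: (@bounded_opP _ 1) => // [a u w|u]; last by rewrite mul1r proj_le.
    exact: proj_linear.
  by move=> _ [m Nm <-]; apply/funext => w /=; rewrite proj_comm.
by move=> /(_ hP) h; have := congr1 (@^~ v) h.
Qed.

(** The bound is uniform in [n]: the comparison passes through a later index [j], whose accumulated
    entrywise error [n * eps j] vanishes as [j] grows. *)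
Lemma proj_sum k v l n : hnsum
  (fun i : 'I_n => io ((proj_data k v).1 l) (zeta i) - proj k i v) <= eps l.
Proof.
apply: (@le_eps R _ _ (1 + n%:R)) => j.
set p := (proj_data k v).1.
have -> : (fun i : 'I_n => io (p l) (zeta i) - proj k i v) =
    evec n (p l - p j) + (fun i : 'I_n => io (p j) (zeta i) - proj k i v).
  by apply/funext => i; rewrite fctE evecB /evec !fctE addrA subrK.
rewrite (le_trans (seminormD (hsum_psd K n) _ _))// mulrDl mul1r addrA lerD//.
  rewrite (le_trans (evec_le _ _))//.
  by have := reps_dist l j (proj_dataP k v) (proj_dataP k v); rewrite !mul1r.
rewrite (le_trans (hnsum_le _))//.
apply: (@le_trans _ _ (\sum_(i < n) eps j)); first by apply: ler_sum => i _; exact: projP.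
by rewrite sumr_const card_ord mulr_natl.
Qed.

(** This is [P x zeta = x zeta] for the projection [P] onto the closure of [N zeta], tested against
    [v] at place [k]. Since [x] commutes with [P], it can be moved to the other side, which leaves
    the same claim for [1 zeta], and [1] lies in [N]. *)
Lemma tform_proj_data k v x : exists C, forall l,
  normc (tform x ((proj_data k v).1 l) - lam k v x) <= C * eps l.
Proof.
pose p := (proj_data k v).1; pose q := (proj_data k (io (star x) v)).1.
exists (tn x + tn 1 + tn 1) => l.
have xP n : hsum (evec n x) (fun i : 'I_n => proj k i v) =
    hsum (evec n 1) (fun i : 'I_n => proj k i (io (star x) v)).
  apply: eq_bigr => i _; rewrite /evec (rep1 hio) (rep_star hio).
  by rewrite proj_commutant.
have d n : normc (hsum (evec n x) (evec n (p l)) - hsum (evec n 1) (evec n (q l))) <=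
    (tn x + tn 1) * eps l.
  rewrite (_ : _ - _ =
    hsum (evec n x) (fun i : 'I_n => io (p l) (zeta i) - proj k i v) -
    hsum (evec n 1) (fun i : 'I_n => io (q l) (zeta i) - proj k i (io (star x) v))); last first.
    have sp z (f g : 'I_n -> K) : hsum (evec n z) (fun i => f i - g i) =
        hsum (evec n z) f - hsum (evec n z) g := psdBr (hsum_psd K n) f g _.
    by rewrite !sp xP opprB addrA subrK.
  rewrite (le_trans (le_normcD _ _))// normcN mulrDl.
  by rewrite lerD// (le_trans (evec_CS _ _))// ler_pM ?hnsum_ge0 ?evec_le ?proj_sum.
have d1 : normc (tform x (p l) - tform 1 (q l)) <= (tn x + tn 1) * eps l.
  by apply: (ulim_dist_le UU _ _ d); exact: evec_cbounded.
have [_ _ /(_ l 1 N1)] := proj_dataP k (io (star x) v); rewrite -/q mul1r.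
have -> : lam k (io (star x) v) 1 = lam k v x by rewrite /lam (rep1 hio) -(rep_star hio).
move=> d2; rewrite (_ : _ - _ = (tform x (p l) - tform 1 (q l)) -
  (lam k v x - tform 1 (q l))); last by ring.
by rewrite (le_trans (le_normcD _ _))// normcN mulrDl lerD// mulrC.
Qed.

(** The sequence [r] represents [n |-> <n zeta, x zeta>] on [N], so [r l zeta] approximates
    [P x zeta]. By [tform_proj_data], each coordinate of [(x - r l) zeta] tends weakly to [0]. The
    sequence is also Cauchy, and splitting [x - r l] as [(x - r j) + (r j - r l)] with [j] tending
    to infinity makes the convergence strong, with error [eps l] for all truncations at once. *)
Lemma tn_dense x (e : R) : 0 < e -> exists2 m, N m &
  forall n, hnsum (evec n (x - m)) <= e.
Proof.
move=> e0.
have [|||r hr] := @reps_exists (fun n => tform n x) (tn x).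
- exact: tn_ge0.
- by move=> c y z; exact: psdl tform_psd _ _ _ _.
- by move=> y; rewrite mulrC; exact: psd_CS tform_psd _ _.
have [_ Nr hr'] := hr.
have rtn l : tn (r l) <= tn x + 1.
  have [->|z0] := eqVneq (tn (r l)) 0; first by rewrite addr_ge0 ?tn_ge0.
  have zp : 0 < tn (r l) by rewrite lt_def z0 tn_ge0.
  rewrite -(ler_pM2r zp) -expr2 mulrDl mul1r.
  have -> : tn (r l) ^+ 2 = Re (tform (r l) (r l)) by rewrite (seminormE tform_psd).
  rewrite (le_trans (le_trans (ler_norm _) (Re_le_normc _)))//.
  rewrite (_ : tform _ _ = tform (r l) x - (tform (r l) x - tform (r l) (r l))); last by ring.
  rewrite (le_trans (le_normcD _ _))// normcN lerD//.
    by rewrite mulrC; exact: psd_CS tform_psd _ _.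
  rewrite (le_trans (hr' l _ (Nr l)))// mul1r -[leRHS]mul1r ler_wpM2r ?tn_ge0//.
  exact: eps_le1.
have weak k v : exists C, forall l, normc (lam k v (x - r l)) <= C * eps l.
  have [C hC] := tform_proj_data k v x; pose p := (proj_data k v).1.
  exists (C + (tn x + 1) + (hnorm v + 1)) => l.
  have [_ Np hp] := proj_dataP k v.
  have h1 := hp l (r l) (Nr l); rewrite -/p in h1.
  have h2 := hr' l (p l) (Np l).
  have h3 := hC l; rewrite -/p in h3.
  have h4 : tn (p l) <= hnorm v + 1.
    apply: le_trans (reps_tn l (proj_dataP k v)) _.
    by rewrite mul1r lerD2l eps_le1.
  have -> : lam k v (x - r l) = - (tform x (p l) - lam k v x) -
      (lam k v (r l) - tform (r l) (p l)) +
      Num.conj (tform (p l) x - tform (p l) (r l)).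
    rewrite rmorphB/= -!(psd_conj tform_psd).
    rewrite /lam (repB hio) (psdBl (inner_psd K)); ring.
  rewrite (le_trans (le_normcD _ _))// normc_conj.
  have el := eps_gt0 R l; have rl := rtn l.
  have a1 : 1 * eps l * tn (r l) <= (tn x + 1) * eps l.
    by rewrite mul1r mulrC ler_wpM2r ?(ltW el).
  have a2 : 1 * eps l * tn (p l) <= (hnorm v + 1) * eps l.
    by rewrite mul1r mulrC ler_wpM2r ?(ltW el).
  rewrite mulrDl lerD ?(le_trans h2)// (le_trans (le_normcD _ _))// !normcN mulrDl.
  by rewrite lerD// (le_trans h1).
have weak_sum n (w : 'I_n -> K) : exists C, forall l,
    normc (hsum (evec n (x - r l)) w) <= C * eps l.
  have /choice[C hC] := fun i : 'I_n => weak i (w i).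
  exists (\sum_i C i) => l; rewrite mulr_suml /hsum.
  rewrite -lecR -normC_real rmorph_sum (le_trans (ler_norm_sum _ _ _))//.
  by apply: ler_sum => i _; rewrite normC_real lecR; exact: hC.
have [l hl] := eps_small e0; exists (r l) => // n.
apply: le_trans (ltW (hl l (leqnn l))).
set w := evec n (x - r l); have [->|w0] := eqVneq (hnsum w) 0; first exact/ltW/eps_gt0.
have wp : 0 < hnsum w by rewrite lt_def w0 hnsum_ge0.
rewrite -(ler_pM2r wp) -expr2.
have [C hC] := weak_sum n w.
apply: (@le_eps R _ _ (C + hnsum w)) => j.
have -> : hnsum w ^+ 2 = Re (hsum (evec n (x - r j)) w + hsum (evec n (r j - r l)) w).
  rewrite -(psdDl (hsum_psd K n)) -[evec n (x - r j) + _]/(_ : 'I_n -> K).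
  rewrite !evecB addrA subrK -evecB -/w.
  by rewrite (seminormE (hsum_psd K n)).
rewrite (le_trans (le_trans (ler_norm _) (Re_le_normc _)))//.
rewrite (le_trans (le_normcD _ _))//.
have := hC j; have := evec_CS (r j - r l) w.
have := evec_le n (r j - r l); have := reps_dist j l hr hr; rewrite !mul1r.
move=> h1 h2 h3 h4.
have h5 : hnsum (evec n (r j - r l)) * hnsum w <= (eps j + eps l) * hnsum w.
  by rewrite ler_wpM2r ?hnsum_ge0// (le_trans h2).
by move: (le_trans h3 h5); lra.
Qed.

End Density.

Section NormalDensity.
Variables (R : realType) (M : cstarAlgType R) (K : hilbertType R).
Variables (io : M -> K -> K) (hio : faithful_rep io).
Variables (N : set M) (hN : star_subalgebra N).
Hypothesis bicomm : forall x, commutant (commutant (io @` N)) (io x).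

Lemma sum_norm_real (u : nat -> K) (C : R) n :
  \sum_(i < n) `|u i| ^+ 2 <= C%:C -> \sum_(i < n) hnorm (u i) ^+ 2 <= C.
Proof.
rewrite -lecR rmorph_sum => /(le_trans _); apply.
by apply: ler_sum => i _; rewrite hnormE rmorphXn.
Qed.

(** Interleaving [xi] and [eta] gives a single square summable sequence [zeta]. For [y = x - m], the
    trace of [y^* y] is the sum of the [<y xi_i, y eta_i>], hence controlled by the square norm of
    [y zeta], which [tn_dense] makes small. *)
Lemma normal_dense (tau : M -> R[i]) x (e : R) : normal_functional io tau -> 0 < e ->
  exists2 m, N m & normc (tau (star (x - m) * (x - m))) <= e.
Proof.
move=> [xi [eta [C [xiC etaC tauE]]]] e0.
pose zeta i := if odd i then eta i./2 else xi i./2.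
have zeven (f : K -> R) n : \sum_(i < n.*2) f (zeta i) =
    \sum_(i < n) f (xi i) + \sum_(i < n) f (eta i).
  elim: n => [|n ih]; first by rewrite !big_ord0 addr0.
  rewrite doubleS !big_ord_recr/= ih /zeta /= odd_double uphalf_double doubleK /=.
  by ring.
have zetaC n : \sum_(i < n) hnorm (zeta i) ^+ 2 <= C + C.
  apply: (@le_trans _ _ (\sum_(i < n.*2) hnorm (zeta i) ^+ 2)).
    rewrite -!(big_mkord xpredT (fun i => hnorm (zeta i) ^+ 2)).
    rewrite [leRHS](big_cat_nat (n := n))//= ?lerDl -?addnn ?leq_addr//.
    by apply: sumr_ge0 => i _; rewrite exprn_ge0 ?hnorm_ge0.
  rewrite (zeven (fun u => hnorm u ^+ 2)) lerD//.
    exact/sum_norm_real/xiC.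
  exact/sum_norm_real/etaC.
(* Any ultrafilter containing the tails will do; it only serves to define [tform]. *)
have [U [UU Uoo]] := @ultraFilterLemma nat \oo _.
have Uge m : U [set n | (m <= n)%N] by apply: Uoo; exists m.
have e2 : 0 < Num.sqrt (e / 2) by rewrite sqrtr_gt0 divr_gt0.
have [m Nm hm] := tn_dense hio hN bicomm zetaC UU Uge x e2.
exists m => //; set y := x - m in hm *.
rewrite -lecR -normC_real; apply/ler_addgt0Pr => d d0.
have [n _ /(_ n (leqnn n)) /= tn] := (cvgrPdist_lt _ _).1 (tauE (star y * y)) _ d0.
set s := \sum_(i < n) _ in tn.
rewrite -[tau _](subrK s) (le_trans (ler_normD _ _))// addrC lerD//; last exact: ltW.
have -> : s = hsum (fun i : 'I_n => io y (xi i)) (fun i : 'I_n => io y (eta i)).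
  by apply: eq_bigr => i _; rewrite (repM hio) (rep_star hio) starK.
rewrite normC_real lecR (le_trans (psd_CS (hsum_psd K n) _ _))//.
set a := seminorm _ _; set b := seminorm _ _.
have : a ^+ 2 + b ^+ 2 <= e / 2.
  rewrite [a ^+ 2]hnsumE [b ^+ 2]hnsumE -(zeven (fun u => hnorm (io y u) ^+ 2)).
  have := hm n.*2; rewrite -(ler_pXn2r (n := 2)) ?nnegrE ?hnsum_ge0 ?(ltW e2)//.
  by rewrite hnsumE sqr_sqrtr// ltW// divr_gt0.
have : 0 <= (a - b) ^+ 2 by exact: sqr_ge0.
by nra.
Qed.

End NormalDensity.

Section FactorDensity.
Variables (R : realType) (M : hyperfinite_II1_factor R).

(** The increasing union of the given subalgebras is again a *-subalgebra, and its bicommutant is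
    [M]. The sequence is also returned as monotone, so that finitely many elements can be
    approximated in a common [N n]. *)
Lemma factor_dense : exists N : nat -> set M,
  [/\ forall n, star_subalgebra (N n) /\ finite_dim (N n),
      forall n k, (n <= k)%N -> N n `<=` N k &
      forall x (e : R), 0 < e -> exists n m, N n m /\
        normc (factor_trace M (star (x - m) * (x - m))) <= e].
Proof.
have [N [hN NS NN]] := factor_hyperfinite M.
have [hio _] := factor_von_neumann M.
have Nmono n k : (n <= k)%N -> N n `<=` N k.
  move=> /subnK <-; elim: (k - n)%N => [//|j ih]; apply: subset_trans ih _.
  exact: NS.
exists N; split=> // x e e0.
pose Nu := \bigcup_n N n.
have hNu : star_subalgebra Nu.
  split; first split.
  - by exists 0%N => //; exact: (opsys1 (subalg_opsys (hN 0%N).1)).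
  - move=> c y z [n _ Ny] [k _ Nz]; exists (maxn n k) => //.
    apply: (opsys_linear (subalg_opsys (hN _).1)).
      exact: Nmono (leq_maxl n k) _ Ny.
    exact: Nmono (leq_maxr n k) _ Nz.
  - move=> y [n _ Ny]; exists n => //.
    exact: (opsys_star (subalg_opsys (hN _).1)).
  - move=> y z [n _ Ny] [k _ Nz]; exists (maxn n k) => //.
    apply: (subalg_mul (hN _).1).
      exact: Nmono (leq_maxl n k) _ Ny.
    exact: Nmono (leq_maxr n k) _ Nz.
have [|m [n _ Nm] hm] := normal_dense hio hNu _ x (factor_normal M) e0.
  by move=> y; rewrite NN; exists y.
by exists n, m.
Qed.

End FactorDensity.

(** * Positive functionals and the 2-norm of a trace *)

Section PositiveFunctional.
Variables (R : realType) (A : cstarAlgType R).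

(** For [l > cnorm x ^+ 2], the element [1 - x^* x / l] is the square of the self-adjoint [1 - 2 y],
    where [y] is the fixed point for [x^* x / (4 l)]. Positivity of [f] at this square gives the
    bound with [l], which then decreases to [cnorm x ^+ 2]. *)
Lemma positive_le (f : A -> R[i]) x :
  (forall c y z, f (c *: y + z) = c * f y + f z) ->
  (forall y, 0 <= f (star y * y)) -> Re (f (star x * x)) <= cnorm x ^+ 2 * Re (f 1).
Proof.
move=> flin fpos.
have f1 : 0 <= Re (f 1).
  by have := Re_ge0 (fpos 1); rewrite star1 mulr1.
have f0 : f 0 = 0.
  have := flin 1 0 0; rewrite scale1r addr0 mul1r.
  by move=> /(congr1 (+%R^~ (- f 0))); rewrite addrK subrr.
have fZ c y : f (c *: y) = c * f y by have := flin c y 0; rewrite addr0 f0 addr0.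
have fB y z : f (y - z) = f y - f z.
  by rewrite addrC -scaleN1r flin mulN1r addrC.
suff h l : cnorm x ^+ 2 < l -> Re (f (star x * x)) <= l * Re (f 1).
  apply/ler_addgt0Pr => d d0.
  have d1 : 0 < d / (Re (f 1) + 1) by rewrite divr_gt0// ltr_wpDl.
  have := h (cnorm x ^+ 2 + d / (Re (f 1) + 1)); rewrite ltrDl => /(_ d1) /le_trans; apply.
  rewrite mulrDl lerD2l mulrAC ler_pdivrMr ?ltr_wpDl// ler_pM2l//.
  by rewrite lerDl.
move=> xl; have l0 : 0 < l := le_lt_trans (sqr_ge0 _) xl.
pose r := cnorm x ^+ 2 / l.
have rr : 0 <= r < 1 by rewrite divr_ge0 ?sqr_ge0 ?(ltW l0)// ltr_pdivrMr// mul1r.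
pose z : A := ((4 * l)^-1)%:C *: (star x * x).
have zr : cnorm z <= r / 4.
  rewrite cnormZ_real normc_real ger0_norm ?invr_ge0 ?mulr_ge0 ?(ltW l0)//.
  rewrite cnorm_star_mul invfM /r le_eqVlt; apply/orP; left; apply/eqP; ring.
have [u [y [[u0 uS] uy yE _]]] := sqrt_fixpoint (cstar_complete_bound A) rr zr.
have zS : star z = z by rewrite starZ conj_real starM starK.
have uSA m : star (u m) = u m.
  by elim: m => [|m ih]; [rewrite u0 star0|rewrite uS starD starM ih zS].
have yS : star y = y.
  apply: (limit_fixed (cstar_complete_bound A) (@starB R A) _ uy uSA).
  by move=> w k; rewrite cnorm_star.
have := Re_ge0 (fpos (1 - y - y)); rewrite !starB star1 yS sqr_1_subDD.
have -> : y - y * y = z by rewrite {1}yE addrK.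
rewrite -scaler_nat fB fZ fZ ReB mulrA.
have -> : 4%:R * ((4 * l)^-1)%:C = (l^-1)%:C :> R[i].
  by rewrite -(rmorph_nat (real_complex R)) -rmorphM; congr (_%:C); field; rewrite gt_eqF.
rewrite ReZ subr_ge0 => h.
by rewrite -ler_pdivrMl.
Qed.

Variables (tau : {scalar A}) (ht : tracial_state tau).

Definition trform (x y : A) : R[i] := tau (star y * x).

Lemma trform_psd : psd_form trform.
Proof.
rewrite /trform; split=> [c x y z|c x y z|x].
- by rewrite mulrDr -scalerAr linearD linearZ.
- by rewrite starD starZ mulrDl -scalerAl linearD linearZ.
- exact: (trace_positive ht).
Qed.

Definition trnorm (x : A) : R := seminorm trform x.

Lemma trnorm_ge0 x : 0 <= trnorm x. Proof. exact: seminorm_ge0. Qed.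

Lemma trnormE x : tau (star x * x) = (trnorm x ^+ 2)%:C.
Proof. exact: (seminormE trform_psd). Qed.

Lemma trnorm_star x : trnorm (star x) = trnorm x.
Proof. by rewrite /trnorm /seminorm /trform starK (trace_comm ht). Qed.

Lemma trnorm_le x : trnorm x <= cnorm x.
Proof.
rewrite -(ler_pXn2r (n := 2)) ?nnegrE ?trnorm_ge0 ?cnorm_ge0//.
have := @positive_le tau x _ (trace_positive ht); rewrite (trace_unital ht) mulr1 trnormE.
by apply=> c y z; rewrite linearD linearZ.
Qed.

Lemma trace_norm2 x y : normc (tau (x * y)) <= trnorm x * trnorm y.
Proof.
by rewrite -(trnorm_star x) mulrC -{1}(starK x); exact: (psd_CS trform_psd).
Qed.

Lemma trnorm_1 : trnorm 1 = 1.
Proof. by rewrite /trnorm /seminorm /trform star1 mulr1 (trace_unital ht) sqrtr1. Qed.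

Lemma trace_norm2_le x : normc (tau x) <= trnorm x.
Proof. by have := trace_norm2 1 x; rewrite mul1r trnorm_1 mul1r. Qed.

Lemma trace_star x : tau (star x) = Num.conj (tau x).
Proof.
have := psd_conj trform_psd x 1; rewrite /trform mulr1 star1 mul1r.
exact.
Qed.

End PositiveFunctional.

(** * Finite-dimensional subalgebras of a tracial C*-algebra *)

Section OrthonormalBasis.
Variables (R : realType) (M : cstarAlgType R).
Variables (tau : {scalar M}) (ht : tracial_state tau).
Hypothesis tau_faithful : forall x, tau (star x * x) = 0 -> x = 0.
Variables (N : set M) (hN : star_subalgebra N) (fN : finite_dim N).

Let Nlin (c : R[i]) x y : N x -> N y -> N (c *: x + y).
Proof. exact: (opsys_linear (subalg_opsys hN)). Qed.
Let N1 : N 1 := opsys1 (subalg_opsys hN).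
Let N0 : N 0.
Proof. by have := Nlin (-1) N1 N1; rewrite scaleN1r addNr. Qed.
Let Nsum I (r : seq I) (c : I -> R[i]) (F : I -> M) :
  (forall i, N (F i)) -> N (\sum_(i <- r) c i *: F i).
Proof. by move=> NF; elim/big_rec: _ => // i x _ Nx; exact: Nlin. Qed.

Definition orthonormal_family d (e : 'I_d -> M) : Prop :=
  (forall i, N (e i)) /\ forall i j, trform tau (e i) (e j) = (i == j)%:R.

(** A family longer than a spanning set of [N] has a nonzero row in the kernel of its coefficient
    matrix; pairing the resulting relation with each [e k] shows that the row vanishes. *)
Lemma orthonormal_bound : exists n, forall d (e : 'I_d -> M),
  orthonormal_family e -> (d <= n)%N.
Proof.
have [n [g hg]] := fN; exists n => d e [Ne oe]; rewrite leqNgt; apply/negP => nd.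
have /choice[c hc] := fun j => hg _ (Ne j).
pose C : 'M[R[i]]_(d, n) := \matrix_(j, i) c j i.
have : kermx C != 0.
  rewrite kermx_eq0 /row_free neq_ltn.
  by rewrite (leq_ltn_trans (rank_leq_col C) nd).
move=> /rowV0Pn[v /sub_kermxP vC /eqP v0]; apply: v0; apply/rowP => k; rewrite mxE.
have s0 : \sum_j v 0 j *: e j = 0.
  under eq_bigr do rewrite hc scaler_sumr.
  rewrite exchange_big big1// => i _.
  under eq_bigr do rewrite scalerA.
  rewrite -scaler_suml; have /rowP/(_ i) := vC; rewrite !mxE.
  by under eq_bigr do rewrite mxE; move=> ->; rewrite scale0r.
have := psd_suml (trform_psd ht) (index_enum 'I_d) xpredT (fun j => v 0 j *: e j) (e k).
rewrite s0 (psd0l (trform_psd ht)) (bigD1 k)//= (psdZl (trform_psd ht)) oe eqxx mulr1.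
by rewrite big1 ?addr0// => j jk; rewrite (psdZl (trform_psd ht)) oe (negPf jk) mulr0.
Qed.

Lemma orthonormal_extend d (e : 'I_d -> M) x : orthonormal_family e -> N x ->
  x != \sum_i trform tau x (e i) *: e i ->
  exists e' : 'I_d.+1 -> M, orthonormal_family e'.
Proof.
move=> [Ne oe] Nx; rewrite -subr_eq0; set s := \sum_i _; set y := x - s => y0.
have hB := trform_psd ht.
have Ny : N y.
  have Ns := Nsum (index_enum 'I_d) (fun i => trform tau x (e i)) Ne.
  by have := Nlin (-1) Ns Nx; rewrite scaleN1r addrC.
have yo k : trform tau y (e k) = 0.
  rewrite /y (psdBl hB) (psd_suml hB) (bigD1 k)//= (psdZl hB) oe eqxx mulr1.
  rewrite big1 ?addr0 ?subrr// => j jk.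
  by rewrite (psdZl hB) oe (negPf jk) mulr0.
have ny : 0 < trnorm tau y.
  rewrite lt_def trnorm_ge0 andbT; apply: contra y0 => /eqP n0; apply/eqP/tau_faithful.
  by rewrite (trnormE ht) n0 expr0n.
pose f : M := ((trnorm tau y)^-1)%:C *: y.
have ff : trform tau f f = 1.
  rewrite (psdZl hB) (psdZr hB) conj_real (seminormE hB) -!rmorphM.
  by rewrite -[seminorm _ _]/(trnorm tau y) (_ : _ * _ = 1)//; field; rewrite gt_eqF.
have fe k : trform tau f (e k) = 0 by rewrite (psdZl hB) yo mulr0.
have ef k : trform tau (e k) f = 0 by rewrite (psd_conj hB f) fe rmorph0.
exists (fun i => if unlift ord_max i is Some j then e j else f); split.
  move=> i; case: unliftP => [j _|_]; first exact: Ne.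
  by have := Nlin ((trnorm tau y)^-1)%:C Ny N0; rewrite addr0.
move=> i j; case: unliftP => [i' ->|->]; case: unliftP => [j' ->|->].
- by rewrite oe (inj_eq (@lift_inj _ _)).
- by rewrite ef eq_sym (negPf (neq_lift _ _)).
- by rewrite fe (negPf (neq_lift _ _)).
- by rewrite ff eqxx.
Qed.

(** A family of maximal length spans [N]: the residue of an element outside the span could be
    normalized, the trace being faithful, and added. *)
Lemma orthonormal_basis : exists d (e : 'I_d -> M), orthonormal_family e /\
  forall x, N x -> x = \sum_i trform tau x (e i) *: e i.
Proof.
pose P d := `[< exists e : 'I_d -> M, orthonormal_family e >].
have P0 : exists d, P d.
  by exists 0%N; apply/asboolP; exists (fun=> 0); split=> -[].
have [n hn] := orthonormal_bound.
have Pn d : P d -> (d <= n)%N by move=> /asboolP[e]; exact: hn.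
case: (ex_maxnP P0 Pn) => d /asboolP[e he] dmax; exists d, e; split=> // x Nx.
apply/eqP; apply: contraT => /(orthonormal_extend he Nx)[e' he'].
by have := dmax d.+1; rewrite ltnn; apply; apply/asboolP; exists e'.
Qed.

End OrthonormalBasis.

Section QuasiBasis.
Variables (R : realType) (M : cstarAlgType R) (K : hilbertType R).
Variables (io : M -> K -> K) (hio : faithful_rep io).
Variables (tau : {scalar M}) (ht : tracial_state tau).
Variables (N : set M) (hN : star_subalgebra N).
Variables (d : nat) (e : 'I_d -> M).
Hypothesis he : orthonormal_family tau N e.
Hypothesis ebasis : forall x, N x -> x = \sum_i trform tau x (e i) *: e i.

Let N1 : N 1 := opsys1 (subalg_opsys hN).
Let Ne i : N (e i). Proof. exact: he.1. Qed.
Let hB := trform_psd ht.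

(* matrix of right multiplication by m in the basis e *)
Definition rmat (m : M) (i j : 'I_d) : R[i] := tau (star (e i) * (e j * m)).

Lemma rmatE m j : N m -> e j * m = \sum_i rmat m i j *: e i.
Proof. by move=> Nm; rewrite {1}[LHS]ebasis//; exact: (subalg_mul hN). Qed.

Lemma rmat1 i j : rmat 1 i j = (i == j)%:R.
Proof. by rewrite /rmat mulr1 eq_sym -he.2. Qed.

Lemma rmat_star m i j : rmat (star m) i j = Num.conj (rmat m j i).
Proof.
by rewrite /rmat -(trace_star ht) !starM starK -[in RHS]mulrA [RHS](trace_comm ht) -mulrA.
Qed.

(** Right multiplications compose in reverse order: [rmat] represents [N^op]. *)
Lemma rmatM m m' i j : N m -> N m' ->
  \sum_k rmat m i k * rmat m' k j = rmat (m' * m) i j.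
Proof.
move=> Nm Nm'; rewrite {3}/rmat mulrA rmatE// mulr_suml mulr_sumr linear_sum.
by apply: eq_bigr => k _; rewrite -scalerAl -scalerAr linearZ mulrC.
Qed.

(* Normalization: sum_j e_j^* (x) e_j induces the functional tau(c _), and N need
   not be a factor, so c need not be a scalar. *)
Definition index_elt : M := \sum_j star (e j) * e j.
Local Notation c := index_elt.

Lemma index_elt_star : star c = c.
Proof.
rewrite /c (big_morph star (@starD R M) (star0 M)).
by apply: eq_bigr => j _; rewrite starM starK.
Qed.

(** The coefficients of [e_j m] in the basis [e_i] and those of [m e_j^*] in the [e_i^*] form
    transposed matrices, so both sides are the same double sum. *)
Lemma index_elt_comm m : N m -> c * m = m * c.
Proof.
move=> Nm; rewrite /c mulr_suml mulr_sumr.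
under eq_bigr do rewrite -mulrA rmatE// mulr_sumr.
have mstar j : m * star (e j) = \sum_i rmat m j i *: star (e i).
  have Nm' : N (star m) := opsys_star (subalg_opsys hN) Nm.
  rewrite -{1}(starK m) -starM rmatE// (big_morph star (@starD R M) (star0 M)).
  by apply: eq_bigr => i _; rewrite starZ rmat_star [X in X *: _](@conjCK).
under [RHS]eq_bigr do rewrite mulrA mstar mulr_suml.
rewrite exchange_big; apply: eq_bigr => i _; apply: eq_bigr => j _.
by rewrite -scalerAr -scalerAl.
Qed.

Lemma index_elt_form v : inner (io c v) v = ((hnsum (fun j => io (e j) v)) ^+ 2)%:C.
Proof.
rewrite -(seminormE (hsum_psd K d)) /c (rep_sum hio) (psd_suml (inner_psd K)).
by apply: eq_bigr => j _; rewrite (repM hio) (rep_star hio) starK.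
Qed.

(** In view of [index_elt_form] this is [c >= 1], which makes [c] invertible. Write
    [1 = sum_j t_j e_j]; Parseval and [tau 1 = 1] give [sum_j |t_j|^2 = 1], and Cauchy-Schwarz
    bounds [<v, v> = sum_j <t_j e_j v, v>]. *)
Lemma index_elt_ge1 v : hnorm v <= hnsum (fun j => io (e j) v).
Proof.
have [->|v0] := eqVneq (hnorm v) 0; first exact: hnsum_ge0.
have vp : 0 < hnorm v by rewrite lt_def v0 hnorm_ge0.
pose t j := trform tau 1 (e j).
have t1 : \sum_j normc (t j) ^+ 2 = 1.
  apply: complexI; rewrite rmorph_sum rmorph1.
  under eq_bigr do rewrite /= -mul_conj_normc.
  have : trform tau 1 1 = 1 by rewrite /trform star1 mulr1 (trace_unital ht).
  rewrite [trform tau 1 1](congr1 (fun x => trform tau x 1) (ebasis N1)) (psd_suml hB) => <-.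
  by apply: eq_bigr => j _; rewrite (psdZl hB) /t -(psd_conj hB).
have w1 : hnsum (fun j => Num.conj (t j) *: v) = hnorm v.
  apply/eqP; rewrite -(eqrXn2 (n := 2)) ?hnsum_ge0 ?hnorm_ge0// hnsumE.
  under eq_bigr do rewrite [hnorm _](seminormZ (inner_psd K)) normc_conj exprMn.
  by rewrite -mulr_suml t1 mul1r.
rewrite -(ler_pM2r vp) -expr2 -{2}w1.
have -> : hnorm v ^+ 2 = Re (hsum (fun j => io (e j) v) (fun j => Num.conj (t j) *: v)).
  transitivity (Re (inner v v)); first by rewrite (seminormE (inner_psd K)).
  rewrite -{1}(rep1 hio v) (congr1 (fun x => inner (io x v) v) (ebasis N1)).
  rewrite (rep_sum hio) (psd_suml (inner_psd K)).
  congr Re; apply: eq_bigr => j _.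
  by rewrite (repZ hio) (psdZl (inner_psd K)) (psdZr (inner_psd K)) [X in _ = X * _](@conjCK).
rewrite (le_trans (le_trans (ler_norm _) (Re_le_normc _)))//.
exact: psd_CS (hsum_psd K d) _ _.
Qed.

Lemma pos_cnorm (x : M) (k : R) : star x = x -> 0 <= k ->
  (forall v, 0 <= Re (inner (io x v) v) <= k * hnorm v ^+ 2) -> cnorm x <= k.
Proof.
move=> xS k0 xk; pose X : 'M[M]_1 := x%:M.
have -> : x = X 0 0 by rewrite mxE eqxx.
apply: (mxbd_entry hio); apply: (mx_pos_bd hio) => //.
  by apply/matrixP => i j; rewrite !mxE !ord1 eqxx xS.
move=> u; rewrite hnsumE /hsum /mxact !big_ord1 mxE eqxx.
exact: xk.
Qed.

(** The inverse square root of [c]. Since [1 <= c <= l], the element [T = 1 - c / l] lies between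
    [0] and [r = 1 - 1 / l]; the fixed point for [T / 4] gives [w = 1 - 2 y] with [w^2 = c / l]. A
    Neumann series inverts [w], and [z = w^-1 / sqrt l]. Every iterate is a polynomial in [c],
    whence [z] is self-adjoint and commutes with [N]. *)
Lemma index_elt_rsqrt : exists z, [/\ star z = z,
  forall m, N m -> z * m = m * z & z * c * z = 1].
Proof.
pose l := cnorm c + 1; have l0 : 0 < l by rewrite ltr_wpDl ?cnorm_ge0.
pose T : M := 1 - (l^-1)%:C *: c; pose r := 1 - l^-1.
have li : 0 < l^-1 by rewrite invr_gt0.
have rr : 0 <= r < 1.
  by rewrite subr_ge0 gtrBl li andbT invf_le1// lerDr cnorm_ge0.
have [r0 r1] := andP rr.
have TS : star T = T by rewrite starB star1 starZ conj_real index_elt_star.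
have Tr : cnorm T <= r.
  apply: pos_cnorm => // v.
  have h1 := index_elt_ge1 v; have := index_elt_form v.
  set q := hnsum _ => cE.
  have -> : Re (inner (io T v) v) = hnorm v ^+ 2 - l^-1 * q ^+ 2.
    rewrite (repB hio) (psdBl (inner_psd K)) ReB (rep1 hio) (repZ hio).
    by rewrite (psdZl (inner_psd K)) ReZ cE (seminormE (inner_psd K)).
  have h2 : hnorm v ^+ 2 <= q ^+ 2.
    by rewrite ler_pXn2r ?nnegrE ?hnorm_ge0 ?hnsum_ge0.
  have h3 : q ^+ 2 <= l * hnorm v ^+ 2.
    have -> : q ^+ 2 = Re (inner (io c v) v) by rewrite cE.
    rewrite (le_trans (le_trans (ler_norm _) (Re_le_normc _)))//.
    rewrite (le_trans (psd_CS (inner_psd K) _ _))// expr2 mulrA ler_wpM2r ?hnorm_ge0//.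
    by rewrite (le_trans (rep_le hio _ _))// ler_wpM2r ?hnorm_ge0// /l lerDl.
  rewrite subr_ge0 ler_pdivrMl// h3/= /r mulrBl mul1r lerB// ler_wpM2l// ltW//.
have hM := cstar_complete_bound M.
have Zr : cnorm ((4^-1)%:C *: T) <= r / 4.
  by rewrite cnormZ_real normc_real ger0_norm ?invr_ge0// mulrC ler_wpM2r ?invr_ge0.
have [u [y [[u0 uS] uy yE yl]]] := sqrt_fixpoint hM rr Zr.
have uSA k : star (u k) = u k.
  by elim: k => [|k ih]; [rewrite u0 star0|rewrite uS starD starM ih starZ conj_real TS].
have starbd (x : M) (k : R) : cnorm x <= k -> cnorm (star x) <= k by rewrite cnorm_star.
have yS : star y = y := limit_fixed hM (@starB R M) starbd uy uSA.
(* The norm of [y] is known to be below every number above [r / 2]; the midpoint of [r] and [1]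
   leaves room and is still less than [1]. *)
have y2 : cnorm (y + y) <= (r + 1) / 2.
  have h : r / 2 < (r + 1) / 4 by lra.
  by rewrite (le_trans (cnorm_triangle _ _))//; have := yl _ h; lra.
have r2 : 0 <= (r + 1) / 2 < 1 by apply/andP; split; lra.
have [u' [v [[u'0 u'S] u'v vE]]] := neumann hM r2 y2.
have [Y YE] : exists Y, Y = y + y by exists (y + y).
rewrite -YE in u'S vE.
have YS : star Y = Y by rewrite YE starD yS.
have u'comm w : Y * w = w * Y -> v * w = w * v.
  move=> yw; apply: (limit_comm hM u'v (cnorm_ge0 w) (lexx _)).
  elim=> [|k ih]; first by rewrite u'0 mul1r mulr1.
  by rewrite u'S mulrDl mulrDr mul1r mulr1 -mulrA ih mulrA yw mulrA.
have u'SA k : star (u' k) = u' k.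
  elim: k => [|k ih]; first by rewrite u'0 star1.
  rewrite u'S starD star1 starM ih YS; congr (1 + _).
  elim: k {ih} => [|k ih]; first by rewrite u'0 mul1r mulr1.
  by rewrite u'S mulrDl mulrDr mul1r mulr1 -mulrA ih.
have vS : star v = v := limit_fixed hM (@starB R M) starbd u'v u'SA.
pose w := 1 - y - y.
have wE : w = 1 - Y by rewrite /w YE opprD addrA.
have vw : v * w = 1 by rewrite -vE -wE; apply: u'comm; rewrite wE mulrBr mulrBl mulr1 mul1r.
have ww : w * w = (l^-1)%:C *: c.
  rewrite /w sqr_1_subDD.
  have -> : y - y * y = (4^-1)%:C *: T by rewrite {1}yE addrK.
  rewrite -scaler_nat scalerA.
  have -> : 4%:R * (4^-1)%:C = 1 :> R[i].
    by rewrite fmorphV/= (rmorph_nat (real_complex R)) divff// pnatr_eq0.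
  by rewrite scale1r /T opprB addrC subrK.
pose a := Num.sqrt l^-1.
exists (a%:C *: v); split.
- by rewrite starZ conj_real vS.
- move=> m Nm; rewrite -scalerAl -scalerAr; congr (_ *: _); apply: u'comm.
  have ym : y * m = m * y.
    apply: (limit_comm hM uy (cnorm_ge0 m) (lexx _)).
    elim=> [|k ih]; first by rewrite u0 mul0r mulr0.
    rewrite uS mulrDl mulrDr -mulrA ih mulrA ih -mulrA; congr (_ + _).
    by rewrite -scalerAl -scalerAr /T mulrBl mulrBr mul1r mulr1 -scalerAl -scalerAr index_elt_comm.
  by rewrite YE mulrDl mulrDr ym.
- rewrite -!scalerAl -scalerAr scalerA -rmorphM -expr2 sqr_sqrtr ?(ltW li)//.
  rewrite scalerAl scalerAr -ww mulrA vw mul1r.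
  by rewrite wE.
Qed.

End QuasiBasis.

(** * Extension of the functional of a UCP map *)

Section Hyperstate.
Variables (R : realType) (A : cstarAlgType R) (H : hilbertType R).
Variables (sg : A -> H -> H) (hs : faithful_rep sg).
Variables (M : cstarAlgType R) (tau : {scalar M}) (ht : tracial_state tau).
Variables (N : set M) (hN : star_subalgebra N).
Variables (d : nat) (e : 'I_d -> M).
Hypothesis he : orthonormal_family tau N e.
Hypothesis ebasis : forall x, N x -> x = \sum_i trform tau x (e i) *: e i.
Variable z : M.
Hypotheses (zS : star z = z) (zN : forall m, N m -> z * m = m * z).
Hypothesis zcz : z * index_elt e * z = 1.
Variables (S : set A) (hS : operator_subsystem S) (phi : A -> M).
Hypothesis hphi : ucp_on S phi.

Let N1 : N 1 := opsys1 (subalg_opsys hN).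
Let Slin (c : R[i]) x y : S x -> S y -> S (c *: x + y).
Proof. exact: (opsys_linear hS). Qed.
Let S1 : S 1 := opsys1 hS.
Let S0 : S 0.
Proof. by have := Slin (-1) S1 S1; rewrite scaleN1r addNr. Qed.
Let SZ (c : R[i]) x : S x -> S (c *: x).
Proof. by move=> Sx; have := Slin c Sx S0; rewrite addr0. Qed.
Let SD x y : S x -> S y -> S (x + y).
Proof. by move=> Sx Sy; have := Slin 1 Sx Sy; rewrite scale1r. Qed.
Let Sstar x : S x -> S (star x). Proof. exact: (opsys_star hS). Qed.

Let phi0 : phi 0 = 0.
Proof. by have := ucp_linear hphi (-1) S1 S1; rewrite !scaleN1r !addNr. Qed.
Let phiZ (c : R[i]) x : S x -> phi (c *: x) = c *: phi x.
Proof. by move=> Sx; have := ucp_linear hphi c Sx S0; rewrite !addr0 phi0 addr0. Qed.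

Let v (j : 'I_d) : M := z * star (e j).

(** The vector functional of [phi (x) id] on matrices, at the vector with entries [v_j = z e_j^*] in
    the GNS space of [tau]. *)
Definition choi (X : 'M[A]_d) : R[i] :=
  \sum_i \sum_j tau (star (v i) * phi (X i j) * v j).

Definition in_mx (X : 'M[A]_d) : Prop := forall i j, S (X i j).

Lemma choi_lin (c : R[i]) X Y : in_mx X -> in_mx Y ->
  choi (mxscal c X + Y) = c * choi X + choi Y.
Proof.
move=> SX SY; rewrite /choi mulr_sumr -big_split; apply: eq_bigr => i _ /=.
rewrite mulr_sumr -big_split; apply: eq_bigr => j _ /=.
rewrite !mxE (ucp_linear hphi)// mulrDr mulrDl -scalerAr -scalerAl.
by rewrite linearD linearZ.
Qed.

(** If [phi] sends [X] to [Y^* Y], the value is the sum of the [tau (star w_k * w_k)] for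
    [w = Y v]. *)
Lemma choi_pos X : in_mx X -> mx_positive X -> 0 <= choi X.
Proof.
move=> SX /(ucp_cp hphi SX)[Y XY].
have XE i j : phi (X i j) = \sum_k star (Y k i) * Y k j.
  have /matrixP/(_ i j) := XY; rewrite !mxE => ->.
  by apply: eq_bigr => k _; rewrite !mxE.
pose w k := \sum_i Y k i * v i.
have -> : choi X = \sum_k tau (star (w k) * w k); last first.
  by apply: sumr_ge0 => k _; exact: (trace_positive ht).
rewrite /choi.
under [RHS]eq_bigr => k _.
  rewrite /w (big_morph star (@starD R M) (star0 M)) mulr_suml linear_sum /=.
  under eq_bigr => i _.
    rewrite mulr_sumr linear_sum /=.
    under eq_bigr do rewrite starM.
    over.
  over.
rewrite [RHS]exchange_big; apply: eq_bigr => i _ /=.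
rewrite [RHS]exchange_big; apply: eq_bigr => j _ /=.
rewrite XE mulr_sumr mulr_suml linear_sum; apply: eq_bigr => k _ /=.
by rewrite !mulrA.
Qed.

(* the elementary tensor x (x) m, with m acting by right multiplication *)
Definition tens (x : A) (m : M) : 'M[A]_d := \matrix_(i, j) (rmat tau e m i j *: x).

Lemma tens_in x m : S x -> in_mx (tens x m).
Proof. by move=> Sx i j; rewrite mxE; exact: SZ. Qed.

(** Summing over [i] turns the coefficients into [e_j m]; summing over [j] and rotating the trace
    collects the index element. As [z] commutes with [m], both copies of [z] move next to it and
    cancel it by [zcz]. *)
Lemma choi_tens x m : S x -> N m -> choi (tens x m) = tau (m * phi x).
Proof.
move=> Sx Nm; rewrite /choi.
under eq_bigr do under eq_bigr do rewrite mxE phiZ//.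
rewrite exchange_big /=.
transitivity (\sum_j tau (e j * m * z * phi x * z * star (e j))).
  apply: eq_bigr => j _; rewrite (rmatE hN he ebasis)// !mulr_suml linear_sum.
  apply: eq_bigr => i _; rewrite /v starM starK zS.
  by rewrite -!scalerAl -scalerAr -scalerAl !mulrA.
transitivity (tau (m * z * phi x * z * index_elt e)).
  rewrite mulr_sumr linear_sum; apply: eq_bigr => j _ /=.
  by rewrite -!mulrA (trace_comm ht) !mulrA.
rewrite -(zN Nm) -!mulrA (trace_comm ht) -!mulrA.
by rewrite (mulrA z (index_elt e)) zcz mulr1.
Qed.

Lemma tensM x y m m' : N m -> N m' -> tens x m *m tens y m' = tens (x * y) (m' * m).
Proof.
move=> Nm Nm'; apply/matrixP => i j; rewrite !mxE -(rmatM hN he ebasis)// scaler_suml.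
by apply: eq_bigr => k _; rewrite !mxE -scalerAl -scalerAr scalerA.
Qed.

Lemma tens_star x m : mxstar (tens x m) = tens (star x) (star m).
Proof. by apply/matrixP => i j; rewrite !mxE starZ (rmat_star ht). Qed.

Lemma tens11 : tens 1 1 = 1%:M.
Proof.
apply/matrixP => i j; rewrite !mxE (rmat1 he).
by case: eqP; rewrite ?scale1r ?scale0r.
Qed.

Lemma mxact_tens1 x u i : mxact sg (tens x 1) u i = sg x (u i).
Proof.
rewrite /mxact (bigD1 i)//= mxE (rmat1 he) eqxx scale1r big1 ?addr0// => j.
by rewrite mxE (rmat1 he) eq_sym => /negPf ->; rewrite scale0r (rep0 hs).
Qed.

Let W := 'I_d -> H.

Definition bdop : set (W -> W) :=
  [set X | exists2 k : R, 0 <= k & forall u, hnsum (X u) <= k * hnsum u].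
(* Skew operators are accretive together with their opposites, so functionals
   positive on this wedge see only real parts; this avoids adjoints on B(H). *)
Definition accretive : set (W -> W) := [set X | forall u, 0 <= Re (hsum (X u) u)].

Lemma bdopD (X Y : W -> W) : bdop X -> bdop Y -> bdop (X + Y).
Proof.
move=> [k k0 hk] [l l0 hl]; exists (k + l); first exact: addr_ge0.
move=> u; rewrite (le_trans (seminormD (hsum_psd H d) _ _))// mulrDl.
by apply: lerD; [exact: hk|exact: hl].
Qed.

Lemma bdopZ (c : R[i]) (X : W -> W) : bdop X -> bdop (c *: X).
Proof.
move=> [k k0 hk]; exists (normc c * k); first by rewrite mulr_ge0 ?normc_ge0.
move=> u; rewrite [hnsum _](seminormZ (hsum_psd H d)) -mulrA ler_wpM2l ?normc_ge0//.
exact: hk.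
Qed.

Lemma bdop_comp (X Y : W -> W) : bdop X -> bdop Y -> bdop (X \o Y).
Proof.
move=> [k k0 hk] [l l0 hl]; exists (k * l); first exact: mulr_ge0.
by move=> u /=; rewrite (le_trans (hk _))// -mulrA ler_wpM2l.
Qed.

Lemma bdop_mxact (X : 'M[A]_d) : bdop (mxact sg X).
Proof. by have [k0 hk] := mxbd_sum hs X; exists (\sum_i \sum_j cnorm (X i j)). Qed.

Lemma bdop_id : bdop id.
Proof. by exists 1 => // u; rewrite mul1r. Qed.

Lemma sqr_hnsum (u : W) : hsum u u = (hnsum u ^+ 2)%:C.
Proof. exact: (seminormE (hsum_psd H d) u). Qed.

(** The prescribed value is the real part of [choi] at the Hermitian part of [X]. If [X] acts
    accretively, [X + mxstar X] is a positive operator, and any shift of it by [t > 0] has the form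
    [Y^* Y]; complete positivity and [t -> 0] give the positivity that the extension theorem
    requires, with [id] as order unit. *)
Lemma choi_extension : exists F : (W -> W) -> R,
  [/\ forall X Y, bdop X -> bdop Y -> F (X + Y) = F X + F Y,
      forall (r : R) X, bdop X -> F (r%:C *: X) = r * F X,
      forall X, bdop X -> accretive X -> 0 <= F X &
      forall X : 'M[A]_d, in_mx X ->
        F (mxact sg X) = Re (choi X + choi (mxstar X)) / 2].
Proof.
pose G : set ((W -> W) * R) := [set p | exists2 X : 'M[A]_d, in_mx X &
  p = (mxact sg X, Re (choi X + choi (mxstar X)) / 2)].
have in_star X : in_mx X -> in_mx (mxstar X).
  by move=> SX i j; rewrite mxstarE; exact: Sstar.
have in_D X Y : in_mx X -> in_mx Y -> in_mx (X + Y).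
  by move=> SX SY i j; rewrite mxE; exact: SD.
have in_Z (c : R[i]) X : in_mx X -> in_mx (mxscal c X).
  by move=> SX i j; rewrite mxE; exact: SZ.
have choiD X Y : in_mx X -> in_mx Y -> choi (X + Y) = choi X + choi Y.
  by move=> SX SY; have := choi_lin 1 SX SY; rewrite mxscal1 mul1r.
have in_0 : in_mx 0 by move=> i j; rewrite mxE.
have choi0 : choi 0 = 0.
  by apply: (addrI (choi 0)); rewrite -choiD// !addr0.
have choiZ (c : R[i]) X : in_mx X -> choi (mxscal c X) = c * choi X.
  by move=> SX; have := choi_lin c SX in_0; rewrite choi0 !addr0.
have choi1 : choi 1%:M = 1.
  by rewrite -tens11 choi_tens// mul1r (ucp_unital hphi) (trace_unital ht).
have in_1 : in_mx 1%:M by rewrite -tens11; exact: tens_in.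
have Gid : G (id, 1).
  exists 1%:M => //; rewrite mxstar1 choi1; congr pair.
    by apply/funext => u; rewrite (mxact1 hs).
  by rewrite ReD /=; field.
have hG : real_graph bdop accretive G.
  split.
  - by move=> _ [X SX ->] /=; exact: bdop_mxact.
  - move=> _ _ [X SX ->] [Y SY ->] /=; exists (X + Y); first exact: in_D.
    rewrite mxstarD !choiD//; do ?exact: in_star.
    congr pair; first by apply/funext => u; rewrite (mxactD hs).
    by rewrite !ReD; ring.
  - move=> r _ [X SX ->] /=; exists (mxscal r%:C X); first exact: in_Z.
    rewrite mxstarZ conj_real !choiZ//; do ?exact: in_star.
    congr pair; first by apply/funext => u; rewrite (mxactZ hs).
    by rewrite -mulrDr ReZ mulrA.
  - move=> _ [X SX ->] /= Xacc; rewrite divr_ge0//.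
    rewrite -choiD//; last exact: in_star.
    set Q := X + mxstar X; have QS : mxstar Q = Q by rewrite mxstarD mxstarK addrC.
    have SQ : in_mx Q by apply: in_D => //; exact: in_star.
    have Qpos u : 0 <= Re (hsum (mxact sg Q u) u).
      rewrite (mxactD hs) (psdDl (hsum_psd H d)) ReD addr_ge0//.
      rewrite (mxact_star hs) mxstarK (psd_conj (hsum_psd H d)) Re_conj.
      exact: (Xacc u).
    apply/ler_addgt0Pr => t t0.
    have SQt : in_mx (Q + mxscal t%:C 1%:M) by apply: in_D => //; exact: in_Z.
    have := Re_ge0 (choi_pos SQt (mx_positive_shift hs QS t0 Qpos)).
    by rewrite choiD ?choiZ// ?choi1 ?mulr1 ?ReD//; exact: in_Z.
have [||||||F [FD FZ Fpos FG]] :=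
  @riesz_extension R (W -> W) bdop accretive id G _ _ _ _ _ _ Gid hG.
- exact: bdopD.
- by move=> r X; exact: bdopZ.
- move=> X Y Xa Ya u; rewrite (psdDl (hsum_psd H d)) ReD addr_ge0//.
- move=> r X r0 Xa u; rewrite (psdZl (hsum_psd H d)) ReZ mulr_ge0//.
- by move=> u; rewrite (psd0l (hsum_psd H d)).
- move=> X [k k0 hk]; exists k => u.
  have -> : (k%:C *: (id : W -> W) - X) u = k%:C *: u - X u by [].
  rewrite (psdBl (hsum_psd H d)) ReB (psdZl (hsum_psd H d)) ReZ sqr_hnsum /=.
  rewrite subr_ge0 (le_trans (le_trans (ler_norm _) (Re_le_normc _)))//.
  rewrite (le_trans (psd_CS (hsum_psd H d) _ _))// expr2 mulrA.
  by rewrite ler_wpM2r ?hnsum_ge0//; exact: hk.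
exists F; split=> // X SX; apply: (FG (_, _)).
by exists X.
Qed.

Definition hbd (T : H -> H) : Prop :=
  exists2 t : R, 0 <= t & forall x, hnorm (T x) <= t * hnorm x.

(** The operator [T (x) 1]. *)
Definition diag (T : H -> H) : W -> W := fun u i => T (u i).

Lemma diag_le T (t : R) : 0 <= t -> (forall x, hnorm (T x) <= t * hnorm x) ->
  forall u, hnsum (diag T u) <= t * hnsum u.
Proof.
move=> t0 Tt u; rewrite -(ler_pXn2r (n := 2)) ?nnegrE ?mulr_ge0 ?hnsum_ge0//.
rewrite exprMn !hnsumE mulr_sumr ler_sum// => i _; rewrite -exprMn.
by rewrite ler_pXn2r ?nnegrE ?mulr_ge0 ?hnorm_ge0// Tt.
Qed.

Lemma diag_bdop T : hbd T -> bdop (diag T).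
Proof. by move=> [t t0 Tt]; exists t => //; exact: diag_le. Qed.

(** A Cauchy-Schwarz inequality without adjoints. With [k = t / (2 dl)] and [c = 1] or [-1], the
    operator [k Q + (t dl / 2) id + c X] is accretive, because [k s^2 + (t dl / 2) n^2 - t s n = k
    (s - dl n)^2] for [n = hnsum u]. Positivity of [F] then gives
    [|F X| <= k dl^2 + t dl / 2 = t dl]. *)
Lemma sqrt_dominated (F : (W -> W) -> R) (X Q : W -> W) (s : W -> R) (t dl : R) :
  (forall X Y, bdop X -> bdop Y -> F (X + Y) = F X + F Y) ->
  (forall (r : R) X, bdop X -> F (r%:C *: X) = r * F X) ->
  (forall X, bdop X -> accretive X -> 0 <= F X) -> F id = 1 ->
  bdop X -> bdop Q -> 0 <= t -> 0 < dl -> F Q <= dl ^+ 2 ->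
  (forall u, Re (hsum (Q u) u) = s u ^+ 2) ->
  (forall u, `|Re (hsum (X u) u)| <= t * s u * hnsum u) ->
  `|F X| <= t * dl.
Proof.
move=> FD FZ Fpos F1 bX bQ t0 dl0 FQ Qs Xs.
have hp (c : R) : `|c| <= 1 -> - (c * F X) <= t * dl.
  move=> c1; set k := t / (2 * dl).
  have k0 : 0 <= k by rewrite divr_ge0// mulr_ge0// ltW.
  have bk := bdopZ k%:C bQ; have bi := bdopZ (t * dl / 2)%:C bdop_id.
  have bc := bdopZ c%:C bX.
  have := Fpos _ (bdopD (bdopD bk bi) bc).
  rewrite (FD _ _ (bdopD bk bi) bc) (FD _ _ bk bi) !FZ//; last exact: bdop_id.
  rewrite F1 mulr1 => h.
  have : 0 <= k * F Q + t * dl / 2 + c * F X.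
    apply: h => u.
    have -> : (k%:C *: Q + (t * dl / 2)%:C *: (id : W -> W) + c%:C *: X) u =
      k%:C *: Q u + (t * dl / 2)%:C *: u + c%:C *: X u by [].
    rewrite !(psdDl (hsum_psd H d)) !ReD !(psdZl (hsum_psd H d)) !ReZ sqr_hnsum Qs /=.
    have := Xs u; set x := Re _; set n := hnsum u; set q := s u => xq.
    have cx : `|c * x| <= t * q * n.
      by rewrite normrM (le_trans _ xq)// -[leRHS]mul1r ler_wpM2r.
    have sq : 0 <= k * (q - dl * n) ^+ 2 by rewrite mulr_ge0// sqr_ge0.
    have e1 : k * (q - dl * n) ^+ 2 = k * q ^+ 2 + t * dl / 2 * n ^+ 2 - t * q * n.
      by rewrite /k; field; rewrite gt_eqF.
    have := ler_norm (- (c * x)); rewrite normrN.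
    by rewrite e1 in sq; move: cx sq; lra.
  have : k * F Q <= t * dl / 2.
    have -> : t * dl / 2 = k * dl ^+ 2 by rewrite /k; field; rewrite gt_eqF.
    by rewrite ler_wpM2l.
  by lra.
have := hp 1; have := hp (-1); rewrite normrN normr1 lexx => /(_ isT) h1 /(_ isT) h2.
by rewrite ler_norml; apply/andP; split; lra.
Qed.

(** With [D = a (x) 1 - 1 (x) m], the two hypotheses on [dl] say that the extended functional is at
    most [dl ^+ 2] at [D^* D] and at [D D^*], expanded by [choi_tens]; since [N] acts as [N^op],
    [D^* D] contains [m * star m]. The products [(T (x) 1) D] and [D (T (x) 1)] contribute [t * dl]
    each. *)
Theorem hyperstate : exists f : (H -> H) -> R,
  [/\ [/\ forall T T', hbd T -> hbd T' -> f (T + T') = f T + f T',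
        forall (r : R) T, hbd T -> f (r%:C *: T) = r * f T,
        forall T, hbd T -> (forall x, 0 <= Re (inner (T x) x)) -> 0 <= f T &
        f id = 1],
      forall a, S a -> f (sg a) = Re (tau (phi a) + tau (phi (star a))) / 2 &
      forall a m (dl t : R) (T : H -> H),
        S a -> S (star a * a) -> S (a * star a) -> N m -> 0 < dl ->
        Re (tau (phi (star a * a)) - tau (m * phi (star a)) -
            tau (star m * phi a) + tau (m * star m)) <= dl ^+ 2 ->
        Re (tau (phi (a * star a)) - tau (star m * phi a) -
            tau (m * phi (star a)) + tau (star m * m)) <= dl ^+ 2 ->
        linear T -> 0 <= t -> (forall x, hnorm (T x) <= t * hnorm x) ->
        `|f (sg a \o T) - f (T \o sg a)| <= 2 * t * dl].
Proof.
have [F [FD FZ Fpos Fchoi]] := choi_extension.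
have diagD T T' : diag (T + T') = diag T + diag T' by [].
have Fid : F id = 1.
  have -> : (id : W -> W) = mxact sg (tens 1 1).
    by rewrite tens11; apply/funext => u; rewrite (mxact1 hs).
  rewrite Fchoi; last exact: tens_in.
  rewrite tens_star !star1 choi_tens// mul1r (ucp_unital hphi) (trace_unital ht) ReD/=.
  by field.
have Nstar m : N m -> N (star m) by exact: (opsys_star (subalg_opsys hN)).
exists (fun T => F (diag T)); split; first split.
- by move=> T T' bT bT'; rewrite diagD FD//; exact: diag_bdop.
- by move=> r T bT; rewrite -FZ//; exact: diag_bdop.
- move=> T bT Tpos; apply: Fpos; first exact: diag_bdop.
  by move=> u; rewrite /hsum Re_sum; apply: sumr_ge0 => i _; exact: Tpos.
- exact: Fid.
- move=> a Sa.
  have -> : diag (sg a) = mxact sg (tens a 1).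
    by apply/funext => u; apply/funext => i; rewrite mxact_tens1.
  rewrite Fchoi; last exact: tens_in.
  by rewrite tens_star star1 !choi_tens ?mul1r//; exact: Sstar.
- move=> a m dl t T Sa Saa Saa' Nm dl0 k1 k2 Tlin t0 Tt.
  have Nm' := Nstar _ Nm; have Sa' := Sstar Sa.
  pose D := tens a 1 - tens 1 m.
  have DS : mxstar D = tens (star a) 1 - tens 1 (star m).
    by rewrite mxstarB !tens_star !star1.
  have FQ (Q : 'M[A]_d) : in_mx Q -> mxstar Q = Q -> F (mxact sg Q) = Re (choi Q).
    by move=> SQ QS; rewrite Fchoi// QS ReD; field.
  have tot x y m1 m2 m3 : S x -> S y -> N m1 -> N m2 -> N m3 ->
      in_mx (tens x 1 - tens y m1 - tens (star y) m2 + tens 1 m3) /\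
      choi (tens x 1 - tens y m1 - tens (star y) m2 + tens 1 m3) =
      tau (phi x) - tau (m1 * phi y) - tau (m2 * phi (star y)) + tau m3.
    move=> Sx Sy N1' N2' N3'.
    have Sy' := Sstar Sy.
    have inD X Y : in_mx X -> in_mx Y -> in_mx (X + Y).
      by move=> SX SY i j; rewrite mxE; exact: SD.
    have NE (X : 'M[A]_d) : - X = mxscal (-1) X.
      by apply/matrixP => i j; rewrite !mxE scaleN1r.
    have inN X : in_mx X -> in_mx (- X).
      by move=> SX i j; rewrite NE mxE; exact: SZ.
    have cD X Y : in_mx X -> in_mx Y -> choi (X + Y) = choi X + choi Y.
      by move=> SX SY; have := choi_lin 1 SX SY; rewrite mxscal1 mul1r.
    have cB X Y : in_mx X -> in_mx Y -> choi (X - Y) = choi X - choi Y.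
      by move=> SX SY; have := choi_lin (-1) SY SX; rewrite -NE mulN1r addrC [RHS]addrC.
    have i1 := tens_in 1 Sx; have i2 := tens_in m1 Sy; have i3 := tens_in m2 Sy'.
    have i4 := tens_in m3 S1; have i12 := inD _ _ i1 (inN _ i2).
    have i123 := inD _ _ i12 (inN _ i3).
    split; first exact: inD.
    by rewrite cD// cB// cB// !choi_tens// mul1r (ucp_unital hphi) mulr1.
  have Q1 : mxstar D *m D =
      tens (star a * a) 1 - tens (star a) m - tens (star (star a)) (star m) + tens 1 (m * star m).
    rewrite DS /D mulmxBl !mulmxBr !tensM// !mulr1 !mul1r starK.
    by rewrite opprB addrA addrAC.
  have Q2 : D *m mxstar D =
      tens (a * star a) 1 - tens a (star m) - tens (star a) m + tens 1 (star m * m).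
    rewrite DS /D mulmxBl !mulmxBr !tensM// !mulr1 !mul1r.
    by rewrite opprB addrA addrAC.
  have Q1S : mxstar (mxstar D *m D) = mxstar D *m D by rewrite mxstarM mxstarK.
  have Q2S : mxstar (D *m mxstar D) = D *m mxstar D by rewrite mxstarM mxstarK.
  have [iQ1 cQ1] := tot (star a * a) (star a) m (star m) (m * star m) Saa Sa' Nm Nm'
    (subalg_mul hN Nm Nm').
  have [iQ2 cQ2] := tot (a * star a) a (star m) m (star m * m) Saa' Sa Nm' Nm
    (subalg_mul hN Nm' Nm).
  rewrite -Q1 in iQ1 cQ1; rewrite -Q2 in iQ2 cQ2.
  have bT : bdop (diag T) by apply: diag_bdop; exists t.
  have bD := bdop_mxact D.
  have b1 := bdop_comp bT bD; have b2 := bdop_comp bD bT.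
  have F1 : `|F (diag T \o mxact sg D)| <= t * dl.
    apply: (@sqrt_dominated F _ (mxact sg (mxstar D *m D)) (fun u => hnsum (mxact sg D u))) => //.
    - exact: bdop_mxact.
    - by rewrite FQ// cQ1 starK.
    - move=> u; rewrite (mxactM hs) (mxact_star hs) mxstarK.
      by rewrite sqr_hnsum.
    - move=> u; rewrite (le_trans (Re_le_normc _))//.
      rewrite (le_trans (psd_CS (hsum_psd H d) _ _))// ler_wpM2r ?hnsum_ge0//.
      exact: diag_le.
  have F2 : `|F (mxact sg D \o diag T)| <= t * dl.
    apply: (@sqrt_dominated F _ (mxact sg (D *m mxstar D))
      (fun u => hnsum (mxact sg (mxstar D) u))) => //.
    - exact: bdop_mxact.
    - by rewrite FQ// cQ2.
    - move=> u; rewrite (mxactM hs) (mxact_star hs).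
      by rewrite sqr_hnsum.
    - move=> u; rewrite (le_trans (Re_le_normc _))//=.
      rewrite (mxact_star hs) (le_trans (psd_CS (hsum_psd H d) _ _))//.
      rewrite mulrAC ler_wpM2r ?hnsum_ge0//.
      exact: diag_le.
  have -> : F (diag (sg a \o T)) - F (diag (T \o sg a)) =
      F (mxact sg D \o diag T) - F (diag T \o mxact sg D).
    have h1 : hbd (sg a).
      by exists (cnorm a); [exact: cnorm_ge0|move=> x; exact: rep_le].
    have ba := diag_bdop h1.
    have bTa := bdop_comp bT ba; have baT := bdop_comp ba bT.
    apply/eqP; rewrite subr_eq addrAC eq_sym subr_eq eq_sym; apply/eqP.
    rewrite -!FD//; congr F; apply/funext => u; apply/funext => i.
    rewrite !fctE /diag /= !(mxactB hs) !fctE !mxact_tens1.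
    have T0 : T 0 = 0 by have := Tlin (-1) 0 0; rewrite !scaleN1r !addNr.
    have TD x y : T (x + y) = T x + T y by have := Tlin 1 x y; rewrite !scale1r.
    have TZ (c : R[i]) x : T (c *: x) = c *: T x by have := Tlin c x 0; rewrite !addr0 T0 addr0.
    have TN x : T (- x) = - T x by rewrite -scaleN1r TZ scaleN1r.
    (* The matrix of [1 (x) m] has scalar entries, so the linear [T], acting diagonally, commutes
       with it. *)
    have E : T (mxact sg (tens 1 m) u i) = mxact sg (tens 1 m) (fun i => T (u i)) i.
      rewrite /mxact (big_morph T TD T0); apply: eq_bigr => j _.
      by rewrite mxE !(repZ hs) TZ !(rep1 hs).
    by rewrite TD TN E addrA addrAC.
  rewrite (le_trans (ler_normB _ _))//.
  by rewrite (_ : 2 * t * dl = t * dl + t * dl) ?lerD//; ring.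
Qed.

End Hyperstate.

(** * Construction of the hypertrace *)

Section TraceEstimate.
Variables (R : realType) (M : cstarAlgType R).
Variables (tau : {scalar M}) (ht : tracial_state tau).
Local Notation n2 := (trnorm tau).

(** For [b = phi a], [p = phi (star a * a)] and [q = phi (star a)] the left-hand side is the value
    at [D^* D] required by [hyperstate]. It splits into the distance of [b] from [m] and the defects
    of [phi] in products and adjoints. *)
Lemma trace_defect_le (b m p q : M) :
  Re (tau p - tau (m * q) - tau (star m * b) + tau (m * star m)) <=
  n2 (b - m) ^+ 2 + n2 (p - star b * b) + n2 m * n2 (q - star b).
Proof.
have -> : tau p - tau (m * q) - tau (star m * b) + tau (m * star m) =
    tau (star (b - m) * (b - m)) + tau (p - star b * b) - tau (m * (q - star b)).
  rewrite starB mulrBr !mulrBl !linearB/= mulrBr linearB/=.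
  by rewrite (trace_comm ht (star b) m) (trace_comm ht (star m) m); ring.
rewrite ReB ReD (trnormE ht) /=; apply: lerD.
  rewrite lerD2l (le_trans (le_trans (ler_norm _) (Re_le_normc _)))//.
  exact: trace_norm2_le.
rewrite (le_trans (le_trans (ler_norm _) _) (trace_norm2 ht _ _))//.
by rewrite normrN Re_le_normc.
Qed.

(** Reduction to the other order: replacing [p] by [p - b * star b + star b * b] does not change its
    trace. *)
Lemma trace_defect_le' (b m p q : M) :
  Re (tau p - tau (star m * b) - tau (m * q) + tau (star m * m)) <=
  n2 (b - m) ^+ 2 + n2 (p - b * star b) + n2 m * n2 (q - star b).
Proof.
have := trace_defect_le b m (p - b * star b + star b * b) q; rewrite addrK.
have -> : tau (p - b * star b + star b * b) = tau p.
  by rewrite linearD linearB/= (trace_comm ht b) subrK.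
rewrite (trace_comm ht m (star m)) => h.
by apply: le_trans h; rewrite [tau p - _ - _]addrAC.
Qed.

End TraceEstimate.

Section SpanSystem.
Variables (R : realType) (A : starAlgType R).

Definition lspan (s : seq A) : set A :=
  [set x | exists c : 'I_(size s) -> R[i], x = \sum_i c i *: s`_i].

Lemma lspan_lin s (c : R[i]) x y : lspan s x -> lspan s y -> lspan s (c *: x + y).
Proof.
move=> [a ->] [b ->]; exists (fun i => c * a i + b i).
rewrite scaler_sumr -big_split; apply: eq_bigr => i _ /=.
by rewrite scalerA scalerDl.
Qed.

Lemma lspan_mem s x : x \in s -> lspan s x.
Proof.
move=> xs; have xi : (index x s < size s)%N by rewrite index_mem.
exists (fun i => (i == Ordinal xi)%:R).
rewrite (bigD1 (Ordinal xi))//= eqxx scale1r nth_index// big1 ?addr0// => i.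
by move=> /negPf ->; rewrite scale0r.
Qed.

Lemma lspan_opsys s : 1 \in s -> (forall x, x \in s -> star x \in s) ->
  operator_subsystem (lspan s).
Proof.
move=> s1 ss; split; [exact: lspan_mem|exact: lspan_lin|].
have s0 : lspan s 0.
  by have := lspan_lin (-1) (lspan_mem s1) (lspan_mem s1); rewrite scaleN1r addNr.
move=> _ [c ->]; rewrite (big_morph star (@starD R A) (star0 A)).
elim/big_rec: _ => // i x _ Sx; rewrite starZ; apply: lspan_lin => //.
by apply/lspan_mem/ss/mem_nth.
Qed.

Lemma lspan_finite s : finite_dim (lspan s).
Proof. by exists (size s), (fun i => s`_i). Qed.

Definition quadratic_seq (F : seq A) : seq A :=
  1 :: F ++ map star F ++ map (fun a => star a * a) F ++ map (fun a => a * star a) F.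

Lemma quadratic_opsys F : operator_subsystem (lspan (quadratic_seq F)).
Proof.
apply: lspan_opsys; first by rewrite inE eqxx.
move=> x; rewrite !inE !mem_cat => /orP[/eqP ->|]; first by rewrite star1 eqxx.
move=> h; apply/orP; right; case/or4P: h => [xF|/mapP[a aF ->]|/mapP[a aF ->]|/mapP[a aF ->]].
- by rewrite map_f ?orbT.
- by rewrite starK aF.
- by rewrite starM starK (map_f (fun a => star a * a)) ?orbT.
- by rewrite starM starK (map_f (fun a => a * star a)) ?orbT.
Qed.

Lemma quadratic_mem F a : a \in F -> let S := lspan (quadratic_seq F) in
  [/\ S a, S (star a), S (star a * a) & S (a * star a)].
Proof.
move=> aF S; split; apply: lspan_mem; rewrite inE !mem_cat.
- by rewrite aF orbT.
- by rewrite map_f ?orbT.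
- by rewrite (map_f (fun a => star a * a)) ?orbT.
- by rewrite (map_f (fun a => a * star a)) ?orbT.
Qed.

End SpanSystem.

(** * The trace pulled back from the ultrapower *)

Section UltrapowerTrace.
Variables (R : realType) (M : hyperfinite_II1_factor R).
Variables (omega : set_system nat) (omega_ultra : UltraFilter omega).
Local Notation tau := (factor_trace M).
Let ht := factor_tracial M.
Local Notation n2 := (trnorm tau).
Local Notation J := (null_ideal M omega_ultra).

Lemma null_trnorm (u : linf M) : J u -> n2 (u k) @[k --> omega] --> (0 : R).
Proof. by []. Qed.

Lemma null_near (u : linf M) (e : R) : J u -> 0 < e ->
  \forall k \near omega, n2 (u k) <= e.
Proof.
move=> Ju e0; have /cvgr0Pnorm_lt/(_ e e0) := null_trnorm Ju.
by apply: filterS => k; rewrite ger0_norm ?trnorm_ge0// => /ltW.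
Qed.

(** The norm of a bounded sequence dominates the 2-norms of all its coordinates at once. *)
Lemma null_ideal_closed : closed_ideal J.
Proof.
move=> u l Ju ul; suff : n2 (l k) @[k --> omega] --> (0 : R) by [].
apply/cvgr0Pnorm_lt => e e0.
have e2 : 0 < e / 2 by rewrite divr_gt0.
have [n _ /(_ n (leqnn n)) /= un] := (cvgr0Pnorm_lt _).1 ul _ e2.
rewrite ger0_norm ?cnorm_ge0// in un.
have := null_near (Ju n) (divr_gt0 e2 (ltr0Sn R 1)).
apply: filterS => k uk.
rewrite ger0_norm ?trnorm_ge0// -(subKr (u n k) (l k)).
rewrite (le_lt_trans (seminormB (trform_psd ht) _ _))//.
have h : n2 (u n k - l k) <= cnorm (u n - l).
  by rewrite (le_trans (trnorm_le ht _))//; exact: (linf_norm_ge (u n - l) k).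
have : n2 (u n k) + n2 (u n k - l k) < e by lra.
by [].
Qed.

Definition utrace (u : linf M) : R[i] := ulim omega (fun k => tau (u k)).

Lemma utrace_cbounded (u : linf M) : cbounded (fun k => tau (u k)).
Proof.
exists (cnorm u) => k; rewrite (le_trans (trace_norm2_le ht _))//.
by rewrite (le_trans (trnorm_le ht _))//; exact: linf_norm_ge.
Qed.

Lemma utrace_lin (c : R[i]) (u v : linf M) : utrace (c *: u + v) = c * utrace u + utrace v.
Proof.
rewrite -(ulim_linear omega_ultra); do ?exact: utrace_cbounded.
congr ulim; apply/funext => k.
by rewrite -[(c *: u + v) k]/(c *: u k + v k) linearD linearZ.
Qed.

Lemma utrace_null u : J u -> utrace u = 0.
Proof.
move=> Ju; apply/eqP; rewrite -normr_eq0 normC_real.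
suff : normc (utrace u) <= 0.
  by move=> h; rewrite (_ : normc _ = 0)//; apply/eqP; rewrite eq_le h normc_ge0.
apply/ler_addgt0Pr => e e0; rewrite add0r.
apply: (ulim_normc_le omega_ultra (utrace_cbounded u)).
apply: filterS (null_near Ju e0) => k; apply: le_trans.
exact: trace_norm2_le.
Qed.

Lemma utrace_eq u v : qpi J u = qpi J v -> utrace u = utrace v.
Proof.
move=> /qpiP; rewrite (_ : u - v = -1 *: v + u); last by rewrite scaleN1r addrC.
by move=> /utrace_null; rewrite utrace_lin mulN1r addrC => /eqP; rewrite subr_eq0 => /eqP.
Qed.

Lemma utrace_near (u : linf M) (e : R) : 0 < e ->
  \forall k \near omega, `|Re (tau (u k)) - Re (utrace u)| <= e.
Proof.
move=> e0; have := ulim_Re omega_ultra (utrace_cbounded u).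
move/cvgrPdist_lt => /(_ e e0); apply: filterS => k /ltW.
by rewrite distrC.
Qed.

Variable A : cstarAlgType R.
Variable pi : {lrmorphism A -> tracial_ultrapower M omega_ultra}.
Hypothesis pi_star : forall a, pi (star a) = star (pi a).

Lemma pi_ucp : @ucp_on R A (star_quot J) setT pi.
Proof.
split; first by move=> c x y _ _; exact: linearP.
  exact: rmorph1.
move=> n X _ [Y ->]; exists (map_mx pi Y); rewrite map_mxM; congr (_ *m _).
by apply/matrixP => i j; rewrite !mxE; exact: pi_star.
Qed.

Lemma linf_sum_eval I (r : seq I) (F : I -> linf M) k :
  (\sum_(i <- r) F i) k = \sum_(i <- r) F i k.
Proof. exact: (big_morph (fun u : linf M => u k)). Qed.

Lemma eval_ucp (S : set A) (psi : A -> linf M) k :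
  ucp_on S psi -> ucp_on S (fun a => psi a k : M).
Proof.
move=> hpsi; split.
- by move=> c x y Sx Sy; rewrite (ucp_linear hpsi).
- by rewrite (ucp_unital hpsi).
- move=> n X SX /(ucp_cp hpsi SX)[Y XY].
  exists (map_mx (fun u : linf M => u k : M) Y); apply/matrixP => i j.
  have /matrixP/(_ i j) := XY; rewrite !mxE => ->; rewrite linf_sum_eval.
  by apply: eq_bigr => l _; rewrite !mxE.
Qed.

(** An arbitrary choice of representatives; by [utrace_eq] the trace does not see it. *)
Definition ulift (a : A) : linf M := projT1 (cid (qpi_surj (pi a))).

Lemma uliftP a : pi a = qpi J (ulift a).
Proof. by rewrite /ulift; case: cid. Qed.

Definition pulled_trace (a : A) : R[i] := utrace (ulift a).

Lemma pulled_traceE a u : pi a = qpi J u -> pulled_trace a = utrace u.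
Proof. by move=> au; apply: utrace_eq; rewrite -uliftP. Qed.

Lemma pulled_trace_scalar : scalar pulled_trace.
Proof.
move=> c a b; rewrite -utrace_lin; apply: pulled_traceE.
by rewrite linearP qpiD qpiZ -!uliftP.
Qed.

Lemma pulled_trace_star a : pulled_trace (star a) = Num.conj (pulled_trace a).
Proof.
rewrite (@pulled_traceE _ (star (ulift a))); last by rewrite pi_star uliftP; exact/esym/qpi_star.
rewrite /pulled_trace /utrace -(ulim_conj omega_ultra); last exact: utrace_cbounded.
congr ulim; apply/funext => k.
by rewrite -[star (ulift a) k]/(star (ulift a k)) (trace_star ht).
Qed.

Lemma pulled_trace_pos a : 0 <= pulled_trace (star a * a).
Proof.
rewrite (@pulled_traceE _ (star (ulift a) * ulift a)).
  apply: ulim_ge0; first exact: utrace_cbounded.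
  by move=> k; exact: (trace_positive ht).
rewrite rmorphM /= pi_star uliftP; apply/esym; apply: etrans (qpiM J _ _) _.
by congr qmul; exact: qpi_star.
Qed.

Lemma pulled_trace1 : pulled_trace 1 = 1.
Proof.
rewrite (@pulled_traceE _ 1); last by rewrite rmorph1.
rewrite /utrace -[RHS](ulim_cst omega_ultra); congr ulim.
by apply/funext => k; exact: (trace_unital ht).
Qed.

Lemma pulled_trace_comm a b : pulled_trace (a * b) = pulled_trace (b * a).
Proof.
rewrite (@pulled_traceE _ (ulift a * ulift b)); last by rewrite rmorphM /= !uliftP qpiM.
rewrite (@pulled_traceE (b * a) (ulift b * ulift a)); last by rewrite rmorphM /= !uliftP qpiM.
by congr ulim; apply/funext => k; exact: (trace_comm ht).
Qed.

End UltrapowerTrace.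

Lemma near_seq (I : Type) (T : eqType) (U : set_system I) (P : T -> I -> Prop)
    (s : seq T) : Filter U ->
  (forall a, a \in s -> \forall k \near U, P a k) ->
  \forall k \near U, forall a, a \in s -> P a k.
Proof.
move=> FU; elim: s => [|a s ih] h; first by apply: nearW.
have h1 := h a (mem_head a s).
have h2 : \forall k \near U, forall b, b \in s -> P b k.
  by apply: ih => b bs; apply: h; rewrite inE bs orbT.
apply: filterS2 h1 h2 => k h1 h2 b; rewrite inE => /orP[/eqP ->//|].
exact: h2.
Qed.

(** * Approximate hypertraces *)

Section Amenable.
Variables (R : realType) (A : cstarAlgType R) (M : hyperfinite_II1_factor R).
Variables (omega : set_system nat) (omega_ultra : UltraFilter omega).
Hypothesis hA : LLP A.
Variable pi : {lrmorphism A -> tracial_ultrapower M omega_ultra}.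
Hypothesis pi_star : forall a, pi (star a) = star (pi a).
Variables (H : hilbertType R) (sg : A -> H -> H) (hs : faithful_rep sg).
Local Notation tau := (factor_trace M).
Let ht := factor_tracial M.
Local Notation n2 := (trnorm tau).
Local Notation J := (null_ideal M omega_ultra).
Local Notation ptr := (pulled_trace pi).

Record hypertrace_approx (F : seq A) (e : R) (f : (H -> H) -> R) : Prop := {
  approxD : forall T T', hbd T -> hbd T' -> f (T + T') = f T + f T';
  approxZ : forall (r : R) T, hbd T -> f (r%:C *: T) = r * f T;
  approx_pos : forall T, hbd T -> (forall x, 0 <= Re (inner (T x) x)) -> 0 <= f T;
  approx1 : f id = 1;
  approx_trace : forall a, a \in F -> `|f (sg a) - Re (ptr a)| <= e;
  approx_comm : forall a (t : R) (T : H -> H), a \in F -> linear T -> 0 <= t ->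
    (forall x, hnorm (T x) <= t * hnorm x) ->
    `|f (sg a \o T) - f (T \o sg a)| <= 2 * t * e
}.

Lemma hypertrace_approx_exists (F : seq A) (e : R) : 0 < e ->
  exists f, hypertrace_approx F e f.
Proof.
move=> e0; pose S := lspan (quadratic_seq F).
have hS : operator_subsystem S := quadratic_opsys F.
have [psi [hpsi psiq]] := hA (@null_ideal_closed _ M _ omega_ultra) (pi_ucp pi_star) hS
  (lspan_finite (quadratic_seq F)).
have ptrE a : S a -> ptr a = utrace omega (psi a).
  by move=> Sa; apply: pulled_traceE; rewrite psiq.
pose B a := cnorm (psi a).
have B0 a : 0 <= B a := cnorm_ge0 _.
(* Chosen so that [et a + (B a + 1) * et a = e ^+ 2 / 2], where [B a + 1] will bound the 2-norm of
   [m]; the other half of [e ^+ 2] goes to the distance from [N]. *)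
pose et a := e ^+ 2 / (2 * (B a + 2)).
have et0 a : 0 < et a by rewrite divr_gt0 ?exprn_gt0// mulr_gt0// ltr_wpDl.
pose good a k := [/\ `|Re (tau (psi a k)) - Re (ptr a)| <= e,
  `|Re (tau (psi (star a) k)) - Re (ptr (star a))| <= e,
  n2 (psi (star a * a) k - star (psi a k) * psi a k) <= et a,
  n2 (psi (a * star a) k - psi a k * star (psi a k)) <= et a &
  n2 (psi (star a) k - star (psi a k)) <= et a].
have [k hk] : exists k, forall a, a \in F -> good a k.
  apply: (@filter_ex _ omega); apply: near_seq => a aF.
  have [Sa Sa' Saa Saa'] := quadratic_mem aF.
  (* Two lifts of one element of the ultrapower differ by a null sequence: multiplicativity of [pi]
     becomes approximate multiplicativity of [psi] at coordinates near [omega]. *)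
  have jn x (u : linf M) : S x -> pi x = qpi J u ->
      \forall k \near omega, n2 (psi x k - u k) <= et a.
    move=> Sx xu; apply: (@null_near R M omega omega_ultra (psi x - u)) => //.
    by apply/qpiP; rewrite psiq.
  have qa : pi a = qpi J (psi a) by rewrite psiq.
  have n1 := utrace_near omega_ultra (psi a) e0; rewrite -ptrE// in n1.
  have n3 := utrace_near omega_ultra (psi (star a)) e0; rewrite -ptrE// in n3.
  have m1 := jn (star a * a) (star (psi a) * psi a) Saa.
  have m2 := jn (a * star a) (psi a * star (psi a)) Saa'.
  have m3 := jn (star a) (star (psi a)) Sa'.
  have {}m1 := m1 _; have {}m2 := m2 _; have {}m3 := m3 _.
  have e3 : pi (star a) = qpi J (star (psi a)) by rewrite pi_star qa qpi_star.
  have e1 : pi (star a * a) = qpi J (star (psi a) * psi a).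
    by rewrite rmorphM /= e3 qa qpiM.
  have e2 : pi (a * star a) = qpi J (psi a * star (psi a)).
    by rewrite rmorphM /= e3 qa qpiM.
  apply: filterS2 (filterI n1 n3) (filterI (m1 e1) (filterI (m2 e2) (m3 e3))).
  by move=> k [g1 g2] [g3 [g4 g5]]; split.
pose phi a : M := psi a k.
have hphi : ucp_on S phi := eval_ucp k hpsi.
have [N [hN Nmono Ndense]] := factor_dense M.
(* A bound for the squared 2-norm of [phi a - m]: the [1] keeps the 2-norm of [m] below [B a + 1],
   the other term is the remaining half of [e ^+ 2]. *)
pose dl := Num.min 1 (e ^+ 2 / 2).
have dl0 : 0 < dl by rewrite lt_min ltr01 divr_gt0// exprn_gt0.
have [n hn] : exists n, forall a, a \in F -> exists m, N n m /\ n2 (phi a - m) ^+ 2 <= dl.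
  elim: (F) => [|a s [n ih]]; first by exists 0%N.
  have [n' [m [Nm hm]]] := Ndense (phi a) _ dl0.
  exists (maxn n n') => b; rewrite inE => /orP[/eqP ->|/ih[m' [Nm' hm']]].
    exists m; split; first exact: Nmono (leq_maxr n n') _ Nm.
    move: hm; rewrite (trnormE ht) normc_real ger0_norm//.
    by rewrite exprn_ge0 ?trnorm_ge0.
  by exists m'; split=> //; exact: Nmono (leq_maxl n n') _ Nm'.
have [hNn fNn] := hN n.
have [d [b [hb bbasis]]] := orthonormal_basis ht (@factor_faithful R M) hNn fNn.
have [hio _] := factor_von_neumann M.
have [z [zS zN zcz]] := index_elt_rsqrt hio ht hNn hb bbasis.
have [f [[fD fZ fpos f1] ftr fcomm]] :=
  hyperstate hs ht hNn hb bbasis zS zN zcz hS hphi.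
exists f; split=> //.
- move=> a aF; have [Sa Sa' _ _] := quadratic_mem aF.
  have [g1 g2 _ _ _] := hk a aF.
  rewrite ftr// ReD.
  (* The functional averages the values at [a] and [star a]; both have real part near that of
     [ptr a]. *)
  have ss : Re (ptr (star a)) = Re (ptr a).
    by rewrite pulled_trace_star// Re_conj.
  rewrite ss in g2; move: g1 g2; rewrite !ler_norml -/(phi a) -/(phi (star a)).
  by move=> /andP[g1 g2] /andP[g3 g4]; apply/andP; split; lra.
- move=> a t T aF Tlin t0 Tt; have [Sa Sa' Saa Saa'] := quadratic_mem aF.
  have [_ _ g3 g4 g5] := hk a aF.
  have [m [Nm hm]] := hn a aF.
  have mB : n2 m <= B a + 1.
    rewrite -(subKr (phi a) m) (le_trans (seminormB (trform_psd ht) _ _))// lerD//.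
      rewrite (le_trans (trnorm_le ht _))//; exact: linf_norm_ge.
    rewrite -(ler_pXn2r (n := 2)) ?nnegrE ?seminorm_ge0// expr1n (le_trans hm)//.
    by rewrite /dl ge_min lexx.
  have dle : n2 (phi a - m) ^+ 2 <= e ^+ 2 / 2.
    by rewrite (le_trans hm)// /dl ge_min lexx orbT.
  have prod : n2 m * n2 (phi (star a) - star (phi a)) <= (B a + 1) * et a.
    by apply: ler_pM; rewrite ?trnorm_ge0.
  have etE : et a + (B a + 1) * et a = e ^+ 2 / 2.
    rewrite /et; field; rewrite gt_eqF//; have := B0 a; lra.
  apply: (fcomm a m) => //.
    apply: le_trans (trace_defect_le ht _ _ _ _) _.
    by move: dle g3 prod etE; rewrite -/(phi (star a * a)) -/(phi a); lra.
  apply: le_trans (trace_defect_le' ht _ _ _ _) _.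
  by move: dle g4 prod etE; rewrite -/(phi (a * star a)) -/(phi a); lra.
Qed.

(** Length is recorded beside membership because the precision attached to a list will be [eps] of
    its length; repetitions make every length available. *)
Let listle (G : seq A) : set (seq A) :=
  [set F : seq A | (forall a, a \in G -> a \in F) /\ (size G <= size F)%N].

Lemma list_ultrafilter : exists U : set_system (seq A), UltraFilter U /\
  forall G, U (listle G).
Proof.
have [|U [UU hU]] := @ultraFilterLemma (seq A) (filter_from setT listle).
  apply: filter_from_proper; last by move=> G _; exists G; split.
  apply: filter_fromT_filter; first by exists [::].
  move=> G1 G2; exists (G1 ++ G2) => F [h hF]; split; split.
  - by move=> a aG; apply: h; rewrite mem_cat aG.
  - by apply: leq_trans hF; rewrite size_cat leq_addr.
  - by move=> a aG; apply: h; rewrite mem_cat aG orbT.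
  - by apply: leq_trans hF; rewrite size_cat leq_addl.
by exists U; split=> // G; apply: hU; exists G.
Qed.

(** Both [t id + T] and [t id - T] are accretive. The bound depends on neither [F] nor [e], which
    makes the ultralimit exist. *)
Lemma approx_bound F e f T (t : R) : hypertrace_approx F e f -> 0 <= t ->
  (forall x, hnorm (T x) <= t * hnorm x) -> `|f T| <= t.
Proof.
move=> [fD fZ fpos f1 _ _] t0 Tt.
have bT : hbd T by exists t.
have bi (c : R) : hbd (c%:C *: (id : H -> H)).
  exists `|c| => // x.
  by rewrite [leLHS](seminormZ (inner_psd H)) normc_real lexx.
have bcT (c : R) : hbd (c%:C *: T).
  exists (`|c| * t); first exact: mulr_ge0.
  move=> x; rewrite [leLHS](seminormZ (inner_psd H)) normc_real -mulrA ler_wpM2l//.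
  exact: Tt.
have bid : hbd (id : H -> H) by exists 1 => // x; rewrite mul1r.
have h (c : R) : `|c| <= 1 -> 0 <= t + c * f T.
  move=> c1; rewrite -{1}[t]mulr1 -f1 -!fZ// -fD//; apply: fpos.
    exists (t + t); first exact: addr_ge0.
    move=> x; rewrite (le_trans (hnormD _ _))// mulrDl lerD//.
      by rewrite [hnorm _](seminormZ (inner_psd H)) normc_real ger0_norm.
    rewrite [hnorm _](seminormZ (inner_psd H)) normc_real (le_trans _ (Tt x))//.
    by rewrite -[leRHS]mul1r ler_wpM2r ?hnorm_ge0.
  move=> x; have -> : (t%:C *: (id : H -> H) + c%:C *: T) x = t%:C *: x + c%:C *: T x by [].
  rewrite (psdDl (inner_psd H)) !(psdZl (inner_psd H)) ReD !ReZ (seminormE (inner_psd H)) /=.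
  have : `|c * Re (inner (T x) x)| <= t * hnorm x ^+ 2.
    rewrite normrM (le_trans (_ : _ <= 1 * normc (inner (T x) x)))//.
      by apply: ler_pM => //; exact: Re_le_normc.
    rewrite mul1r (le_trans (psd_CS (inner_psd H) _ _))// expr2 mulrA.
    by rewrite ler_wpM2r ?hnorm_ge0//; exact: Tt.
  by rewrite ler_norml -[seminorm _ x]/(hnorm x) => /andP[]; lra.
have := h 1; have := h (-1); rewrite normrN normr1 lexx => /(_ isT) h1 /(_ isT) h2.
by rewrite ler_norml; apply/andP; split; lra.
Qed.

Lemma bounded_op_hbd (T : H -> H) : bounded_op T -> hbd T.
Proof.
move=> [Tlin Tcont].
have T0 : T 0 = 0 by have := Tlin (-1) 0 0; rewrite !scaleN1r !addNr.
have TZ (c : R[i]) x : T (c *: x) = c *: T x by have := Tlin c x 0; rewrite !addr0 T0 addr0.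
have : T x @[x --> (0 : H)] --> T 0 := Tcont 0.
rewrite T0 => /cvgr0Pnorm_lt/(_ 1 ltr01).
move=> /nbhs_ballP[d /= d0 hd].
have dE := ge0_ReE (ltW d0).
have r0 : 0 < Re d by rewrite -ltcR -dE.
exists (2 / Re d); first by rewrite divr_ge0// ltW.
move=> x; have [x0|x0] := eqVneq (hnorm x) 0.
  have -> : x = 0 by apply: hnorm_le0; rewrite x0.
  by rewrite T0 /hnorm (seminorm0 (inner_psd H)) mulr0.
have xp : 0 < hnorm x by rewrite lt_def x0 hnorm_ge0.
pose c : R := Re d / (2 * hnorm x).
have c0 : 0 < c by rewrite divr_gt0// mulr_gt0.
have := hd (c%:C *: x); rewrite -ball_normE /= sub0r normrN !hnormE.
have hZ y : hnorm (c%:C *: y) = c * hnorm y.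
  by rewrite hnormZ normc_real ger0_norm// ltW.
rewrite hZ {1}dE ltcR TZ hZ -(rmorph1 (real_complex R)) ltcR.
have -> : c * hnorm x = Re d / 2 by rewrite /c; field.
have -> : Re d / 2 < Re d by rewrite ltr_pdivrMr// mulr2n mulrDr mulr1 ltrDl.
move=> /(_ isT) h; rewrite -(ler_pM2l c0).
have -> : c * (2 / Re d * hnorm x) = 1 by rewrite /c; field; rewrite !gt_eqF.
exact: ltW.
Qed.

End Amenable.

(** * Ultralimit of the approximations and complexification *)

Section Hypertrace.
Variables (R : realType) (A : cstarAlgType R) (M : hyperfinite_II1_factor R).
Variables (omega : set_system nat) (omega_ultra : UltraFilter omega).
Hypothesis hA : LLP A.
Variable pi : {lrmorphism A -> tracial_ultrapower M omega_ultra}.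
Hypothesis pi_star : forall a, pi (star a) = star (pi a).
Variables (H : hilbertType R) (sg : A -> H -> H) (hs : faithful_rep sg).
Local Notation ptr := (pulled_trace pi).

Lemma real_hypertrace : exists g : (H -> H) -> R,
  [/\ forall T T', hbd T -> hbd T' -> g (T + T') = g T + g T',
      forall (r : R) T, hbd T -> g (r%:C *: T) = r * g T,
      forall T, hbd T -> (forall x, 0 <= Re (inner (T x) x)) -> 0 <= g T &
      [/\ g id = 1, forall a, g (sg a) = Re (ptr a) &
      forall a T, bounded_op T -> g (sg a \o T) = g (T \o sg a)]].
Proof.
(* The precision is tied to the length of [F], so that a single ultrafilter on lists exhausts [A]
   and sends the error to [0]. *)
have /choice[f hf] := fun F => hypertrace_approx_exists hA pi_star hs F (eps_gt0 R (size F)).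
have [U [UU hU]] := list_ultrafilter A.
have Usize n : \forall F \near U, (n <= size F)%N.
  by apply: filterS (hU (nseq n 1)) => F [_]; rewrite size_nseq.
have Umem a : \forall F \near U, a \in F.
  by apply: filterS (hU [:: a]) => F [+ _]; apply; rewrite inE.
pose g T := lim (f F T @[F --> U]).
have gT T : hbd T -> f F T @[F --> U] --> g T.
  move=> [t t0 Tt]; have [F|l fl] := @bounded_ultralimit R _ U (f^~ T) t UU.
    exact: approx_bound (hf F) t0 Tt.
  by rewrite /g (cvg_lim _ fl).
have glim T (l : R) : f F T @[F --> U] --> l -> g T = l.
  by move=> fl; rewrite /g (cvg_lim _ fl).
have small (e : R) : 0 < e -> \forall F \near U, eps R (size F) <= e.
  move=> e0; have [N hN] := eps_small e0.
  by apply: filterS (Usize N) => F /hN/ltW.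
have hsg a : hbd (sg a).
  by exists (cnorm a); [exact: cnorm_ge0|move=> x; exact: rep_le].
have hcomp (T T' : H -> H) : hbd T -> hbd T' -> hbd (T \o T').
  move=> [t t0 Tt] [t' t'0 Tt']; exists (t * t'); first exact: mulr_ge0.
  by move=> x /=; rewrite (le_trans (Tt _))// -mulrA ler_wpM2l.
exists g; split.
- move=> T T' bT bT'; apply: glim.
  rewrite (_ : (fun F => _) = fun F => f F T + f F T'); first by apply: cvgD; exact: gT.
  by apply/funext => F; rewrite (approxD (hf F)).
- move=> r T bT; apply: glim.
  rewrite (_ : (fun F => _) = fun F => r * f F T); first by apply: cvgMr; exact: gT.
  by apply/funext => F; rewrite (approxZ (hf F)).
- move=> T bT Tpos; apply: (cvgr_to_ge (gT _ bT)); apply: nearW => F.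
  exact: (approx_pos (hf F)).
split.
- apply: glim; rewrite (_ : (fun F => _) = fun=> 1); first exact: cvg_cst.
  by apply/funext => F; rewrite (approx1 (hf F)).
- move=> a; apply: glim; apply/cvgrPdist_le => e e0.
  apply: filterS2 (Umem a) (small e e0) => F aF Fe.
  by rewrite distrC (le_trans (approx_trace (hf F) aF)).
- move=> a T bT; have hT := bounded_op_hbd bT; have [t t0 Tt] := hT.
  have b1 := hcomp _ _ (hsg a) hT; have b2 := hcomp _ _ hT (hsg a).
  apply/eqP; rewrite -subr_eq0; apply/eqP.
  rewrite -(cvg_lim _ (cvgB (gT _ b1) (gT _ b2)))//.
  apply: cvg_lim => //; apply/cvgr0Pnorm_le => e e0.
  have d0 : 0 < e / (2 * t + 1) by rewrite divr_gt0// ltr_wpDl// mulr_ge0.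
  apply: filterS2 (Umem a) (small _ d0) => F aF Fe.
  have := approx_comm (hf F) aF bT.1 t0 Tt; rewrite !fctE /= => /le_trans; apply.
  apply: (@le_trans _ _ (2 * t * (e / (2 * t + 1)))); first by rewrite ler_wpM2l// mulr_ge0.
  rewrite mulrCA -[leRHS]mulr1 ler_wpM2l ?(ltW e0)//.
  by rewrite ler_pdivrMr ?ltr_wpDl ?mulr_ge0// mul1r lerDl.
Qed.

(** The identities of the real functional pass to the imaginary part because the factor [i] can be
    absorbed into [a]: [i sg a = sg (i a)]. Positivity needs in addition that the imaginary part
    vanishes on positive operators. *)
Lemma hypertrace_exists : exists rho : (H -> H) -> R[i],
  [/\ BH_state rho, forall a, rho (sg a) = ptr a &
      forall a T, bounded_op T -> rho (sg a \o T) = rho (T \o sg a)].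
Proof.
have [g [gD gZ gpos [g1 gtr gcomm]]] := real_hypertrace.
have hZ (c : R[i]) (T : H -> H) : hbd T -> hbd (c *: T).
  move=> [t t0 Tt]; exists (normc c * t); first by rewrite mulr_ge0 ?normc_ge0.
  by move=> x; rewrite [leLHS]hnormZ -mulrA ler_wpM2l ?normc_ge0.
have hid : hbd (id : H -> H) by exists 1 => // x; rewrite mul1r.
have rlin := complexify_linear (D := @hbd R H) gD gZ hZ.
(* For positive [T], the quadratic forms of [i T] and of [- i T] have real part [0], so both
   operators are accretive and the value is squeezed between [0] and [0]. *)
have skew T : hbd T -> (forall x, 0 <= inner (T x) x) -> g ('i%C *: T) = 0.
  move=> bT Tpos.
  have iT x : Re (inner ('i%C *: T x) x) = 0.
    rewrite (psdZl (inner_psd H)) (ge0_ReE (Tpos x)); by simpc.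
  have h1 : 0 <= g ('i%C *: T).
    by apply: gpos => [|x]; [exact: hZ|rewrite [Re _]iT].
  have h2 : 0 <= g ((-1)%:C *: ('i%C *: T)).
    apply: gpos => [|x]; first exact/hZ/hZ.
    have -> : ((-1)%:C *: ('i%C *: T)) x = (-1)%:C *: ('i%C *: T x) by [].
    by rewrite (psdZl (inner_psd H)) ReZ iT mulr0.
  rewrite gZ in h2; last exact: hZ.
  by apply/eqP; rewrite eq_le h1 andbT; lra.
have inner_ge0 (x : H) : 0 <= inner x x := psd_ge0 (inner_psd H) x.
exists (complexify g); split.
- split.
  + move=> c S T bS bT.
    exact: (rlin c S T (bounded_op_hbd bS) (bounded_op_hbd bT)).
  + move=> T bT Tpos; rewrite /complexify skew//; last exact: bounded_op_hbd.
    rewrite oppr0 lecE /= eqxx /=; apply: gpos; first exact: bounded_op_hbd.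
    by move=> x; exact: Re_ge0.
  + by rewrite /complexify g1 skew// oppr0.
- move=> a; rewrite /complexify gtr.
  have -> : 'i%C *: sg a = sg ('i%C *: a).
    by apply/funext => x; rewrite fctE (repZ hs).
  rewrite gtr; have := pulled_trace_scalar pi 'i%C a 0.
  have p0 : ptr 0 = 0.
    have := pulled_trace_scalar pi 1 0 0; rewrite scale1r addr0 mul1r.
    by move/(congr1 (+%R^~ (- ptr 0))); rewrite subrr addrK.
  rewrite addr0 p0 addr0 => ->; case: (ptr a) => x y; simpc.
  by [].
- move=> a T bT; rewrite /complexify gcomm//; congr Complex; congr (- _).
  have -> : 'i%C *: (sg a \o T) = sg ('i%C *: a) \o T.
    by apply/funext => x; rewrite /= fctE (repZ hs).
  rewrite gcomm//; congr g; apply/funext => x /=.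
  have [Tlin _] := bT.
  have T0 : T 0 = 0 by have := Tlin (-1) 0 0; rewrite !scaleN1r !addNr.
  by rewrite (repZ hs) fctE; have := Tlin 'i%C (sg a x) 0; rewrite !addr0 T0 addr0.
Qed.

End Hypertrace.

Theorem corollary4p2 (R : realType) (A : cstarAlgType R)
    (M : hyperfinite_II1_factor R)
    (omega : set_system nat) (omega_ultra : UltraFilter omega)
    (omega_free : forall n : nat, ~ omega [set n]) :
  LLP A ->
  (exists tau : {scalar A}, amenable_trace tau) \/
  ~ (exists pi : {lrmorphism A -> tracial_ultrapower M omega_ultra},
       forall a : A, pi (star a) = star (pi a)).
Proof.
move=> hA; have [[pi pi_star]|npi] := pselect
  (exists pi : {lrmorphism A -> tracial_ultrapower M omega_ultra},
     forall a : A, pi (star a) = star (pi a)); last by right.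
left; pose tlin := GRing.isLinear.Build _ _ _ _ (pulled_trace pi) (pulled_trace_scalar pi).
pose tau : {scalar A} := HB.pack (pulled_trace pi) tlin.
exists tau; split; first split.
- by move=> x; exact: pulled_trace_pos.
- exact: pulled_trace1.
- exact: pulled_trace_comm.
- by move=> H sg hs; exact: (hypertrace_exists hA pi_star hs).
Qed.
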